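(* For each $m\in\mathbb{N}$ (with $m\ge1$), there exist a complex infinite-dimensional Banach space $Y$ and continuous algebra homomorphisms $\psi:\mathcal{B}(Y)\to\mathcal{T}_m(\mathbb{C})$ and $\theta:\mathcal{T}_m(\mathbb{C})\to\mathcal{B}(Y)$ giving a strongly split exact sequence $$\{0\}\longrightarrow\mathcal{S}(Y)\xrightarrow{\ \iota\ }\mathcal{B}(Y)\xrightarrow{\ \psi\ }\mathcal{T}_m(\mathbb{C})\longrightarrow\{0\};$$ that is, the sequence is exact (where $\iota$ is the inclusion) and $\psi\circ\theta=\operatorname{id}_{\mathcal{T}_m(\mathbb{C})}$.
   Context: $\mathcal{B}(Y)$ is the Banach algebra of continuous linear maps $Y\to Y$. $\mathcal{S}(Y)$ is the closed ideal of strictly singular operators on $Y$: those $S\in\mathcal{B}(Y)$ such that every subspace of $Y$ on which $S$ is bounded below is finite-dimensional. $\mathcal{T}_m(\mathbb{C})$ is the algebra of upper triangular complex $m\times m$ matrices. A short exact sequence of Banach algebras and continuous homomorphisms is strongly split exact if the surjection has a continuous algebra homomorphism as right inverse. *)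

(* Defs.v *)
From HB Require Import structures.
From mathcomp Require Import all_boot all_order all_algebra.
From mathcomp Require Import complex.
From mathcomp Require Import all_classical all_reals all_analysis.

Set Implicit Arguments.
Unset Strict Implicit.
Unset Printing Implicit Defensive.

Import Order.TTheory GRing.Theory Num.Theory.
Import numFieldNormedType.Exports.

Local Open Scope classical_set_scope.
Local Open Scope ring_scope.
Local Open Scope complex_scope.

Section BoundedOperators.
Context {K : numFieldType} (Y : normedModType K).

Definition bop_pred : {pred Y -> Y} := mem [set f | linear f /\ continuous f].

Record bop := BOp { bop_fun :> Y -> Y ; bop_mem : bop_fun \in bop_pred }.

HB.instance Definition _ := [isSub for bop_fun].
HB.instance Definition _ := [Choice of bop by <:].

Lemma bop_linear (f : bop) : linear f.
Proof. by have := bop_mem f; rewrite inE => -[]. Qed.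

Lemma bop_continuous (f : bop) : continuous f.
Proof. by have := bop_mem f; rewrite inE => -[]. Qed.

HB.instance Definition _ (f : bop) := @GRing.isLinear.Build K Y Y *:%R f (bop_linear f).

Lemma bop_submod_closed : submod_closed bop_pred.
Proof.
split=> [|a f g]; rewrite !inE.
  split; first by move=> a x y; rewrite /= scaler0 addr0.
  by move=> x; exact: cst_continuous.
move=> [lf cf] [lg cg]; split.
  move=> b x y; rewrite !fctE lf lg !scalerDr !scalerA addrACA.
  by rewrite [b * a]mulrC.
move=> x; apply: (@continuousD _ _ _ (a *: f) g x); last exact: cg.
by apply: continuousZl_tmp; exact: cf.
Qed.

HB.instance Definition _ := GRing.isSubmodClosed.Build K (Y -> Y) bop_pred bop_submod_closed.
HB.instance Definition _ := [SubChoice_isSubLmodule of bop by <:].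

Lemma bop_id_subproof : idfun \in bop_pred.
Proof. by rewrite inE; split=> // x; exact: cvg_id. Qed.

Definition bop_id : bop := BOp bop_id_subproof.

Lemma bop_comp_subproof (f g : bop) : (f \o g) \in bop_pred.
Proof.
rewrite inE; split; first by move=> a x y; rewrite /= !linearP.
by move=> x; apply: continuous_comp; exact: bop_continuous.
Qed.

Definition bop_comp (f g : bop) : bop := BOp (bop_comp_subproof f g).

Lemma bop_compA : associative bop_comp.
Proof. by move=> f g h; exact/val_inj. Qed.

Lemma bop_comp1f : left_id bop_id bop_comp.
Proof. by move=> f; exact/val_inj. Qed.

Lemma bop_compf1 : right_id bop_id bop_comp.
Proof. by move=> f; exact/val_inj. Qed.

Lemma bop_compDl : left_distributive bop_comp +%R.
Proof. by move=> f g h; exact/val_inj. Qed.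

Lemma bop_compDr : right_distributive bop_comp +%R.
Proof.
by move=> f g h; apply/val_inj/funext => x /=; rewrite !fctE /= linearD.
Qed.

HB.instance Definition _ := GRing.Zmodule_isPzRing.Build bop
  bop_compA bop_comp1f bop_compf1 bop_compDl bop_compDr.

End BoundedOperators.

Section OperatorNorm.
Context {R : realType} (Y : normedModType R[i]).
Implicit Types f g : bop Y.

(* Norms on R[i]-normed modules take values in R[i], where suprema are not
   available; they are real, so the supremum is taken over their real parts. *)
Definition opnorm f : R[i] :=
  (sup [set complex.Re `|f x| | x in [set x : Y | `|x| <= 1]])%:C.

Lemma opnorm_has_sup f :
  has_sup [set complex.Re `|f x| | x in [set x : Y | `|x| <= 1]].
Proof.
split; first by exists (complex.Re `|f 0|), 0 => //=; rewrite normr0.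
have /linear_bounded_continuous/linear_boundedP := @bop_continuous _ _ f.
move=> /pinfty_ex_gt0[M M0 fM]; exists (complex.Re M) => _ /= [x x1 <-].
rewrite -lecR !RRe_real ?normr_real ?gtr0_real//.
by rewrite (le_trans (fM x))// ler_piMr// ltW.
Qed.

Lemma opnorm_ge0 f : 0 <= opnorm f.
Proof.
rewrite /opnorm lecR; apply: ub_le_sup; first by have [] := opnorm_has_sup f.
by exists 0; rewrite /= ?normr0 ?ler01// linear0 normr0.
Qed.

Lemma le_opnorm f x : `|f x| <= opnorm f * `|x|.
Proof.
have [->|x0] := eqVneq x 0; first by rewrite linear0 !normr0 mulr0.
have nx : 0 < `|x| by rewrite normr_gt0.
rewrite -ler_pdivrMr// mulrC -[X in X * _]gtr0_norm ?invr_gt0// -normrZ.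
rewrite -linearZ /opnorm -[leLHS]RRe_real ?normr_real// lecR.
apply: ub_le_sup; first by have [] := opnorm_has_sup f.
exists (`|x|^-1 *: x) => //=.
by rewrite normrZ gtr0_norm ?invr_gt0// mulVf// gt_eqF.
Qed.

Lemma ge_opnorm f (M : R[i]) :
  (forall x, `|x| <= 1 -> `|f x| <= M) -> opnorm f <= M.
Proof.
move=> fM; have M0 : 0 <= M.
  by rewrite (le_trans _ (fM 0 _)) ?normr_ge0// normr0.
rewrite /opnorm -[leRHS]RRe_real ?ger0_real// lecR.
apply: ge_sup; first by have [] := opnorm_has_sup f.
move=> _ [x x1 <-]; rewrite -lecR !RRe_real ?normr_real ?ger0_real//.
exact: fM.
Qed.

Lemma opnormD f g : opnorm (f + g) <= opnorm f + opnorm g.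
Proof.
apply: ge_opnorm => x x1; rewrite (le_trans (ler_normD _ _))// lerD//.
  by rewrite (le_trans (le_opnorm f x))// ler_piMr// opnorm_ge0.
by rewrite (le_trans (le_opnorm g x))// ler_piMr// opnorm_ge0.
Qed.

Lemma opnormZ_le (a : R[i]) f : opnorm (a *: f) <= `|a| * opnorm f.
Proof.
apply: ge_opnorm => x x1; rewrite [_ x]/(a *: f x) normrZ ler_wpM2l//.
by rewrite (le_trans (le_opnorm f x))// ler_piMr// opnorm_ge0.
Qed.

Lemma opnormZ (a : R[i]) f : opnorm (a *: f) = `|a| * opnorm f.
Proof.
apply/eqP; rewrite eq_le opnormZ_le/=.
have [->|a0] := eqVneq a 0; first by rewrite normr0 mul0r opnorm_ge0.
rewrite -ler_pdivlMl ?normr_gt0// -normfV.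
by rewrite -{1}[f]scale1r -(mulVf a0) -scalerA opnormZ_le.
Qed.

Lemma opnorm0_eq0 f : opnorm f = 0 -> f = 0.
Proof.
move=> f0; apply/val_inj/funext => x; apply/eqP.
by rewrite -normr_le0 (le_trans (le_opnorm f x))// f0 mul0r.
Qed.

HB.instance Definition _ := Lmodule_isNormed.Build R[i] (bop Y)
  opnormD opnormZ opnorm0_eq0.

End OperatorNorm.

Section UpperTriangular.
Context (K : numFieldType) (m : nat).

(* [is_trig_mx] is lower triangularity. *)
Definition utmx_pred : {pred 'M[K]_m} := [pred A | is_trig_mx A^T].

Record utmx := UTMx { utmx_mx :> 'M[K]_m ; utmx_mem : utmx_mx \in utmx_pred }.

HB.instance Definition _ := [isSub for utmx_mx].
HB.instance Definition _ := [Choice of utmx by <:].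

Lemma utmxP (A : 'M[K]_m) :
  reflect (forall i j : 'I_m, (j < i)%N -> A i j = 0) (A \in utmx_pred).
Proof.
apply: (iffP is_trig_mxP) => AT i j ij.
  by have := AT _ _ ij; rewrite mxE.
by rewrite mxE AT.
Qed.

Lemma utmx_submod_closed : submod_closed utmx_pred.
Proof.
split=> [|a A B /utmxP A0 /utmxP B0]; apply/utmxP => i j ij; rewrite !mxE//.
by rewrite A0// B0// mulr0 addr0.
Qed.

Lemma utmx_mulr_closed : mulr_closed utmx_pred.
Proof.
split=> [|A B /utmxP A0 /utmxP B0]; apply/utmxP => i j ij; rewrite !mxE.
  by case: eqP ij => // ->; rewrite ltnn.
apply: big1 => k _; have [ki|ik] := ltnP k i; first by rewrite A0// mul0r.
by rewrite B0 ?mulr0// (leq_trans ij).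
Qed.

HB.instance Definition _ :=
  GRing.isSubmodClosed.Build K 'M[K]_m utmx_pred utmx_submod_closed.
HB.instance Definition _ := [SubChoice_isSubLmodule of utmx by <:].
HB.instance Definition _ :=
  GRing.SubNmodule_isSubPzSemiRing.Build 'M[K]_m utmx_pred utmx utmx_mulr_closed.

(* The norm induced by the library's entrywise maximum norm: all norms on this
   finite-dimensional space are equivalent, so it gives the usual topology. *)
Definition utmx_norm (A : utmx) : K := `|utmx_mx A|.

Lemma utmx_normD A B : utmx_norm (A + B) <= utmx_norm A + utmx_norm B.
Proof. exact: ler_normD. Qed.

Lemma utmx_normZ (a : K) A : utmx_norm (a *: A) = `|a| * utmx_norm A.
Proof. exact: normrZ. Qed.

Lemma utmx_norm0_eq0 A : utmx_norm A = 0 -> A = 0.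
Proof. by move=> /normr0_eq0 A0; exact/val_inj. Qed.

HB.instance Definition _ := Lmodule_isNormed.Build K utmx
  utmx_normD utmx_normZ utmx_norm0_eq0.

End UpperTriangular.

Section StrictlySingular.
Context {K : numFieldType} {Y : normedModType K}.

(* Not required to be closed: a lower bound for [S] passes to the closure. *)
Definition linear_subspace (W : set Y) :=
  W 0 /\ forall (a : K) (x y : Y), W x -> W y -> W (a *: x + y).

Definition finite_dimensional (W : set Y) := exists n (e : 'I_n -> Y),
  W = [set \sum_(i < n) c i *: e i | c in [set: 'I_n -> K]].

Definition bounded_below_on (S : bop Y) (W : set Y) :=
  exists2 c : K, 0 < c & forall x, W x -> c * `|x| <= `|S x|.

Definition strictly_singular : set (bop Y) := [set S | forall W,
  linear_subspace W -> bounded_below_on S W -> finite_dimensional W].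

End StrictlySingular.
Arguments strictly_singular {K} Y.

Section Sequences.
Context {K : numFieldType} {I : Type} {A B : lmodType K}.

(* Exactness of 0 -> I -> A -> B -> 0. [I] carries no algebraic structure: it is
   meant to be a subset of [A] with [iota] its inclusion, so that exactness at
   [I] is injectivity of [iota]. *)
Definition short_exact (iota : I -> A) (psi : A -> B) :=
  [/\ injective iota, range iota = psi @^-1` [set 0] & range psi = setT].

End Sequences.

(* Main.v *)
(* Let [c00] carry the norm induced by a norming set of mixed Tsirelson type:
   functionals of weight [w] are of the form [(1 / m_w) (f_1 + ... + f_d)]
   with [d <= n_w] and successive supports; for odd [w] only special sequences are
   allowed, in which the weight of each [f_l] codes its predecessors, as in
   Gowers and Maurey. The completion [X] has the property that every bounded
   operator from a coordinate subspace into [X] is, on rapidly increasing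
   sequences (RIS), asymptotically a scalar multiple of the inclusion: otherwise
   there are a RIS [x_k] and successive functionals [h_k] with [h_k x_k = 0] and
   [h_k (T x_k)] bounded below; averaging them along a special sequence of odd
   weight [r] yields vectors [z_k] with [|sum z_k| <= C n_r / m_r ^ 2], whereas
   [|T (sum z_k)| >= c n_r / m_r], which is absurd for large [r].

   Now let [N_0 > N_1 > ... > N_(m-1)] be sets of integers with infinite successive
   differences, [X_j] the vectors of [X] supported in [N_j], and [Y] the sum of
   the [X_j]. The scalar parts of the entries [X_j -> X_i] of an operator form a
   matrix, which is upper triangular since [X_i] is too small to contain
   the relevant RIS of [X_j] when [j < i]. An operator whose scalar matrix is 0 is
   small on RIS, and every infinite-dimensional subspace contains almost a RIS,
   so it is strictly singular; conversely a nonzero scalar part makes an operator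
   bounded below on the span of a sparse sequence. *)
Require Import Defs.
From HB Require Import structures.
From mathcomp Require Import all_boot all_order all_algebra.
From mathcomp Require Import complex.
From mathcomp Require Import all_classical all_reals all_analysis.
From mathcomp Require Import ring lra zify.

Set Implicit Arguments.
Unset Strict Implicit.
Unset Printing Implicit Defensive.

Import Order.TTheory GRing.Theory Num.Theory.
Import numFieldNormedType.Exports.

Local Open Scope classical_set_scope.
Local Open Scope ring_scope.
Local Open Scope complex_scope.

(** * Moduli, counting and finitely supported functionals *)

(** Two devices keep the construction elementary. By bounded completeness ([tail_small]) a sequence
    of finite norm is the limit of its truncations, so X is realised as the space of all sequences
    of finite norm. And limits along RIS become thresholds: [ris_vec S c P] describes a single
    vector fit to appear from [P] on, asymptotic statements assert an estimate for all such vectors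
    with [P] large, and sequences are rebuilt by iteration only to reach a contradiction.

    The parameters are shaped by one demand: sums over a dependent sequence must gain a further
    factor [weight r] over sums of an ordinary RIS. Functionals of weight above [r] give this gain
    because weights are successive squares; those of weight below [r] have to be split, and the
    price is a power of the smaller arities that [arity r] must absorb; at weight [r] itself only
    the coding helps.

    A separate obstacle is that strict singularity is tested on arbitrary subspaces, which come
    without any RIS. There, iterated averaging with a factor slightly too large for an average finds
    vectors whose norm is comparable to that of their many summands, and such averages are RIS
    vectors. *)

Section Modulus.
Variable R : realType.
Implicit Types z w : R[i].

(** The norm of [R[i]] takes values in [R[i]]; a modulus with values in [R] gives access to suprema
    and to linear arithmetic. *)
Definition cabs z : R := Normc.normc z.

Lemma cabsE z : `|z| = (cabs z)%:C.
Proof. by rewrite /cabs; case: z. Qed.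

Lemma cabs_ge0 z : 0 <= cabs z.
Proof. by rewrite -lecR -cabsE normr_ge0. Qed.

Lemma cabs0 : cabs 0 = 0. Proof. exact: Normc.normc0. Qed.
Lemma cabs1 : cabs 1 = 1. Proof. exact: Normc.normc1. Qed.
Lemma cabsM z w : cabs (z * w) = cabs z * cabs w.
Proof. exact: Normc.normcM. Qed.
Lemma cabsV z : cabs z^-1 = (cabs z)^-1. Proof. exact: Normc.normcV. Qed.
Lemma cabsD z w : cabs (z + w) <= cabs z + cabs w.
Proof. exact: le_normcD. Qed.
Lemma cabsN z : cabs (- z) = cabs z. Proof. exact: normcN. Qed.
Lemma cabsB z w : cabs (z - w) <= cabs z + cabs w.
Proof. by rewrite -[cabs w]cabsN cabsD. Qed.
Lemma cabsBC z w : cabs (z - w) = cabs (w - z).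
Proof. by rewrite -cabsN opprB. Qed.
Lemma cabs_eq0 z : cabs z = 0 -> z = 0. Proof. exact: Normc.eq0_normc. Qed.
Lemma cabs_gt0 z : z != 0 -> 0 < cabs z.
Proof.
move=> z0; rewrite lt_neqAle cabs_ge0 andbT eq_sym.
by apply: contra z0 => /eqP/cabs_eq0 ->.
Qed.
Lemma cabsR (r : R) : cabs r%:C = `|r|.
Proof. by rewrite /cabs /= expr0n addr0 sqrtr_sqr. Qed.
Lemma cabs_ler z w : cabs z - cabs w <= cabs (z - w).
Proof. by rewrite lerBlDr (le_trans _ (cabsD _ _))// subrK. Qed.
Lemma Re_le_cabs z : complex.Re z <= cabs z.
Proof.
by rewrite (le_trans (ler_norm _))// -lecR -cabsE; exact: normc_ge_Re.
Qed.
Lemma cabs_le_ReIm z : cabs z <= `|complex.Re z| + `|complex.Im z|.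
Proof.
rewrite {1}[z]complexE (le_trans (cabsD _ _))// cabsM !cabsR.
suff -> : cabs 'i = 1 by rewrite mul1r.
by rewrite /cabs /= expr0n expr1n add0r sqrtr1.
Qed.
Lemma cabs_sum (I : Type) (r : seq I) (P : pred I) (F : I -> R[i]) :
  cabs (\sum_(i <- r | P i) F i) <= \sum_(i <- r | P i) cabs (F i).
Proof.
elim/big_ind2: _ => [|a b c d ab cd|//]; first by rewrite cabs0.
by rewrite (le_trans (cabsD _ _))// lerD.
Qed.

(** Rotating functionals or vectors by such a [u] makes their values nonnegative reals, so that sums
    of them cannot cancel. Asking only [cabs u <= 1] admits [u = 0] at [z = 0]. *)
Lemma phaseP z : exists u : R[i], cabs u <= 1 /\ u * z = (cabs z)%:C.
Proof.
have [->|z0] := eqVneq z 0.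
  by exists 0; rewrite cabs0 ler01 mulr0.
exists ((cabs z)%:C * z^-1); split; last by rewrite mulfVK.
by rewrite cabsM cabsV cabsR ger0_norm ?cabs_ge0// divff// gt_eqF ?cabs_gt0.
Qed.

End Modulus.

Section Counting.
Variable R : realType.

(** Used to count successive intervals: only one of them contains a given coordinate or
    breakpoint. *)
Lemma sum_at_most_one (K : nat) (P : pred nat) :
  (forall k l, (k < K)%N -> (l < K)%N -> P k -> P l -> k = l) ->
  \sum_(k < K) (P k)%:R <= 1 :> R.
Proof.
move=> uP; case: (pickP (fun k : 'I_K => P k)) => [k0 Pk0|nP].
  rewrite (bigD1 k0)//= big1 => [|k /eqP kk0]; first by rewrite addr0 Pk0.
  have [Pk|//] := boolP (P k); case: kk0; apply: val_inj.
  exact: (uP k k0 (ltn_ord k) (ltn_ord k0) Pk Pk0).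
by rewrite big1 => [|k _]; rewrite ?ler01 ?nP.
Qed.

Lemma sum_halves (K : nat) : \sum_(k < K) (2^-1 : R) ^+ k.+1 <= 1.
Proof.
suff -> : \sum_(k < K) (2^-1 : R) ^+ k.+1 = 1 - 2^-1 ^+ K.
  by rewrite lerBlDr lerDl exprn_ge0// invr_ge0.
elim: K => [|K IH]; first by rewrite big_ord0 expr0 subrr.
by rewrite big_ord_recr/= IH exprS; lra.
Qed.

End Counting.

Section Pairing.
Variable R : realType.
Local Notation C := R[i].
Implicit Types (f g : {poly C}) (x y : nat -> C) (p q : nat).

(* A polynomial stands for the finitely supported functional whose coordinates
   are its coefficients. *)
Definition ev f x : C := \sum_(i < size f) f`_i * x i.

Lemma ev_wide n f x : (size f <= n)%N -> ev f x = \sum_(i < n) f`_i * x i.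
Proof.
move=> fn; rewrite /ev (big_ord_widen n (fun i => f`_i * x i) fn).
rewrite big_mkcond/=; apply: eq_bigr => i _; case: ltnP => // ?.
by rewrite nth_default// mul0r.
Qed.

Lemma evDl f g x : ev (f + g) x = ev f x + ev g x.
Proof.
set n := maxn (size f) (size g).
rewrite !(@ev_wide n) ?leq_maxl ?leq_maxr ?size_polyD//.
by rewrite -big_split/=; apply: eq_bigr => i _; rewrite coefD mulrDl.
Qed.

Lemma evZl a f x : ev (a *: f) x = a * ev f x.
Proof.
rewrite !(@ev_wide (size f)) ?size_scale_leq// mulr_sumr.
by apply: eq_bigr => i _; rewrite coefZ mulrA.
Qed.

Lemma ev0l x : ev 0 x = 0.
Proof. by rewrite /ev size_poly0 big_ord0. Qed.

Lemma ev_suml (I : Type) (r : seq I) (P : pred I) (F : I -> {poly C}) x :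
  ev (\sum_(i <- r | P i) F i) x = \sum_(i <- r | P i) ev (F i) x.
Proof.
by elim/big_rec2: _ => [|i a f _ <-]; rewrite ?ev0l ?evDl.
Qed.

Lemma evDr f x y : ev f (x + y) = ev f x + ev f y.
Proof.
by rewrite /ev -big_split/=; apply: eq_bigr => i _; rewrite fctE mulrDr.
Qed.

Lemma evZr f a x : ev f (a *: x) = a * ev f x.
Proof.
by rewrite /ev mulr_sumr; apply: eq_bigr => i _; rewrite fctE mulrCA.
Qed.

Lemma ev0r f : ev f 0 = 0.
Proof. by rewrite /ev big1// => i _; rewrite mulr0. Qed.

Lemma evNr f x : ev f (- x) = - ev f x.
Proof. by rewrite -scaleN1r evZr mulN1r. Qed.

Lemma evBr f x y : ev f (x - y) = ev f x - ev f y.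
Proof. by rewrite evDr evNr. Qed.

Lemma ev_sumr f (I : Type) (r : seq I) (P : pred I) (F : I -> nat -> C) :
  ev f (\sum_(i <- r | P i) F i) = \sum_(i <- r | P i) ev f (F i).
Proof.
by elim/big_rec2: _ => [|i a z _ <-]; rewrite ?ev0r ?evDr.
Qed.

Lemma evXn n x : ev 'X^n x = x n.
Proof.
rewrite /ev size_polyXn (bigD1 ord_max)//= coefXn eqxx mul1r big1 ?addr0//.
move=> i /eqP ni; rewrite coefXn; case: eqP => [ein|]; last by rewrite mul0r.
by case: ni; apply: val_inj.
Qed.

Lemma eq_ev f x y : (forall i, f`_i != 0 -> x i = y i) -> ev f x = ev f y.
Proof.
move=> xy; apply: eq_bigr => i _; have [->|/xy->//] := eqVneq f`_i 0.
by rewrite !mul0r.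
Qed.

Definition supp p q x := forall i, ~~ (p <= i < q)%N -> x i = 0.
Definition psupp p q f := forall i, ~~ (p <= i < q)%N -> f`_i = 0.

Definition cutv p q x : nat -> C := fun i => if (p <= i < q)%N then x i else 0.
Definition cut p q f : {poly C} :=
  \poly_(i < size f) (if (p <= i < q)%N then f`_i else 0).

Lemma coef_cut p q f i : (cut p q f)`_i = if (p <= i < q)%N then f`_i else 0.
Proof.
rewrite coef_poly; case: ltnP => // si; rewrite (nth_default _ si).
by case: ifP.
Qed.

Lemma psupp_cut p q f : psupp p q (cut p q f).
Proof. by move=> i /negbTE pq; rewrite coef_cut pq. Qed.

Lemma supp_cutv p q x : supp p q (cutv p q x).
Proof. by move=> i /negbTE pq; rewrite /cutv pq. Qed.

Lemma psupp_cut2 p q b c f : psupp b c f -> psupp b c (cut p q f).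
Proof. by move=> bf i /bf fi; rewrite coef_cut fi; case: ifP. Qed.

Lemma cut_id p q f : psupp p q f -> cut p q f = f.
Proof.
by move=> pf; apply/polyP => i; rewrite coef_cut; case: ifPn => // /pf ->.
Qed.

Lemma cutv_id p q x : supp p q x -> cutv p q x = x.
Proof.
by move=> pf; apply/funext => i; rewrite /cutv; case: ifPn => // /pf ->.
Qed.

Lemma ev_cut p q f x : ev (cut p q f) x = ev f (cutv p q x).
Proof.
rewrite (@ev_wide (size f)) ?size_poly//; apply: eq_bigr => i _.
by rewrite coef_cut /cutv; case: ifP; rewrite ?mul0r ?mulr0.
Qed.

Lemma cutD p q f g : cut p q (f + g) = cut p q f + cut p q g.
Proof.
apply/polyP => i; rewrite coefD !coef_cut coefD.
by case: ifP; rewrite ?addr0.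
Qed.

Lemma cutZ p q a f : cut p q (a *: f) = a *: cut p q f.
Proof.
by apply/polyP => i; rewrite coefZ !coef_cut coefZ; case: ifP; rewrite ?mulr0.
Qed.

Lemma cut0 p q : cut p q 0 = 0.
Proof. by apply/polyP => i; rewrite coef_cut coef0; case: ifP. Qed.

Lemma cut_sum p q (I : Type) (r : seq I) (P : pred I) (F : I -> {poly C}) :
  cut p q (\sum_(i <- r | P i) F i) = \sum_(i <- r | P i) cut p q (F i).
Proof.
by elim/big_rec2: _ => [|i a f _ <-]; rewrite ?cut0 ?cutD.
Qed.

Lemma cutXn p q n :
  cut p q 'X^n = (if (p <= n < q)%N then 1 else 0) *: 'X^n :> {poly C}.
Proof.
apply/polyP => i; rewrite coef_cut coefZ coefXn.
by case: eqP => [->|_]; case: ifP; rewrite ?mulr1 ?mulr0 ?if_same.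
Qed.

Lemma cut_cut p q p' q' f : cut p q (cut p' q' f) = cut (maxn p p') (minn q q') f.
Proof.
apply/polyP => i; rewrite !coef_cut geq_max leq_min.
by case: (leqP p i); case: (leqP p' i); case: (ltnP i q); case: (ltnP i q').
Qed.

Lemma ev_disjoint p q b c f x : psupp b c f -> supp p q x ->
  ((q <= b) || (c <= p))%N -> ev f x = 0.
Proof.
move=> bf px h; apply: big1 => i _.
have [bi|/bf ->] := boolP (b <= i < c)%N; last by rewrite mul0r.
by rewrite px ?mulr0//; lia.
Qed.

Lemma supp_sub p q p' q' x : (p' <= p)%N -> (q <= q')%N -> supp p q x -> supp p' q' x.
Proof. by move=> pp qq px i ii; apply: px; lia. Qed.

Lemma psupp_sub p q p' q' f :
  (p' <= p)%N -> (q <= q')%N -> psupp p q f -> psupp p' q' f.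
Proof. by move=> pp qq px i ii; apply: px; lia. Qed.

Lemma suppD p q x y : supp p q x -> supp p q y -> supp p q (x + y).
Proof. by move=> px py i ii; rewrite fctE px// py// addr0. Qed.

Lemma suppZ p q a x : supp p q x -> supp p q (a *: x).
Proof. by move=> px i ii; rewrite fctE px// scaler0. Qed.

Lemma supp_sum p q (I : eqType) (r : seq I) (P : pred I) (F : I -> nat -> C) :
  (forall i, i \in r -> P i -> supp p q (F i)) ->
  supp p q (\sum_(i <- r | P i) F i).
Proof.
move=> pF; rewrite big_seq_cond; elim/big_ind: _ => //.
- exact: suppD.
- by move=> i /andP[]; exact: pF.
Qed.

Lemma ev_le f x (c : R) : (forall i, cabs (x i) <= c) ->
  cabs (ev f x) <= (\sum_(i < size f) cabs f`_i) * c.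
Proof.
move=> xc; rewrite (le_trans (cabs_sum _ _ _))// mulr_suml.
by apply: ler_sum => i _; rewrite cabsM ler_wpM2l ?cabs_ge0.
Qed.

End Pairing.
(** * The norming set *)

Section Weights.

(* Weights and arities grow so fast that [weight r.+1 = weight r ^ 2] and
   [arity r] beats any [2 ^ r.+1]-fold product of smaller arities; [prev_arity r]
   bounds the arities of all weights below [r]. *)
Fixpoint arity (r : nat) : nat :=
  if r is r'.+1 then (16 * arity r') ^ (2 ^ r'.+2) else 16 ^ 2.
Definition prev_arity (r : nat) : nat := if r is r'.+1 then arity r' else 1.

Lemma arityE r : arity r = ((16 * prev_arity r) ^ (2 ^ r.+1))%N.
Proof. by case: r. Qed.

Lemma arity_gt0 r : (0 < arity r)%N.
Proof. by elim: r => // r IH; rewrite arityE expn_gt0 muln_gt0/= IH. Qed.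

Lemma prev_arity_gt0 r : (0 < prev_arity r)%N.
Proof. by case: r => // r; exact: arity_gt0. Qed.

Lemma arity_ltn r : (prev_arity r < arity r)%N.
Proof.
rewrite arityE (@leq_trans ((16 * prev_arity r) ^ 1))//; last first.
  by rewrite leq_pexp2l ?expn_gt0// muln_gt0 prev_arity_gt0.
by have := prev_arity_gt0 r; lia.
Qed.

Lemma arity_mono w r : (w <= r)%N -> (arity w <= arity r)%N.
Proof.
elim: r => [|r IH]; first by case: w.
rewrite leq_eqVlt => /orP[/eqP->//|wr].
by rewrite (leq_trans (IH wr))// ltnW// (arity_ltn r.+1).
Qed.

Lemma arity_prev w r : (w < r)%N -> (arity w <= prev_arity r)%N.
Proof. by case: r => // r; rewrite ltnS; exact: arity_mono. Qed.

Lemma arity_gtn r : (r < arity r)%N.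
Proof. by elim: r => // r IH; rewrite (leq_ltn_trans IH)// (arity_ltn r.+1). Qed.

Variable R : realType.

Definition weight (w : nat) : R := 2 ^+ (2 ^ w).

Lemma weight_gt0 w : 0 < weight w. Proof. by rewrite exprn_gt0. Qed.
Lemma weight_ge0 w : 0 <= weight w. Proof. exact: ltW (weight_gt0 w). Qed.
Lemma weight_ge1 w : 1 <= weight w. Proof. by rewrite exprn_ege1// ler1n. Qed.
Lemma weightS w : weight w.+1 = weight w ^+ 2.
Proof. by rewrite /weight expnS mulnC exprM. Qed.
Lemma weight_le v w : (v <= w)%N -> weight v <= weight w.
Proof. by move=> vw; rewrite ler_eXn2l ?ltr1n// leq_exp2l. Qed.
Lemma weight_sq v w : (v < w)%N -> weight v ^+ 2 <= weight w.
Proof. by rewrite -weightS; exact: weight_le. Qed.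

Lemma natr_ltX2 n : n%:R <= 2 ^+ n :> R.
Proof. by rewrite -natrX ler_nat ltnW// ltn_expl. Qed.

Lemma weight_ge_nat w : w%:R <= weight w.
Proof.
rewrite (le_trans (natr_ltX2 _))// ler_eXn2l ?ltr1n//.
by rewrite ltnW// ltn_expl.
Qed.

(** The base 16 is split as [8 * 2]: powers of [8 * prev_arity r] are the cost of splitting in
    [core_estimate], and [2 ^+ i] ranges up to [weight R r ^+ 2]. *)
Lemma arity_ge r i : (i <= 2 ^ r.+1)%N ->
  (8 * (prev_arity r)%:R) ^+ i * 2 ^+ i <= (arity r)%:R :> R.
Proof.
move=> ir; rewrite arityE natrX -exprMn.
have -> : 8 * (prev_arity r)%:R * 2 = (16 * prev_arity r)%:R :> R by rewrite natrM; ring.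
by rewrite ler_weXn2l// ler1n muln_gt0 prev_arity_gt0.
Qed.

(** The left side is [16 ^+ (2 ^ r.+1)], the same power as in [arityE]. *)
Lemma weight_arity r : weight r ^+ 8 <= (arity r)%:R.
Proof.
rewrite arityE natrX /weight -exprM mulnC (_ : (8 * 2 ^ r = 4 * 2 ^ r.+1)%N); last first.
  by rewrite expnS mulnA.
rewrite exprM lerXn2r ?nnegrE ?exprn_ge0// -natrX ler_nat.
by have := prev_arity_gt0 r; lia.
Qed.

End Weights.
Arguments arity : simpl never.

Section Norming.
Variable R : realType.
Local Notation C := R[i].
Implicit Types (f g : {poly C}) (x y : nat -> C).

Definition l1 f : R := \sum_(i < size f) cabs f`_i.

Definition code := (seq (rat * rat) * nat)%type.

Definition crat (c : rat * rat) : C := (ratr c.1 : R)%:C + (ratr c.2 : R)%:C * 'i.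

(* The second component of a code is ignored: it makes room for infinitely many
   codes of the same functional. *)
Definition decode (c : code) : {poly C} := \poly_(i < size c.1) crat (nth (0, 0) c.1 i).

(** Doubling makes coded weights even, hence available to the freely formed functionals of
    [norming_even]; adding [arity r] keeps them far above [r]. Injectivity in [s] comes from
    [pickle]. *)
Definition sigma (r : nat) (s : seq code) : nat := (pickle s + arity r).*2.

(* [norming None f] means that [f] is in the norming set, [norming (Some w) f] that
   moreover [f] has weight [w]. In the odd case the [g l] are known to the code
   only up to an l1-error, so that no rational functionals are needed. *)
Inductive norming : option nat -> {poly C} -> Prop :=
| norming_basis n : norming None 'X^n
| norming_conv a b f g : norming None f -> norming None g -> cabs a + cabs b <= 1 ->
    norming None (a *: f + b *: g)
| norming_weight w f : norming (Some w) f -> norming None f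
| norming_even w d (b : nat -> nat) (g : nat -> {poly C}) :
    ~~ odd w -> (d <= arity w)%N -> (forall l, (b l <= b l.+1)%N) ->
    (forall l, (l < d)%N -> norming None (g l)) ->
    (forall l, (l < d)%N -> psupp (b l) (b l.+1) (g l)) ->
    norming (Some w) ((weight R w)^-1%:C *: \sum_(l < d) g l)
| norming_odd w d (b : nat -> nat) (g : nat -> {poly C}) (c : nat -> code) p q :
    odd w -> (d <= arity w)%N -> (forall l, (b l <= b l.+1)%N) ->
    (forall l, (l < d)%N -> norming (Some (sigma w (mkseq c l))) (g l)) ->
    (forall l, (l < d)%N -> psupp (b l) (b l.+1) (g l)) ->
    (forall l, (l < d)%N -> l1 (g l - decode (c l)) <= (arity w)%:R^-1) ->
    norming (Some w) ((weight R w)^-1%:C *: \sum_(l < d) cut p q (g l)).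

Notation D := (norming None).
Notation W w := (norming (Some w)).

Lemma D_scale a f : cabs a <= 1 -> D f -> D (a *: f).
Proof.
move=> a1 Df; rewrite -[_ *: f]addr0 -(scale0r f).
by apply: norming_conv => //; rewrite cabs0 addr0.
Qed.

Lemma D0 : D 0.
Proof. by rewrite -(scale0r 'X^0); apply: D_scale; [rewrite cabs0 ler01|exact: norming_basis]. Qed.

(** The odd clause carries its own interval: a restriction only shrinks that interval, while the
    codes go on describing the uncut pieces. *)
Lemma norming_cut o f p q : norming o f -> norming o (cut p q f).
Proof.
move=> Nf; elim: Nf p q => {o f}.
- move=> n p q; rewrite cutXn.
  apply: D_scale; last exact: norming_basis.
  by case: ifP; rewrite ?cabs0 ?cabs1 ?ler01.
- move=> a b f g Nf IHf Ng IHg ab p q; rewrite cutD !cutZ.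
  exact: norming_conv.
- by move=> w f _ IH p q; apply: norming_weight.
- move=> w d b g ow dn bm Ng IH sg p q; rewrite cutZ cut_sum.
  apply: (@norming_even _ _ b (fun l => cut p q (g l))) => //; first by move=> l ld; exact: IH.
  by move=> l ld; apply/psupp_cut2/sg.
- move=> w d b g c p' q' ow dn bm Ng IH sg gc p q.
  rewrite cutZ cut_sum.
  under eq_bigr do rewrite cut_cut.
  exact: norming_odd gc.
Qed.

(** All that upper estimates use of a functional of weight [w], for both parities: codes are
    forgotten and cuts are absorbed into the pieces [h l]. *)
Definition weighted w f d (b : nat -> nat) (h : nat -> {poly C}) :=
  [/\ (d <= arity w)%N, (forall l, (b l <= b l.+1)%N),
      (forall l, (l < d)%N -> D (h l)),
      (forall l, (l < d)%N -> psupp (b l) (b l.+1) (h l)) &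
      f = (weight R w)^-1%:C *: \sum_(l < d) h l].

Lemma W_weighted w f : W w f -> exists d b h, weighted w f d b h.
Proof.
move E : (Some w) => o Nf; elim: Nf E => {o f} //.
- move=> v d b g _ dn bm Ng _ sg [->]; by exists d, b, g.
- move=> v d b g c p q _ dn bm Ng _ sg _ [->]; exists d, b, (fun l => cut p q (g l)).
  split => // l ld; last by apply/psupp_cut2/sg.
  by apply/norming_cut/norming_weight/Ng.
Qed.

(** In the odd case the generated induction principle speaks of the uncut [g l], whereas the
    summands are their cuts. Proving [P] for every cut at once closes this gap. *)
Lemma D_ind (P : {poly C} -> Prop) :
  (forall n, P 'X^n) -> P 0 ->
  (forall a b f g, D f -> D g -> P f -> P g -> cabs a + cabs b <= 1 ->
    P (a *: f + b *: g)) ->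
  (forall w f d b h, W w f -> weighted w f d b h ->
    (forall l, (l < d)%N -> P (h l)) -> P f) ->
  forall f, D f -> P f.
Proof.
move=> PX P0 Pc Pw.
have PZ a f : cabs a <= 1 -> D f -> P f -> P (a *: f).
  move=> a1 Df Pf; rewrite -[_ *: f]addr0 -(scale0r f).
  by apply: Pc => //; rewrite cabs0 addr0.
suff H o f : norming o f -> forall p q, P (cut p q f).
  by move=> f /H /(_ 0 (size f)); rewrite cut_id// => i; rewrite leq0n/= -leqNgt; exact: nth_default.
elim=> {o f}.
- move=> n p q; rewrite cutXn.
  by case: ifP; rewrite ?scale1r ?scale0r.
- move=> a b f g Nf IHf Ng IHg ab p q; rewrite cutD !cutZ.
  by apply: Pc => //; exact: norming_cut.
- by [].
- move=> w d b g ow dn bm Ng IH sg p q.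
  apply: (Pw w _ d b (fun l => cut p q (g l))); first exact/norming_cut/(norming_even ow dn bm).
    split => // [l ld|l ld|]; [exact/norming_cut/Ng|exact/psupp_cut2/sg|].
    by rewrite cutZ cut_sum.
  by move=> l ld; exact: IH.
- move=> w d b g c p' q' ow dn bm Ng IH sg gc p q.
  apply: (Pw w _ d b (fun l => cut p q (cut p' q' (g l)))).
  + exact/norming_cut/(norming_odd p' q' ow dn bm Ng sg gc).
  + split => // [l ld|l ld|]; [|exact/psupp_cut2/psupp_cut2/sg|].
      by apply/norming_cut/norming_cut/norming_weight/Ng.
    by rewrite cutZ cut_sum.
  + by move=> l ld; rewrite cut_cut; exact: IH.
Qed.

Lemma mono_leq (b : nat -> nat) : (forall l, b l <= b l.+1)%N ->
  forall l k, (l <= k)%N -> (b l <= b k)%N.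
Proof.
move=> bm l k; elim: k => [|k IH]; first by case: l.
rewrite leq_eqVlt => /orP[/eqP->//|lk].
by rewrite (leq_trans (IH lk)).
Qed.

Lemma mono_uniq (b : nat -> nat) : (forall l, b l <= b l.+1)%N ->
  forall l k i, (b l <= i < b l.+1)%N -> (b k <= i < b k.+1)%N -> l = k.
Proof.
move=> bm l k i li ki; have := @mono_leq b bm.
by case: (ltngtP l k) => // h /(_ _ _ h); lia.
Qed.

Lemma weighted_coef w f d b h (c : R) : weighted w f d b h -> 0 <= c ->
  (forall l i, (l < d)%N -> cabs (h l)`_i <= c) ->
  forall i, cabs f`_i <= c / weight R w.
Proof.
move=> [_ bm _ sh ->] c0 hc i; rewrite coefZ cabsM cabsR ger0_norm ?invr_ge0 ?weight_ge0//.
rewrite [leLHS]mulrC ler_pM2r ?invr_gt0 ?weight_gt0// coef_sum.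
rewrite (le_trans (cabs_sum _ _ _))//.
apply: (@le_trans _ _ (\sum_(l < d) c * (b l <= i < b l.+1)%N%:R)).
  apply: ler_sum => l _; case: (boolP (_ <= _ < _)%N) => bi.
    by rewrite mulr1 hc.
  by rewrite (sh l)// cabs0 mulr0.
rewrite -mulr_sumr ler_piMr//; apply: (@sum_at_most_one _ _ (fun l => b l <= i < b l.+1)%N) => k l _ _.
exact: mono_uniq.
Qed.

Lemma D_coef f i : D f -> cabs f`_i <= 1.
Proof.
move=> Df; elim/D_ind: Df i => {f}.
- by move=> n i; rewrite coefXn; case: eqP; rewrite ?cabs1 ?cabs0.
- by move=> i; rewrite coef0 cabs0.
- move=> a b f g _ _ IHf IHg ab i; rewrite coefD !coefZ.
  rewrite (le_trans (cabsD _ _))// (le_trans _ ab)// !cabsM lerD//.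
    by rewrite ler_piMr ?cabs_ge0.
  by rewrite ler_piMr ?cabs_ge0.
- move=> w f d b h Ww wf IH i.
  apply: (le_trans (weighted_coef wf ler01 _ i)); first by move=> l j ld; exact: IH.
  by rewrite div1r invf_le1 ?weight_gt0 ?weight_ge1.
Qed.

Lemma W_coef w f i : W w f -> cabs f`_i <= (weight R w)^-1.
Proof.
move=> /W_weighted[d [b [h wf]]]; rewrite -[leRHS]mul1r.
apply: (weighted_coef wf) => // l j ld; apply: D_coef.
by case: wf => _ _ + _ _; apply.
Qed.

(** The norm of [x] is finite and at most [c]; working with bounds postpones the supremum to [nrm].
    [wbnd w] tests on functionals of weight [w] alone. *)
Definition bnd x (c : R) := forall f, D f -> cabs (ev f x) <= c.
Definition wbnd w x (c : R) := forall f, W w f -> cabs (ev f x) <= c.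

Lemma bnd_coord x c i : bnd x c -> cabs (x i) <= c.
Proof. by move=> /(_ _ (norming_basis i)); rewrite evXn. Qed.

Lemma bnd_ge0 x c : bnd x c -> 0 <= c.
Proof. by move=> /(_ _ D0); exact/le_trans/cabs_ge0. Qed.

Lemma bnd_le x c c' : c <= c' -> bnd x c -> bnd x c'.
Proof. by move=> cc xc f /xc/le_trans; exact. Qed.

Lemma bndD x y c c' : bnd x c -> bnd y c' -> bnd (x + y) (c + c').
Proof.
move=> xc yc f Df; rewrite evDr (le_trans (cabsD _ _))// lerD//; [exact: xc|exact: yc].
Qed.

Lemma bndZ x c a : bnd x c -> bnd (a *: x) (cabs a * c).
Proof.
by move=> xc f Df; rewrite evZr cabsM ler_wpM2l ?cabs_ge0// xc.
Qed.

Lemma bnd0 : bnd 0 0.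
Proof. by move=> f _; rewrite ev0r cabs0. Qed.

Lemma bnd_sum (I : eqType) (r : seq I) (F : I -> nat -> C) (c : I -> R) :
  (forall i, i \in r -> bnd (F i) (c i)) ->
  bnd (\sum_(i <- r) F i) (\sum_(i <- r) c i).
Proof.
move=> Fc; rewrite big_seq [X in bnd _ X]big_seq.
by elim/big_rec2: _ => [|i a b ir ab]; [exact: bnd0|apply: bndD => //; exact: Fc].
Qed.

Lemma bnd_cut p q x c : bnd x c -> bnd (cutv p q x) c.
Proof. by move=> xc f Df; rewrite -ev_cut; apply: xc; exact: norming_cut. Qed.

Lemma bnd_ph x c a : cabs a <= 1 -> bnd x c -> bnd (a *: x) c.
Proof.
move=> a1 xc; apply: bnd_le (bndZ a xc).
by rewrite ler_piMl// (bnd_ge0 xc).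
Qed.

Lemma wbndD w x y c c' : wbnd w x c -> wbnd w y c' -> wbnd w (x + y) (c + c').
Proof.
move=> xc yc f Df; rewrite evDr (le_trans (cabsD _ _))// lerD//; [exact: xc|exact: yc].
Qed.

Lemma wbnd_ph w x c a : cabs a <= 1 -> wbnd w x c -> wbnd w (a *: x) c.
Proof.
move=> a1 xc f Wf; rewrite evZr cabsM (le_trans _ (xc _ Wf))// ler_piMl//.
exact: cabs_ge0.
Qed.

Lemma wbnd_le w x c c' : c <= c' -> wbnd w x c -> wbnd w x c'.
Proof. by move=> cc xc f /xc/le_trans; exact. Qed.

Lemma ev_delta f n : ev f (fun i => (i == n)%:R) = f`_n.
Proof.
rewrite (@ev_wide _ (maxn n.+1 (size f))) ?leq_maxr//.
have n_lt : (n < maxn n.+1 (size f))%N by rewrite leq_max ltnS leqnn.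
rewrite (bigD1 (Ordinal n_lt))//= eqxx mulr1 big1 ?addr0// => i /eqP ni.
case: eqP; rewrite ?mulr0// => e; case: ni; exact/val_inj.
Qed.

Lemma bnd_basis n : bnd (fun i => (i == n)%:R) 1.
Proof. by move=> f Df; rewrite ev_delta D_coef. Qed.

Lemma wbnd_basis w n : wbnd w (fun i => (i == n)%:R) (weight R w)^-1.
Proof. by move=> f Wf; rewrite ev_delta W_coef. Qed.

End Norming.
Notation D := (norming None).
Notation W w := (norming (Some w)).

(** * Rapidly increasing sequences *)

Section Estimates.
Variable R : realType.
Local Notation C := R[i].
Implicit Types (f g : {poly C}) (x y : nat -> nat -> C) (A : pred nat).

Definition cnt K A : R := \sum_(k < K) (A k)%:R.

Lemma cnt_ge0 K A : 0 <= cnt K A.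
Proof. by apply: sumr_ge0. Qed.

Lemma cnt_predT K : cnt K xpredT = K%:R.
Proof. by rewrite /cnt sumr_const card_ord. Qed.

Lemma sum_pred_cnt K A (c : R) : \sum_(k < K | A k) c = c * cnt K A.
Proof.
rewrite /cnt mulr_sumr big_mkcond; apply: eq_bigr => k _.
by case: (A k); rewrite ?mulr1 ?mulr0.
Qed.

(** A block [x k] on which the sum is nonzero either lies within the interval of one [g l] or has
    one of the [d.+1] breakpoints [b l] in its interior. The latter blocks number at most [d.+1],
    each worth [c]; the former are grouped by [l] and left to the hypothesis on [g l], and the sizes
    of the groups add up to at most [cnt K A]. *)
Lemma split_le d (b a : nat -> nat) (g : nat -> {poly C}) x K A (c u v : R) :
  (forall l, b l <= b l.+1)%N -> (forall k, a k < a k.+1)%N ->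
  (forall l, (l < d)%N -> psupp (b l) (b l.+1) (g l)) ->
  (forall k, supp (a k) (a k.+1) (x k)) -> 0 <= c -> 0 <= v ->
  (forall k, cabs (ev (\sum_(l < d) g l) (x k)) <= c) ->
  (forall l A', (l < d)%N ->
    cabs (ev (g l) (\sum_(k < K | A' k) x k)) <= u + v * cnt K A') ->
  cabs (ev (\sum_(l < d) g l) (\sum_(k < K | A k) x k)) <=
    c * d.+1%:R + d%:R * u + v * cnt K A.
Proof.
move=> bm am sg sx c0 v0 Gc gu; set G := \sum_(l < d) g l.
have am' k : (a k <= a k.+1)%N by exact: ltnW.
pose inn l k := ((b l <= a k) && (a k.+1 <= b l.+1))%N.
pose gd k := [exists l : 'I_d, inn l k].
have inn_uniq k l l' : inn l k -> inn l' k -> l = l'.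
  move=> /andP[h1 h2] /andP[h3 h4]; apply: (mono_uniq bm (i := a k)).
    by rewrite h1 (leq_trans (am k)).
  by rewrite h3 (leq_trans (am k)).
rewrite ev_sumr (bigID (fun k : 'I_K => gd k))/= (le_trans (cabsD _ _))// addrC -addrA lerD//.
- pose cross l k := (a k < b l < a k.+1)%N.
  have badc k : ~~ gd k -> cabs (ev G (x k)) <= c * \sum_(l < d.+1) (cross l k)%:R.
    move=> ngd; have s0 : 0 <= \sum_(l < d.+1) (cross l k)%:R :> R by exact: sumr_ge0.
    have [->|] := eqVneq (ev G (x k)) 0; first by rewrite cabs0 mulr_ge0.
    move=> Gx0; have [l gl0] : exists l : 'I_d, ev (g l) (x k) != 0.
      apply/existsP; apply: contraNT Gx0 => /existsPn ne; rewrite ev_suml big1// => l _.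
      by apply/eqP; have := ne l; rewrite negbK.
    have [l' cl'] : exists l' : 'I_d.+1, cross l' k.
      have nin : ~~ inn l k by apply: contra ngd => il; apply/existsP; exists l.
      have nd : ~~ ((a k.+1 <= b l) || (b l.+1 <= a k))%N.
        by apply: contra gl0 => h; apply/eqP/(ev_disjoint (sg l _) (sx k)).
      have [h|h] := ltnP (a k) (b l).
        exists (widen_ord (leqnSn d) l); rewrite /cross/= h/=.
        by move: nd; rewrite negb_or -!ltnNge => /andP[].
      exists (lift ord0 l); rewrite /cross lift0.
      by move: nin nd; rewrite /inn h/= negb_or -!ltnNge => -> /andP[_ ->].
    rewrite (le_trans (Gc k))// ler_peMr// (bigD1 l')//= cl' lerDl.
    exact: sumr_ge0.
  rewrite (le_trans (cabs_sum _ _ _))//.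
  apply: (@le_trans _ _ (\sum_(k < K) c * \sum_(l < d.+1) (cross l k)%:R)).
    rewrite big_mkcond/=; apply: ler_sum => k _; case: ifP => [/andP[_ /badc]//|_].
    by rewrite mulr_ge0// sumr_ge0.
  rewrite -mulr_sumr ler_wpM2l// exchange_big/=.
  rewrite -[leRHS](cnt_predT d.+1); apply: ler_sum => l _.
  apply: (@sum_at_most_one _ _ (cross l)) => k k' _ _ /andP[h1 h2] /andP[h3 h4].
  by apply: (mono_uniq am' (i := b l)); rewrite ?h2 ?h4 ltnW.
- have -> : \sum_(k < K | A k && gd k) ev G (x k) =
      \sum_(l < d) ev (g l) (\sum_(k < K | A k && inn l k) x k).
    under [RHS]eq_bigr do rewrite ev_sumr big_mkcond/=.
    rewrite [RHS]exchange_big/= [LHS]big_mkcond/=; apply: eq_bigr => k _.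
    case: (boolP (A k)) => Ak /=; last by rewrite big1.
    case: (boolP (gd k)) => [/existsP[l il]|/existsPn ngd].
      rewrite /G ev_suml; apply: eq_bigr => l' _; case: (boolP (inn l' k)) => // nil'.
      move: il => /andP[h1 h2]; apply: (ev_disjoint (sg l' _) (sx k)) => //.
      have := mono_leq bm; case: (ltngtP l' l) => [ll|ll|ll] mb.
      + by rewrite (leq_trans (mb _ _ ll))// orbT.
      + by rewrite (leq_trans h2 (mb _ _ ll)).
      + by move: nil'; rewrite ll /inn h1 h2.
    by rewrite big1// => l _; rewrite (negbTE (ngd l)).
  rewrite (le_trans (cabs_sum _ _ _))//.
  apply: (@le_trans _ _ (\sum_(l < d) (u + v * cnt K (fun k => A k && inn l k)))).
    by apply: ler_sum => l _; exact: gu.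
  rewrite big_split/= sumr_const card_ord mulr_natl lerD2l -mulr_sumr ler_wpM2l//.
  rewrite /cnt exchange_big/=; apply: ler_sum => k _.
  case: (A k) => /=; last by rewrite big1.
  apply: (@sum_at_most_one _ _ (inn^~ k)) => l l' _ _; exact: inn_uniq.
Qed.

Lemma wbnd_sum w x K A (c : R) f : W w f -> (forall k, wbnd w (x k) c) ->
  cabs (ev f (\sum_(k < K | A k) x k)) <= c * cnt K A.
Proof.
move=> Wf xc; rewrite ev_sumr (le_trans (cabs_sum _ _ _))// -sum_pred_cnt.
by apply: ler_sum => k _; exact: xc.
Qed.

Lemma bnd_sum_cnt x K A (c : R) f : D f -> (forall k, bnd (x k) c) ->
  cabs (ev f (\sum_(k < K | A k) x k)) <= c * cnt K A.
Proof.
move=> Wf xc; rewrite ev_sumr (le_trans (cabs_sum _ _ _))// -sum_pred_cnt.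
by apply: ler_sum => k _; exact: xc.
Qed.

Lemma weighted_ev w f d b h (y : nat -> C) : weighted w f d b h ->
  ev f y = (weight R w)^-1%:C * ev (\sum_(l < d) h l) y.
Proof. by case=> _ _ _ _ ->; rewrite evZl. Qed.

Lemma cabs_weighted w f d b h (y : nat -> C) : weighted w f d b h ->
  cabs (ev (\sum_(l < d) h l) y) = weight R w * cabs (ev f y).
Proof.
move=> /weighted_ev ->; rewrite cabsM cabsR ger0_norm ?invr_ge0 ?weight_ge0//.
by rewrite mulrA divff ?mul1r// gt_eqF ?weight_gt0.
Qed.

(* The direct bound of the last hypothesis is only available for weights
   [w >= r]; functionals of smaller weight are split by induction on the
   functional, trading the target [j] for [j - 2 ^ w]. *)
Lemma core_estimate x (a : nat -> nat) K (c n : R) r i :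
  (forall k, a k < a k.+1)%N -> (forall k, supp (a k) (a k.+1) (x k)) ->
  (forall k, bnd (x k) c) ->
  (forall k w, (w < r)%N -> wbnd w (x k) (c / weight R w)) ->
  1 <= n -> (forall w, (w < r)%N -> (arity w)%:R <= n) ->
  (forall w f A, (r <= w)%N -> W w f ->
    cabs (ev f (\sum_(k < K | A k) x k)) <= c * (2 + cnt K A / 2 ^+ i)) ->
  forall f, D f -> forall A j, (j <= i)%N ->
  cabs (ev f (\sum_(k < K | A k) x k)) <= c * (2 + (8 * n) ^+ j + cnt K A / 2 ^+ j).
Proof.
move=> am sx xc xw n1 nw hc f Df.
have c0 : 0 <= c by exact: bnd_ge0 (xc 0).
have n0 : 0 <= 8 * n by lra.
have F0 A j : 0 <= cnt K A / 2 ^+ j by rewrite divr_ge0 ?cnt_ge0 ?exprn_ge0.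
have E0 j : 0 <= (8 * n) ^+ j by rewrite exprn_ge0.
have G0 A j : 0 <= 2 + (8 * n) ^+ j + cnt K A / 2 ^+ j by rewrite !addr_ge0.
have am' k : (a k <= a k.+1)%N by exact: ltnW.
elim/D_ind: Df => {f}.
- move=> m A j ji; rewrite evXn.
  apply: (@le_trans _ _ (c * 1)); last first.
    by rewrite ler_wpM2l//; have := F0 A j; have := E0 j; lra.
  rewrite fct_sumE (le_trans (cabs_sum _ _ _))//.
  apply: (@le_trans _ _ (\sum_(k < K) c * (a k <= m < a k.+1)%N%:R)).
    rewrite big_mkcond/=; apply: ler_sum => k _; case: ifP => // _.
      case: (boolP (_ <= _ < _)%N) => akm; first by rewrite mulr1 (bnd_coord _ (xc k)).
      by rewrite (sx k)// cabs0 mulr0.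
    by rewrite mulr_ge0.
  rewrite -mulr_sumr ler_wpM2l//.
  apply: (@sum_at_most_one _ _ (fun k => a k <= m < a k.+1)%N) => k l _ _.
  exact: mono_uniq.
- move=> A j _; by rewrite ev0l cabs0 mulr_ge0.
- move=> s t f g Df Dg IHf IHg st A j ji; rewrite evDl !evZl.
  set B := leRHS; have B0 : 0 <= B by rewrite mulr_ge0.
  rewrite (le_trans (cabsD _ _))// !cabsM (@le_trans _ _ ((cabs s + cabs t) * B))//.
    by rewrite mulrDl lerD// ler_wpM2l ?cabs_ge0//; [exact: IHf|exact: IHg].
  by rewrite ler_piMl.
- move=> w f d b h Wf wf IH A j ji.
  have [rw|wr] := leqP r w.
    rewrite (le_trans (hc w f A rw Wf))// ler_wpM2l//.
    suff : cnt K A / 2 ^+ i <= cnt K A / 2 ^+ j by have := E0 j; lra.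
    rewrite ler_wpM2l ?cnt_ge0//.
    by rewrite lef_pV2 ?posrE ?exprn_gt0// ler_eXn2l ?ltr1n.
  have [jw|wj] := leqP j (2 ^ w).
    have wc k : wbnd w (x k) (c / weight R w) by exact: xw.
    rewrite (le_trans (wbnd_sum _ _ Wf wc))// -mulrA ler_wpM2l//.
    suff : (weight R w)^-1 * cnt K A <= cnt K A / 2 ^+ j by have := E0 j; lra.
    rewrite mulrC ler_wpM2l ?cnt_ge0//.
    by rewrite lef_pV2 ?posrE ?exprn_gt0// ler_eXn2l ?ltr1n.
  pose j' := (j - 2 ^ w)%N.
  have [dw bm Dh sh _] := wf.
  have := @split_le d b a h x K A c (c * (2 + (8 * n) ^+ j')) (c / 2 ^+ j')
    bm am sh sx c0 _ _ _.
  rewrite (cabs_weighted _ wf) => H.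
  rewrite -(ler_pM2l (weight_gt0 R w)) (le_trans (H _ _ _))//.
  + by rewrite divr_ge0// ?exprn_ge0.
  + move=> k; rewrite (cabs_weighted _ wf) mulrC -ler_pdivlMr ?weight_gt0//.
    exact: xw.
  + move=> l A' ld; rewrite (le_trans (IH l ld A' j' _))//; last first.
      by rewrite mulrDr [X in _ + X <= _]mulrCA [X in _ <= _ + X]mulrC lexx.
    by rewrite (leq_trans _ ji)// leq_subr.
  + have ej : 2 ^+ j = 2 ^+ j' * weight R w by rewrite -exprD subnK// ltnW.
    have ew : weight R w * (c * (cnt K A / 2 ^+ j)) = c / 2 ^+ j' * cnt K A.
      by rewrite ej; field; rewrite ?lt0r_neq0 ?weight_gt0 ?exprn_gt0.
    have w1 := weight_ge1 R w.
    have dn : d%:R <= n by rewrite (le_trans _ (nw w wr))// ler_nat.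
    have d0 : 0 <= d%:R :> R by [].
    have e0 : 1 <= (8 * n) ^+ j' by rewrite exprn_ege1//; lra.
    have e1 : (8 * n) ^+ j' * (8 * n) <= (8 * n) ^+ j.
      rewrite -exprSr ler_weXn2l//; first by lra.
      by rewrite /j' ltn_subrL expn_gt0/= (leq_trans _ wj).
    set E := _ ^+ j' in e0 e1 *; set E' := _ ^+ j in e1 *.
    have -> : weight R w * (c * (2 + E' + cnt K A / 2 ^+ j)) =
      c * (weight R w * (2 + E')) + c / 2 ^+ j' * cnt K A by rewrite -ew; ring.
    have -> : c * d.+1%:R + d%:R * (c * (2 + E)) =
      c * (d.+1%:R + d%:R * (2 + E)) by ring.
    rewrite lerD2r ler_wpM2l// (@le_trans _ _ (2 + E'))//; last first.
      by rewrite ler_peMl// addr_ge0//; exact: E0.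
    (* By [d <= n] and [1 <= E] the left side is at most [1 + 4 * n * E], well below
       [2 + 8 * n * E]. *)
    rewrite -natr1.
    have : d%:R * E <= n * E by rewrite ler_wpM2r//; lra.
    have : n <= n * E by rewrite ler_peMr//; lra.
    by lra.
Qed.

(** [P k] has two roles, left end of the support and growth index: weights below [P k] see [x k]
    reduced by their full factor, and weights from [P k.+1] on exceed every index of the support of
    [x k]. *)
Definition RIS (c : R) x (P : nat -> nat) :=
  [/\ forall k, (P k < P k.+1)%N, forall k, supp (P k) (P k.+1) (x k),
      forall k, bnd (x k) c &
      forall k v, (v < P k)%N -> wbnd v (x k) (c / weight R v)].

Lemma gtn_id (P : nat -> nat) : (forall k, P k < P k.+1)%N -> forall k, (k <= P k)%N.
Proof. by move=> Pm; elim=> // k /leq_ltn_trans; apply. Qed.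

(** Three regimes. If [v < P k], the RIS condition applies. The case [P k <= v < P k.+1] occurs for
    one [k] only and costs [c]. If [P k.+1 <= v], the support lies below [v] and the coefficients of
    [f] are at most [(weight R v)^-1]; these terms sum to at most [c]. *)
Lemma RIS_direct c x P : RIS c x P -> forall K v f A, W v f ->
  \sum_(k < K | A k) cabs (ev f (x k)) <= c * (2 + cnt K A / weight R v).
Proof.
move=> [Pm sx xc xw] K v f A Wf.
have c0 : 0 <= c by exact: bnd_ge0 (xc 0).
have v0 := weight_gt0 R v.
have T k : A k -> cabs (ev f (x k)) <=
    c * ((P k <= v < P k.+1)%N%:R + 2^-1 ^+ k.+1 + (A k)%:R / weight R v).
  move=> ->; rewrite div1r.
  have [vP|Pv] := ltnP v (P k).
    rewrite add0r (le_trans (xw k v vP _ Wf))// ler_wpM2l//.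
    by rewrite ler_wpDl// ?exprn_ge0// invr_ge0.
  have [vP|Pv'] := ltnP v (P k.+1).
    rewrite (le_trans (xc k f (norming_weight Wf)))// ler_peMr//=.
    by rewrite -addrA ler_wpDr// addr_ge0 ?invr_ge0 ?exprn_ge0 ?invr_ge0 ?weight_ge0.
  rewrite /= add0r.
  apply: (@le_trans _ _ (v%:R * (weight R v)^-1 * c)).
    rewrite (@eq_ev _ _ _ (cutv 0 v (x k))); last first.
      move=> i _; rewrite /cutv; case: ifPn => //; rewrite leq0n -leqNgt => vi.
      by apply: sx; lia.
    rewrite -ev_cut (@ev_wide _ v); last first.
      by apply/leq_sizeP => j vj; rewrite coef_cut; case: ltnP => //; lia.
    rewrite (le_trans (cabs_sum _ _ _))//.
    apply: (@le_trans _ _ (\sum_(i < v) ((weight R v)^-1 * c))).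
      apply: ler_sum => i _; rewrite cabsM ler_pM ?cabs_ge0//.
        by apply: W_coef; exact: norming_cut.
      exact: bnd_coord (xc k).
    by rewrite sumr_const card_ord -mulrA mulr_natl.
  rewrite mulrC ler_wpM2l// ler_wpDr ?invr_ge0 ?weight_ge0//.
  (* There remains [v * 2 ^ k.+1 <= weight v], which follows from [v <= 2 ^ v], [k < v] and
     [2 * v <= 2 ^ v]. *)
  have kv : (k.+1 <= v)%N by rewrite (leq_trans _ Pv')// (leq_trans _ (Pm k))// ltnS gtn_id.
  rewrite exprVn ler_pdivrMr// ler_pdivlMl ?exprn_gt0//.
  rewrite (@le_trans _ _ (2 ^+ v * 2 ^+ v))//.
    by rewrite ler_pM ?exprn_ge0 ?natr_ltX2// ler_eXn2l ?ltr1n.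
  rewrite -exprD ler_eXn2l ?ltr1n//.
  rewrite addnn -mul2n; clear -kv; case: v kv => // v _.
  rewrite expnS leq_mul2l/=.
  exact: ltn_expl.
apply: (@le_trans _ _ (\sum_(k < K) c * ((P k <= v < P k.+1)%N%:R + 2^-1 ^+ k.+1 + (A k)%:R / weight R v))).
  rewrite [leLHS]big_mkcond/=; apply: ler_sum => k _; case: ifP => [Ak|_].
    by have := T _ Ak; rewrite Ak.
  by rewrite mulr_ge0// !addr_ge0// ?divr_ge0 ?weight_ge0// ?exprn_ge0// ?invr_ge0.
rewrite -mulr_sumr ler_wpM2l// !big_split/= -mulr_suml lerD2r.
rewrite (_ : 2 = 1 + 1)// lerD ?sum_halves//.
apply: (@sum_at_most_one _ _ (fun k => P k <= v < P k.+1)%N) => k l _ _.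
by apply: mono_uniq => i; exact: ltnW.
Qed.

Lemma RIS_direct_sum c x P : RIS c x P -> forall K v f A, W v f ->
  cabs (ev f (\sum_(k < K | A k) x k)) <= c * (2 + cnt K A / weight R v).
Proof.
move=> xP K v f A Wf; rewrite ev_sumr (le_trans (cabs_sum _ _ _))//.
exact: RIS_direct xP _ _ _ _ Wf.
Qed.

(** Scaled so that a functional of weight [r] made of norming functionals of the [x k] takes a value
    of order 1. *)
Definition rescaled_avg r x : nat -> C := (weight R r / (arity r)%:R)%:C *: \sum_(k < arity r) x k.

Lemma rescaled_avg_coef_ge0 r : 0 <= weight R r / (arity r)%:R.
Proof. by rewrite divr_ge0 ?weight_ge0. Qed.

Lemma rescaled_avg_le r x f (c : R) :
  cabs (ev f (\sum_(k < arity r) x k)) * weight R r <= c * (arity r)%:R ->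
  cabs (ev f (rescaled_avg r x)) <= c.
Proof.
move=> h; rewrite evZr cabsM cabsR ger0_norm ?rescaled_avg_coef_ge0//.
by rewrite mulrC mulrA ler_pdivrMr// ltr0n arity_gt0.
Qed.

Section Averages.
Variables (c : R) (x : nat -> nat -> C) (P : nat -> nat) (r : nat).
Hypotheses (xP : RIS c x P) (rP : (r <= P 0)%N).

Let c0 : 0 <= c. Proof. by have [_ _ xc _] := xP; exact: bnd_ge0 (xc 0). Qed.
Let rPk k : (r <= P k)%N.
Proof. by have [Pm _ _ _] := xP; elim: k => // k /leq_trans; apply; exact: ltnW. Qed.

Lemma RIS_core f A : D f ->
  cabs (ev f (\sum_(k < arity r | A k) x k)) <=
    c * (2 + (8 * (prev_arity r)%:R) ^+ (2 ^ r) + cnt (arity r) A / weight R r).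
Proof.
move=> Df; have [Pm sx xc xw] := xP.
(* This [i] makes [2 ^+ i] equal to [weight R r]. *)
apply: (core_estimate (i := (2 ^ r)%N) Pm sx xc (r := r)) => //.
- by move=> k w wr; apply: xw; exact: leq_trans wr (rPk k).
- by rewrite ler1n prev_arity_gt0.
- by move=> w wr; rewrite ler_nat arity_prev.
- move=> w g B rw Wg; rewrite (le_trans (RIS_direct_sum xP _ _ Wg))//.
  rewrite ler_wpM2l// lerD2l ler_wpM2l ?cnt_ge0//.
  by rewrite lef_pV2 ?posrE ?weight_gt0// weight_le.
Qed.

Let nr_bounds : 2 * weight R r <= (arity r)%:R /\
  (8 * (prev_arity r)%:R) ^+ (2 ^ r).+1 * weight R r <= (arity r)%:R.
Proof.
have w1 := weight_ge1 R r; split.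
  apply: le_trans (weight_arity R r); rewrite exprS mulrC ler_wpM2l ?weight_ge0//.
  rewrite (@le_trans _ _ (weight R r ^+ 1))//; last by rewrite ler_weXn2l.
  by rewrite expr1 /weight -[leLHS]expr1 ler_eXn2l ?ltr1n// expn_gt0.
apply: le_trans (arity_ge R (i := (2 ^ r).+1) _); last first.
  by rewrite expnS mul2n -addnn -add1n leq_add2r expn_gt0.
rewrite ler_wpM2l ?exprn_ge0 ?mulr_ge0// exprS ler_peMl ?exprn_ge0//.
by rewrite ler1n.
Qed.

(** The three terms of [RIS_core] contribute at most [c] each after rescaling, the first two by
    [nr_bounds]. *)
Lemma rescaled_avg_bnd : bnd (rescaled_avg r x) (3 * c).
Proof.
move=> f Df; apply: rescaled_avg_le.
have := RIS_core xpredT Df; rewrite cnt_predT => h.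
rewrite (le_trans (ler_wpM2r (weight_ge0 R r) h))//.
have [h1 h2] := nr_bounds; have wg := weight_gt0 R r.
rewrite [3 * c]mulrC -!mulrA ler_wpM2l// mulrDl divfK ?gt_eqF//.
have n1 : 1 <= (prev_arity r)%:R :> R by rewrite ler1n prev_arity_gt0.
have : (8 * (prev_arity r)%:R) ^+ (2 ^ r) * weight R r <= (arity r)%:R.
  rewrite (le_trans _ h2)// ler_wpM2r ?weight_ge0// ler_weXn2l//; lra.
by rewrite mulrDl; lra.
Qed.

(** Together with [rescaled_avg_wbnd_gt]: only weight [r] can see a rescaled average in full.
    Smaller weights lose their own factor, so that averages with growing [r] form a RIS again. Here
    [split_le] leaves at most [prev_arity r] pieces, each governed by [RIS_core]. *)
Lemma rescaled_avg_wbnd_lt v : (v < r)%N -> wbnd v (rescaled_avg r x) (2 * c / weight R v).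
Proof.
move=> vr f Wf; apply: rescaled_avg_le.
have [Pm sx xc xw] := xP.
have [d [b [h wf]]] := W_weighted Wf; have [dv bm Dh sh _] := wf.
pose E : R := (8 * (prev_arity r)%:R) ^+ (2 ^ r).
have := @split_le d b P h x (arity r) xpredT c (c * (2 + E)) (c / weight R r)
    bm Pm sh sx c0 _ _ _.
rewrite (cabs_weighted _ wf) cnt_predT => H.
have {}H : weight R v * cabs (ev f (\sum_(k < arity r) x k)) <=
  c * d.+1%:R + d%:R * (c * (2 + E)) + c / weight R r * (arity r)%:R.
  apply: H.
  + by rewrite divr_ge0// weight_ge0.
  + move=> k; rewrite (cabs_weighted _ wf) mulrC -ler_pdivlMr ?weight_gt0//.
    by apply: xw => //; exact: leq_trans vr (rPk k).
  + move=> l A' ld; rewrite (le_trans (RIS_core _ (Dh l ld)))//.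
    by rewrite mulrDr [X in _ + X <= _]mulrCA [X in _ <= _ + X]mulrC lexx.
rewrite -(ler_pM2l (weight_gt0 R v)) mulrA.
rewrite (le_trans (ler_wpM2r (weight_ge0 R r) H))//.
have [h1 h2] := nr_bounds; have wg := weight_gt0 R r; have vg := weight_gt0 R v.
have -> : weight R v * (2 * c / weight R v * (arity r)%:R) = c * (2 * (arity r)%:R).
  by field; rewrite lt0r_neq0.
have -> : (c * d.+1%:R + d%:R * (c * (2 + E)) + c / weight R r * (arity r)%:R) * weight R r
  = c * ((d.+1%:R + d%:R * (2 + E)) * weight R r + (arity r)%:R).
  by field; rewrite lt0r_neq0.
rewrite ler_wpM2l// [2 * _]mulrDl mul1r lerD2r (le_trans _ h2)// ler_wpM2r ?weight_ge0//.
have n1 : 1 <= (prev_arity r)%:R :> R by rewrite ler1n prev_arity_gt0.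
have dn : d%:R <= (prev_arity r)%:R :> R by rewrite ler_nat (leq_trans dv) ?arity_prev.
have E1 : 1 <= E by rewrite exprn_ege1//; lra.
rewrite -natr1 exprS -/E; set n := (prev_arity r)%:R in n1 dn *.
have : d%:R * E <= n * E by rewrite ler_wpM2r//; lra.
have : n <= n * E by rewrite ler_peMr//; lra.
by lra.
Qed.

(** The direct estimate suffices, since [weight R v] is at least [weight R r ^+ 2]. *)
Lemma rescaled_avg_wbnd_gt v : (r < v)%N -> wbnd v (rescaled_avg r x) (2 * c / weight R r).
Proof.
move=> rv f Wf; apply: rescaled_avg_le.
have := RIS_direct_sum xP (arity r) xpredT Wf; rewrite cnt_predT => h.
rewrite (le_trans (ler_wpM2r (weight_ge0 R r) h))//.
have wg := weight_gt0 R r; have vg := weight_gt0 R v; have w1 := weight_ge1 R r.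
have sq := weight_sq R rv.
have n2 : 2 * weight R r ^+ 2 <= (arity r)%:R.
  apply: le_trans (weight_arity R r); rewrite (_ : 8%N = (1 + 2 + 5)%N)// !exprD.
  rewrite -[leLHS]mulr1 ler_pM ?exprn_ege1 ?ler1n// ?mulr_ge0 ?exprn_ge0 ?weight_ge0//.
  by rewrite ler_pM2r ?exprn_gt0 ?weight_gt0// expr1 /weight -[leLHS]expr1 ler_eXn2l ?ltr1n// expn_gt0.
rewrite -(ler_pM2r wg).
have -> : c * (2 + (arity r)%:R / weight R v) * weight R r * weight R r =
  c * (2 * weight R r ^+ 2 + (arity r)%:R * (weight R r ^+ 2 / weight R v)) by ring.
have -> : 2 * c / weight R r * (arity r)%:R * weight R r = c * ((arity r)%:R + (arity r)%:R).
  by field; rewrite lt0r_neq0.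
by rewrite ler_wpM2l// lerD// ler_piMr// ler_pdivrMr// mul1r.
Qed.

Lemma rescaled_avg_supp : supp (P 0) (P (arity r)) (rescaled_avg r x).
Proof.
have [Pm sx _ _] := xP; have Pm' k : (P k <= P k.+1)%N by exact: ltnW.
apply/suppZ/supp_sum => k _ _; apply: supp_sub (sx k); first exact: mono_leq.
exact: (mono_leq Pm' (ltn_ord k)).
Qed.

End Averages.
End Estimates.

(** * Dependent sequences *)

Section Dependent.
Variable R : realType.
Local Notation C := R[i].
Implicit Types (f g : {poly C}) (A : pred nat).

Lemma evBl f g (x : nat -> C) : ev (f - g) x = ev f x - ev g x.
Proof. by rewrite -scaleN1r evDl evZl mulN1r. Qed.

Lemma W_odd_inv r f : W r f -> odd r ->
  exists d (b : nat -> nat) (g : nat -> {poly C}) (c : nat -> code) (p q : nat),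
  [/\ (d <= arity r)%N,
    forall l, (l < d)%N -> W (sigma r (mkseq c l)) (g l),
    forall l, (l < d)%N -> l1 (g l - decode R (c l)) <= (arity r)%:R^-1 &
    f = (weight R r)^-1%:C *: \sum_(l < d) cut p q (g l)].
Proof.
move E : (Some r) => o Nf; case: Nf E => //.
  by move=> w d b g ow _ _ _ _ [->]; rewrite (negbTE ow).
move=> w d b g c p q _ dn _ Ng _ gc [->] _; by exists d, b, g, c, p, q.
Qed.

Lemma sigma_ge r s : ((arity r).*2 <= sigma r s)%N.
Proof. by rewrite leq_double leq_addl. Qed.

Lemma sigma_inj r : injective (sigma r).
Proof.
move=> s t /double_inj/eqP; rewrite eqn_add2r => /eqP.
exact: (pcan_inj (@choice.pickleK _)).
Qed.

(** When weights differ, a term of a special functional on a dependent sequence is at most [c] over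
    a coded weight; the at most [arity r ^ 2] such terms then total at most [c]. *)
Lemma weight_sigma r s : (arity r)%:R ^+ 2 <= weight R (sigma r s).
Proof.
have h : ((arity r).*2 <= 2 ^ (sigma r s))%N.
  by rewrite (leq_trans (sigma_ge r s))// ltnW// ltn_expl.
apply: (@le_trans _ _ (2 ^+ (arity r).*2)); last by rewrite /weight ler_eXn2l ?ltr1n.
by rewrite -muln2 exprM lerXn2r ?nnegrE ?exprn_ge0// natr_ltX2.
Qed.

Section DependentSequence.
Variables (c : R) (r : nat) (cc : nat -> code) (z : nat -> nat -> C)
  (f : nat -> {poly C}).
Let w k := sigma r (mkseq cc k).
Hypotheses (r_odd : odd r) (zw : RIS c z w).
Hypothesis z_gt : forall k v, (w k < v)%N -> wbnd v (z k) (c / weight R (w k)).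
Hypothesis fz : forall k, ev (f k) (z k) = 0.
Hypothesis fc : forall k, l1 (f k - decode R (cc k)) <= (arity r)%:R^-1.

Let c0 : 0 <= c. Proof. by have [_ _ xc _] := zw; exact: bnd_ge0 (xc 0). Qed.
Let n0 : 0 < (arity r)%:R :> R. Proof. by rewrite ltr0n arity_gt0. Qed.

(* The codes of [h] and of the sequence [f] agree up to some first index; there
   and before, [h] is small on [z k] because [f k] kills [z k], with at most three
   exceptions (the first disagreement and the two ends of the cutting interval);
   everywhere else the weights differ. *)
Lemma special_bound h A : W r h ->
  cabs (ev h (\sum_(k < arity r | A k) z k)) <= 2 * c.
Proof.
move=> Wh; have [d [b [g [c' [p [q [dn Wg gc ->]]]]]]] := W_odd_inv Wh r_odd.
have [wmono sz zc zlt] := zw; pose n : R := (arity r)%:R; have ng : 0 < n by exact: n0.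
pose first l := (mkseq c' l == mkseq cc l) && (c' l != cc l).
pose crs s k := (w k < s < w k.+1)%N.
pose u k : R := c * ((first k)%:R + (crs p k)%:R + (crs q k)%:R) + 2 * c / n.
have first_uniq k l : first k -> first l -> k = l.
  wlog kl : k l / (k <= l)%N.
    by move=> H fk fl; case/orP: (leq_total k l) => h1; [|symmetry]; exact: H.
  move=> /andP[_ nk] /andP[/eqP el _]; apply/eqP; rewrite eqn_leq kl leqNgt/=.
  apply: contra nk => kl'; apply/eqP.
  by have := congr1 (fun s => nth (c' k) s k) el; rewrite !nth_mkseq.
have u0 k : 0 <= u k.
  by rewrite addr_ge0// ?mulr_ge0 ?invr_ge0 ?addr_ge0// ltW.
have term l k : (l < d)%N ->
    cabs (ev (cut p q (g l)) (z k)) <= c / n ^+ 2 + (l == k)%:R * u k.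
  move=> ld; have Wcg := norming_cut p q (Wg l ld).
  have le1 v : n ^+ 2 <= weight R v -> c / weight R v <= c / n ^+ 2 + (l == k)%:R * u k.
    move=> nv; rewrite ler_wpDr ?mulr_ge0// ler_wpM2l//.
    by rewrite lef_pV2 ?posrE ?weight_gt0// exprn_gt0.
  have [lt|gt|/sigma_inj e] := ltngtP (sigma r (mkseq c' l)) (w k).
  - by rewrite (le_trans (zlt k _ lt _ Wcg))// le1// weight_sigma.
  - by rewrite (le_trans (z_gt gt Wcg))// le1// weight_sigma.
  (* Codes are injective on whole lists, lengths included, so equal weights occur only on the
     diagonal. *)
  have lk : l = k by move/(congr1 size): e; rewrite !size_mkseq.
  subst k; rewrite eqxx mul1r.
  have cn0 : 0 <= c / n ^+ 2 by rewrite divr_ge0// exprn_ge0// ltW.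
  have cn1 : 0 <= 2 * c / n by rewrite !mulr_ge0// invr_ge0 ltW.
  have zl : cabs (ev (cut p q (g l)) (z l)) <= c by apply/zc/norming_weight/Wcg.
  have [fpq|] := boolP [|| first l, crs p l | crs q l].
    rewrite (le_trans zl)// ler_wpDl// ler_wpDr// ler_peMr//.
    by move: fpq; case: (first l); case: (crs p l); case: (crs q l) => //= _; lra.
  rewrite !negb_or => /and3P[nfl ncp ncq].
  rewrite /u (negbTE nfl) (negbTE ncp) (negbTE ncq) !addr0 mulr0 add0r.
  suff : cabs (ev (cut p q (g l)) (z l)) <= 2 * c / n by lra.
  rewrite ev_cut.
  have ecl : c' l = cc l by apply/eqP; move: nfl; rewrite /first e eqxx/= negbK.
  have [out|out] := boolP ((w l.+1 <= p) || (q <= w l))%N.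
    suff -> : cutv p q (z l) = 0 by rewrite ev0r cabs0.
    apply/funext => i; rewrite /cutv; case: ifP => // ipq.
    by apply: (sz l); apply/negP => iw; move: out ipq iw; lia.
  rewrite cutv_id; last first.
    apply: supp_sub (sz l); move: ncp ncq out; rewrite /crs; lia.
  have zi i : cabs (z l i) <= c by exact: bnd_coord (zc l).
  (* [g l] and [f l] are both close in l1 to the same decoded functional, and [f l] kills [z l]. *)
  have -> : ev (g l) (z l) = ev (g l - decode R (c' l)) (z l) - ev (f l - decode R (cc l)) (z l).
    by rewrite !evBl fz ecl; ring.
  rewrite (le_trans (cabsB _ _))// (_ : 2 * c / n = n^-1 * c + n^-1 * c); last by ring.
  rewrite lerD// (le_trans (ev_le _ zi))// ler_wpM2r//; [exact: gc|exact: fc].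
rewrite evZl cabsM cabsR ger0_norm ?invr_ge0 ?weight_ge0//.
rewrite ev_suml; under eq_bigr do rewrite ev_sumr.
have sc k (s : R) : \sum_(i < k) s = k%:R * s by rewrite sumr_const card_ord mulr_natl.
(* The 6 is 1 for all terms with different weights, 3 for the exceptional indices and 2 for the
   coding errors. Division by [weight R r >= 4], valid for odd [r], brings it below 2. *)
have H : cabs (\sum_(l < d) \sum_(k < arity r | A k) ev (cut p q (g l)) (z k)) <= 6 * c.
  rewrite (le_trans (cabs_sum _ _ _))//.
  apply: (@le_trans _ _ (\sum_(l < d) \sum_(k < arity r) (c / n ^+ 2 + (val l == k)%:R * u k))).
    apply: ler_sum => l _; rewrite (le_trans (cabs_sum _ _ _))// big_mkcond/=.
    apply: ler_sum => k _; have := term l k (ltn_ord l); case: ifP => // _.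
    exact/le_trans/cabs_ge0.
  rewrite exchange_big/=.
  apply: (@le_trans _ _ (\sum_(k < arity r) (c / n + u k))).
    apply: ler_sum => k _; rewrite big_split/= lerD//.
      rewrite sc.
      rewrite (_ : c / n = n * (c / n ^+ 2)); last by field; rewrite lt0r_neq0.
      by rewrite ler_wpM2r ?ler_nat// divr_ge0// exprn_ge0// ltW.
    rewrite -mulr_suml ler_piMl//; apply: (@sum_at_most_one _ _ (fun l => l == k)).
    by move=> l l' _ _ /eqP-> /eqP->.
  rewrite /u !big_split/= !sc -/n -mulr_sumr !big_split/=.
  have s1 : \sum_(i < arity r) (first i)%:R <= 1 :> R.
    by apply: sum_at_most_one => k l _ _; exact: first_uniq.
  have weight' k : (w k <= w k.+1)%N by exact: ltnW.
  have s2 s : \sum_(i < arity r) (crs s i)%:R <= 1 :> R.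
    apply: sum_at_most_one => k l _ _ /andP[h1 h2] /andP[h3 h4].
    by apply: (mono_uniq weight' (i := s)); rewrite ?h2 ?h4 ltnW.
  have -> : n * (c / n) = c by field; rewrite lt0r_neq0.
  have -> : n * (2 * c / n) = 2 * c by field; rewrite lt0r_neq0.
  set S := _ + _ + \sum_(i < arity r) (crs q i)%:R.
  have S3 : S <= 3 by have := s2 p; have := s2 q; rewrite /S; lra.
  have := ler_wpM2l c0 S3; lra.
rewrite mulrC ler_pdivrMr ?weight_gt0// (le_trans H)//.
have w4 : 4 <= weight R r.
  rewrite (_ : 4 = weight R 1); first by apply: weight_le; case: (r) r_odd.
  by rewrite /weight /= expn1 expr2; ring.
by have := ler_wpM2l c0 w4; have := c0; lra.
Qed.

(** [core_estimate] with [i = 2 ^ r.+1], for which [2 ^+ i] is [weight R r ^+ 2]. The direct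
    estimate holds at weight [r] by [special_bound], where a general RIS would only offer
    [weight R r], and at greater weights because these are at least [weight R r ^+ 2]. *)
Lemma dependent_bound h : D h ->
  cabs (ev h (\sum_(k < arity r) z k)) <= 3 * c * (arity r)%:R / weight R r ^+ 2.
Proof.
move=> Dh; have [wmono sz zc zlt] := zw.
have rw k : (r < w k)%N.
  by rewrite (leq_trans (arity_gtn r))// (leq_trans _ (sigma_ge _ _))// -addnn leq_addr.
have e2 : weight R r ^+ 2 = 2 ^+ (2 ^ r.+1) by rewrite -weightS.
have := @core_estimate _ z w (arity r) c (prev_arity r)%:R r (2 ^ r.+1) wmono sz zc _ _ _ _ h Dh xpredT (2 ^ r.+1) (leqnn _).
rewrite cnt_predT -e2 => H; rewrite (le_trans (H _ _ _ _))//.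
- by move=> k v vr; apply: zlt; exact: ltn_trans vr (rw k).
- by rewrite ler1n prev_arity_gt0.
- by move=> v vr; rewrite ler_nat arity_prev.
- move=> v g A; rewrite leq_eqVlt => /orP[/eqP<-|rv] Wg.
    rewrite (le_trans (special_bound A Wg))// mulrC ler_wpM2l// lerDl.
    by rewrite divr_ge0 ?cnt_ge0// exprn_ge0// weight_ge0.
  rewrite (le_trans (RIS_direct_sum zw _ _ Wg))// ler_wpM2l// lerD2l.
  rewrite ler_wpM2l ?cnt_ge0// lef_pV2 ?posrE ?exprn_gt0 ?weight_gt0//.
  exact: weight_sq.
have wg : 0 < weight R r ^+ 2 by rewrite exprn_gt0 ?weight_gt0.
have h1 : (8 * (prev_arity r)%:R) ^+ (2 ^ r.+1) <= (arity r)%:R / weight R r ^+ 2.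
  by rewrite ler_pdivlMr// e2 arity_ge.
have h2 : 2 <= (arity r)%:R / weight R r ^+ 2.
  rewrite ler_pdivlMr//; apply: le_trans (weight_arity R r).
  rewrite (_ : 8%N = (2 + 1 + 5)%N)// !exprD mulrC -[leLHS]mulr1.
  rewrite ler_pM ?exprn_ege1 ?weight_ge1 ?ler1n ?mulr_ge0 ?exprn_ge0 ?weight_ge0//.
  rewrite ler_wpM2l ?exprn_ge0 ?weight_ge0//.
  by rewrite expr1 /weight -[leLHS]expr1 ler_eXn2l ?ltr1n// expn_gt0.
rewrite [3 * c]mulrC -!mulrA ler_wpM2l//; set X := (arity r)%:R / _ in h1 h2 *.
lra.
Qed.

End DependentSequence.
End Dependent.

(** * Operators are asymptotically scalar *)

Section Operators.
Variable R : realType.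
Local Notation C := R[i].
Implicit Types (f g : {poly C}) (x y : nat -> C) (S : pred nat).

Lemma weight_sq_arity w : weight R w ^+ 2 <= (arity w)%:R.
Proof.
apply: le_trans (weight_arity R w); rewrite (_ : 8%N = (2 + 6)%N)// exprD.
by rewrite ler_peMr ?exprn_ge0 ?weight_ge0// exprn_ege1// weight_ge1.
Qed.

Lemma weight_large (K eps : R) : 0 < eps -> exists r0, forall r, (r0 <= r)%N -> K < weight R r * eps.
Proof.
move=> e0; exists (Num.bound `|K / eps|) => r rr.
rewrite -ltr_pdivrMr// (le_lt_trans (ler_norm _))//.
rewrite (lt_le_trans (archi_boundP (normr_ge0 _)))//.
by rewrite (le_trans _ (weight_ge_nat R r))// ler_nat.
Qed.

Lemma supp_widen p q x q' : supp p q x -> (q <= q')%N -> supp p q' x.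
Proof. by move=> px qq; apply: supp_sub px. Qed.

Lemma not_bnd x c : ~ bnd x c -> exists2 f, D f & c < cabs (ev f x).
Proof.
move=> nb; apply: contrapT => h; apply: nb => f Df.
by rewrite leNgt; apply/negP => cf; apply: h; exists f.
Qed.

Lemma bndN x c : bnd x c -> bnd (- x) c.
Proof. by move=> xc f Df; rewrite evNr cabsN; exact: xc. Qed.

Lemma bndB x y c c' : bnd x c -> bnd y c' -> bnd (x - y) (c + c').
Proof. by move=> xc yc; apply/bndD/bndN. Qed.

(* Bounded completeness of the basis: otherwise some functional of large even
   weight would be unbounded on [y]. *)
Lemma tail_small y (c eps : R) : bnd y c -> 0 < eps ->
  exists q, forall q', (q <= q')%N -> bnd (y - cutv 0 q' y) eps.
Proof.
move=> yc e0; apply: contrapT => H.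
have step q : exists gq : {poly C} * nat, [/\ (q <= gq.2)%N, D gq.1,
    psupp q gq.2 gq.1 & exists2 t, eps <= t & ev gq.1 y = t%:C].
  have : exists2 q', (q <= q')%N & ~ bnd (y - cutv 0 q' y) eps.
    apply: contrapT => h; apply: H; exists q => q' qq.
    by apply: contrapT => nb; apply: h; exists q'.
  move=> [q' qq /not_bnd[f Df fe]].
  have [u [u1 uf]] := phaseP (ev f (y - cutv 0 q' y)).
  exists (u *: cut q' (maxn q' (size f)) f, maxn q' (size f)); split => /=.
  - by rewrite (leq_trans qq)// leq_maxl.
  - by apply: D_scale => //; exact: norming_cut.
  - move=> i iq; rewrite coefZ coef_cut; case: ifP => [|_]; last by rewrite mulr0.
    by move: iq; lia.
  - exists (cabs (ev f (y - cutv 0 q' y))); first exact: ltW.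
    rewrite evZl -uf ev_cut; congr (_ * _); apply: eq_ev => i fi.
    have si : (i < size f)%N by rewrite ltnNge; apply: contra fi => /(nth_default 0) ->.
    rewrite /cutv !fctE /= leq_max si orbT andbT.
    by case: ltnP => _; rewrite ?subrr ?subr0.
have [nx nxP] := choice step.
pose b l := iter l (fun q => (nx q).2) 0%N.
have [r0 rP] := weight_large c e0.
have := rP r0.*2; rewrite -addnn leq_addr => /(_ isT); rewrite addnn; apply/negP; rewrite -leNgt.
set w := r0.*2.
have FD : D ((weight R w)^-1%:C *: \sum_(l < arity w) (nx (b l)).1).
  apply: norming_weight; apply: (@norming_even _ w (arity w) b (fun l => (nx (b l)).1)) => //.
  - by rewrite /w odd_double.
  - by move=> l; have [] := nxP (b l).
  - by move=> l _; have [] := nxP (b l).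
  - by move=> l _; have [] := nxP (b l).
have := le_trans (Re_le_cabs _) (yc _ FD); apply: le_trans.
have tex l : exists t, eps <= t /\ ev (nx (b l)).1 y = t%:C.
  by have [_ _ _ [t]] := nxP (b l); exists t.
have [t tP] := choice tex.
have -> : ev ((weight R w)^-1%:C *: \sum_(l < arity w) (nx (b l)).1) y =
  ((weight R w)^-1 * \sum_(l < arity w) t l)%:C.
  rewrite evZl ev_suml rmorphM rmorph_sum/=; congr (_ * _).
  by apply: eq_bigr => l _; have [_] := tP l.
rewrite /= ler_pdivlMl ?weight_gt0// mulrA -expr2.
apply: (@le_trans _ _ (\sum_(l < arity w) eps)); last by apply: ler_sum => l _; have [] := tP l.
by rewrite sumr_const card_ord -[leRHS]mulr_natl ler_wpM2r ?(ltW e0) ?weight_sq_arity.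
Qed.

Definition fin S x := (exists q, supp 0 q x) /\ forall i, ~~ S i -> x i = 0.

(** One vector fit for a place with left end [P] in a RIS of constant [c] supported in [S]. The
    condition weakens as [P] decreases, so finitely many thresholds can be merged. *)
Definition ris_vec S (c : R) P x :=
  [/\ exists q, supp P q x, forall i, ~~ S i -> x i = 0, bnd x c &
      forall v, (v < P)%N -> wbnd v x (c / weight R v)].

Lemma ris_vec_fin S c P x : ris_vec S c P x -> fin S x.
Proof. by move=> [[q sx] Sx _ _]; split => //; exists q; apply: supp_sub sx. Qed.

Lemma ris_vec_le S c c' P P' x : c <= c' -> (P' <= P)%N -> ris_vec S c P x -> ris_vec S c' P' x.
Proof.
move=> cc PP [[q sx] Sx xc xw]; split=> //.
- by exists q; apply: supp_sub sx.
- exact: bnd_le xc.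
- move=> v vP; apply: (wbnd_le _ (xw v _)); last exact: leq_trans PP.
  by rewrite ler_wpM2r// invr_ge0 weight_ge0.
Qed.

Lemma ris_vec_sub S S' c P x : subpred S S' -> ris_vec S c P x -> ris_vec S' c P x.
Proof.
move=> SS [sx Sx xc xw]; split=> // i S'i; apply: Sx.
by apply: contra S'i; exact: SS.
Qed.

Lemma ris_vecD S c c' P x y : ris_vec S c P x -> ris_vec S c' P y -> ris_vec S (c + c') P (x + y).
Proof.
move=> [[q sx] Sx xc xw] [[q' sy] Sy yc yw]; split.
- exists (maxn q q'); apply: suppD; [apply: supp_widen sx _|apply: supp_widen sy _].
    exact: leq_maxl.
  exact: leq_maxr.
- by move=> i Si; rewrite fctE Sx// Sy// addr0.
- exact: bndD.
- by move=> v vP; rewrite mulrDl; apply: wbndD; [exact: xw|exact: yw].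
Qed.

Lemma fin0 S : fin S 0. Proof. by split => //; exists 0. Qed.

Lemma finZ S a x : fin S x -> fin S (a *: x).
Proof.
move=> [[q sx] Sx]; split; first by exists q; exact: suppZ.
by move=> i Si; rewrite fctE Sx// scaler0.
Qed.

Lemma finD S x y : fin S x -> fin S y -> fin S (x + y).
Proof.
move=> [[q sx] Sx] [[q' sy] Sy]; split; last first.
  by move=> i Si; rewrite fctE Sx// Sy// addr0.
exists (maxn q q'); apply: suppD; [apply: supp_widen sx _|apply: supp_widen sy _].
  exact: leq_maxl.
exact: leq_maxr.
Qed.

Lemma fin_sum S K (x : nat -> nat -> C) : (forall k, fin S (x k)) ->
  fin S (\sum_(k < K) x k).
Proof. by move=> Fx; elim/big_ind: _ => //; [exact: fin0|move=> a b; exact: finD]. Qed.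

(** An operator is recorded through its action on finitely supported vectors of [S]. [T] is total,
    with arbitrary values elsewhere, and its images may leave [S]. *)
Definition bop_on S (M : R) (T : (nat -> C) -> nat -> C) :=
  [/\ 0 <= M, forall a x y, fin S x -> fin S y -> T (a *: x + y) = a *: T x + T y &
      forall x c, fin S x -> bnd x c -> bnd (T x) (M * c)].

Section Bop.
Variables (S : pred nat) (M : R) (T : (nat -> C) -> nat -> C).
Hypothesis bT : bop_on S M T.

Lemma bop0 : T 0 = 0.
Proof.
have [_ lT _] := bT; have := lT 1 0 0 (fin0 S) (fin0 S).
rewrite !scale1r addr0 => /(congr1 (fun y => y - T 0)).
by rewrite subrr addrK.
Qed.

Lemma bopZ a x : fin S x -> T (a *: x) = a *: T x.
Proof.
by move=> Fx; have [_ lT _] := bT; have := lT a x 0 Fx (fin0 S); rewrite bop0 !addr0.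
Qed.

Lemma bopD x y : fin S x -> fin S y -> T (x + y) = T x + T y.
Proof.
by move=> Fx Fy; have [_ lT _] := bT; have := lT 1 x y Fx Fy; rewrite !scale1r.
Qed.

Lemma bop_sum K (x : nat -> nat -> C) : (forall k, fin S (x k)) ->
  T (\sum_(k < K) x k) = \sum_(k < K) T (x k).
Proof.
move=> Fx; elim: K => [|K IH]; first by rewrite !big_ord0 bop0.
by rewrite !big_ord_recr/= bopD ?IH//; exact: fin_sum.
Qed.

Lemma RIS_of_ris_vec c (X : nat -> nat -> C) (e : nat -> nat) :
  (forall P, ris_vec S c P (X P) /\ supp P (e P) (X P) /\ (P < e P)%N) ->
  forall r (u : nat -> C), (forall k, cabs (u k) <= 1) ->
  let P k := iter k e r in RIS c (fun k => u k *: X (P k)) P.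
Proof.
move=> XQ r u u1 P; split => k.
- by have [_ [_]] := XQ (P k).
- by apply: suppZ; have [_ [+ _]] := XQ (P k).
- by apply: bnd_ph => //; have [[]] := XQ (P k).
- by move=> v vP; apply: wbnd_ph => //; have [[_ _ _ +] _] := XQ (P k); exact.
Qed.

(** Otherwise some RIS, with phases chosen so that the [i]-th coordinates of the images add up, has
    a rescaled average of norm at most [3 * c] whose image has [i]-th coordinate at least
    [weight R r * eps]; this is impossible for large [r]. *)
Lemma coord_small (c eps : R) i : 0 < eps ->
  exists P, forall x, ris_vec S c P x -> cabs (T x i) <= eps.
Proof.
move=> e0; apply: contrapT => H.
have step P : exists xe : (nat -> C) * nat,
    (ris_vec S c P xe.1 /\ supp P xe.2 xe.1 /\ (P < xe.2)%N) /\ eps < cabs (T xe.1 i).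
  have [x Qx ex] : exists2 x, ris_vec S c P x & eps < cabs (T x i).
    apply: contrapT => h; apply: H; exists P => x Qx; rewrite leNgt; apply/negP => ex.
    by apply: h; exists x.
  have [[q sx] _ _ _] := Qx.
  exists (x, maxn q P.+1); split => //; split => //; split => /=; last exact: leq_maxr.
  by apply: supp_widen sx _; exact: leq_maxl.
have [nx nxP] := choice step.
have [M0 _ Tb] := bT.
have [r rP] := weight_large (M * (3 * c)) e0.
have := rP r (leqnn _); apply/negP; rewrite -leNgt.
pose P k := iter k (fun p => (nx p).2) r.
have [u uP] := choice (fun k => phaseP (T (nx (P k)).1 i)).
have u1 k : cabs (u k) <= 1 by have [] := uP k.
pose x k := u k *: (nx (P k)).1.
have xR : RIS c x P by apply: (RIS_of_ris_vec (fun p => (nxP p).1)).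
have Fx k : fin S (x k) by apply/finZ/(ris_vec_fin (proj1 (nxP (P k)).1)).
have Fz : fin S (rescaled_avg r x) by apply/finZ/fin_sum.
have := bnd_coord i (Tb _ _ Fz (rescaled_avg_bnd xR (leqnn _))); apply: le_trans.
rewrite bopZ; last exact: fin_sum.
rewrite bop_sum// fctE fct_sumE.
have -> : \sum_(k < arity r) T (x k) i = (\sum_(k < arity r) cabs (T (nx (P k)).1 i))%:C.
  rewrite rmorph_sum; apply: eq_bigr => k _.
  rewrite /x bopZ; last exact: ris_vec_fin (proj1 (nxP (P k)).1).
  exact: (uP k).2.
rewrite cabsM !cabsR ger0_norm ?rescaled_avg_coef_ge0// ger0_norm ?sumr_ge0//; last first.
  by move=> k _; exact: cabs_ge0.
rewrite -mulrA ler_wpM2l ?weight_ge0// ler_pdivlMl ?ltr0n ?arity_gt0//.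
apply: (@le_trans _ _ (\sum_(k < arity r) eps)).
  by rewrite sumr_const card_ord -[leRHS]mulr_natl.
by apply: ler_sum => k _; apply: ltW; have [] := nxP (P k).
Qed.

Lemma cutv_recr p y : cutv 0 p.+1 y = cutv 0 p y + y p *: (fun i => (i == p)%:R).
Proof.
apply/funext => i; rewrite /cutv !fctE /= ltnS leq_eqVlt.
have [->|ip] := eqVneq i p; first by rewrite ltnn add0r /= /GRing.scale/= mulr1.
by rewrite /= /GRing.scale/= mulr0 addr0.
Qed.

Lemma left_small (c eps : R) p : 0 < eps ->
  exists P, forall x, ris_vec S c P x -> bnd (cutv 0 p (T x)) eps.
Proof.
elim: p eps => [|p IH] eps e0.
  exists 0%N => x _; suff -> : cutv 0 0 (T x) = 0 by apply: bnd_le (@bnd0 R); exact: ltW.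
  by apply/funext => i; rewrite /cutv ltn0 andbF.
have e2 : 0 < eps / 2 by rewrite divr_gt0.
have [P1 H1] := IH _ e2; have [P2 H2] := coord_small c p e2.
exists (maxn P1 P2) => x Qx; rewrite cutv_recr [eps]splitr; apply: bndD.
  by apply/H1/(ris_vec_le _ _ Qx) => //; exact: leq_maxl.
rewrite -[_ / 2]mulr1; apply: bnd_le (bndZ _ (@bnd_basis R p)); rewrite mulr1 mulr1.
by apply/H2/(ris_vec_le _ _ Qx) => //; exact: leq_maxr.
Qed.

Lemma near_norming x c : bnd x c ->
  exists2 g, D g & forall f, D f -> cabs (ev f x) <= 2 * cabs (ev g x).
Proof.
move=> xc; pose E := [set cabs (ev f x) | f in D].
have hE : has_sup E.
  split; first by exists (cabs (ev 0 x)), 0 => //; exact: D0.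
  by exists c => _ [f Df <-]; exact: xc.
have Ef f : D f -> cabs (ev f x) <= sup E.
  by move=> Df; apply: ub_le_sup; [exact: hE.2|exists f].
have [s0|s0] := leP (sup E) 0.
  exists 0; first exact: D0.
  by move=> f Df; rewrite (le_trans (Ef f Df))// (le_trans s0)// mulr_ge0// cabs_ge0.
have [|_ [g Dg <-] hg] := @sup_adherent _ E (sup E / 2) _ hE; first by rewrite divr_gt0.
by exists g => // f Df; rewrite (le_trans (Ef f Df))//; lra.
Qed.

(* Combining an almost norming [g] for [x] with a functional [f] that is large on
   [T x - (g (T x) / g x) x] avoids Hahn-Banach. *)
Lemma kill_functional x (c eps : R) : fin S x -> bnd x c ->
  (forall lam : C, ~ bnd (T x - lam *: x) eps) ->
  exists2 h, D h & ev h x = 0 /\ eps / 3 < cabs (ev h (T x)).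
Proof.
move=> Fx xc nb; have [g Dg gx] := near_norming xc.
have [f Df fe] := not_bnd (nb (ev g (T x) / ev g x)).
set a := ev f x / ev g x.
exists ((3^-1)%:C *: f + (- (3^-1)%:C * a) *: g).
  apply: norming_conv => //; rewrite cabsM cabsN !cabsR ger0_norm ?invr_ge0//.
  suff a2 : cabs a <= 2 by lra.
  have [g0|g0] := eqVneq (ev g x) 0; first by rewrite /a g0 invr0 mulr0 cabs0.
  by rewrite cabsM cabsV ler_pdivrMr ?cabs_gt0// gx.
rewrite !evDl !evZl; split.
  have [g0|g0] := eqVneq (ev g x) 0.
    have := gx f Df; rewrite g0 cabs0 mulr0 => f0.
    suff -> : ev f x = 0 by rewrite !mulr0 addr0.
    by apply: cabs_eq0; apply/eqP; rewrite eq_le f0 cabs_ge0.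
  by rewrite -mulrA /a divfK// mulNr subrr.
have -> : (3^-1)%:C * ev f (T x) + - (3^-1)%:C * a * ev g (T x) =
  (3^-1)%:C * ev f (T x - ev g (T x) / ev g x *: x).
  by rewrite evBr evZr /a; ring.
by rewrite cabsM cabsR ger0_norm ?invr_ge0// mulrC ltr_pM2l// invr_gt0.
Qed.

End Bop.
End Operators.

(** * Approximation of functionals by codes *)

Section Approximation.
Variable R : realType.
Local Notation C := R[i].

Lemma rat_approx (x eps : R) : 0 < eps -> exists q : rat, `|x - ratr q| <= eps.
Proof.
move=> e0; have xe : x - eps < x + eps by lra.
have [q] := rat_in_itvoo xe; rewrite in_itv/= => /andP[h1 h2].
by exists q; rewrite ler_norml; apply/andP; split; lra.
Qed.

Lemma crat_approx (x : C) (eps : R) : 0 < eps -> exists q, cabs (x - crat R q) <= eps.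
Proof.
move=> e0; have e2 : 0 < eps / 2 by rewrite divr_gt0.
have [a ha] := rat_approx (complex.Re x) e2; have [b hb] := rat_approx (complex.Im x) e2.
exists (a, b); rewrite (le_trans (cabs_le_ReIm _))// [eps]splitr lerD//.
  by rewrite /crat /=; case: x ha {hb} => u v /=; simpc.
by rewrite /crat /=; case: x hb {ha} => u v /=; simpc.
Qed.

Lemma inj_unbounded (f : nat -> nat) b : injective f -> exists t, (b <= f t)%N.
Proof.
move=> fi; apply: contrapT => H.
have fb t : (f t < b)%N by rewrite ltnNge; apply/negP => h; apply: H; exists t.
pose F (t : 'I_b.+1) : 'I_b := Ordinal (fb t).
have /leq_card : injective F by move=> s t [/fi/val_inj].
by rewrite !card_ord ltnn.
Qed.

(** Varying the free second component of the code changes [sigma] injectively, hence pushes the next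
    weight beyond any bound [b] without affecting the approximation. *)
Lemma code_approx (r : nat) (f : {poly C}) (L : seq code) b : exists c,
  l1 (f - decode R c) <= (arity r)%:R^-1 /\ (b <= sigma r (rcons L c))%N.
Proof.
set e : R := (arity r)%:R^-1; have e0 : 0 < e by rewrite invr_gt0 ltr0n arity_gt0.
have en : 0 < e / (size f).+1%:R by rewrite divr_gt0.
have [q qP] := choice (fun i => crat_approx f`_i en).
have [t bt] : exists t, (b <= sigma r (rcons L (mkseq q (size f), t)))%N.
  apply: inj_unbounded => t t' /sigma_inj/(congr1 (last ([::], 0%N))).
  by rewrite !last_rcons => -[].
exists (mkseq q (size f), t); split => //; set p := f - _.
have sp : (size p <= size f)%N.
  rewrite (leq_trans (size_polyD _ _))// size_polyN geq_max leqnn/=.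
  by rewrite (leq_trans (size_poly _ _))//= size_mkseq.
apply: (@le_trans _ _ (\sum_(i < size p) e / (size f).+1%:R)).
  apply: ler_sum => i _; rewrite coefB coef_poly size_mkseq.
  have si : (i < size f)%N by rewrite (leq_trans (ltn_ord i)).
  by rewrite si nth_mkseq.
rewrite sumr_const card_ord -[leLHS]mulr_natl mulrCA ler_piMr ?(ltW e0)//.
by rewrite ler_pdivrMr// mul1r ler_nat leqW.
Qed.

End Approximation.

(** * Dependent sequences exclude operators far from scalars on RIS *)

Section Contradiction.
Variable R : realType.
Local Notation C := R[i].
Implicit Types (f g : {poly C}).

Section BadSequence.
Variables (S : pred nat) (M : R) (T : (nat -> C) -> nat -> C).
Hypothesis bT : bop_on S M T.
Variables (c delta : R) (x : nat -> nat -> C) (h : nat -> {poly C})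
  (P : nat -> nat) (t : nat -> R).
Hypotheses (delta0 : 0 < delta) (xP : RIS c x P) (Fx : forall k, fin S (x k)).
Hypotheses (Dh : forall k, D (h k)) (sh : forall k, psupp (P k) (P k.+1) (h k)).
Hypothesis hx : forall k, ev (h k) (x k) = 0.
Hypothesis hT : forall k, ev (h k) (T (x k)) = (t k)%:C.
Hypothesis t_ge : forall k, delta <= t k.
Hypothesis err : forall k,
  bnd (T (x k) - cutv (P k) (P k.+1) (T (x k))) (2^-1 ^+ k.+1 * delta).

Let Pm k : (P k < P k.+1)%N. Proof. by have [] := xP. Qed.
Let Pm' k : (P k <= P k.+1)%N. Proof. exact: ltnW. Qed.
Let Pleq := mono_leq Pm'.

Let blockf w s : {poly C} := (weight R w)^-1%:C *: \sum_(i < arity w) h (s + i).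
Let blockz w s : nat -> C := rescaled_avg w (fun i => x (s + i)).

Let hcut k l y : ev (h k) (cutv (P l) (P l.+1) y) = if k == l then ev (h k) y else 0.
Proof.
case: eqP => [->|/eqP kl]; first by rewrite -ev_cut cut_id.
apply: (ev_disjoint (@sh k) (@supp_cutv _ (P l) (P l.+1) y)).
by move: kl; rewrite neq_ltn => /orP[] kl; rewrite (Pleq kl) ?orbT.
Qed.

Let hxx k l : ev (h k) (x l) = 0.
Proof.
have [_ sx _ _] := xP; rewrite -(cutv_id (sx l)) hcut; case: eqP => // ->.
exact: hx.
Qed.

Let RIS_shift s : RIS c (fun i => x (s + i)) (fun i => P (s + i)).
Proof.
have [_ sx xc xw] := xP; split => // k; rewrite ?addnS//.
by move=> v; exact: xw.
Qed.

Section OddWeight.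
Variable r : nat.
Hypothesis r_odd : odd r.

Let code_ex (Le : seq code * nat) : exists c,
  let w := sigma r Le.1 in let s := maxn Le.2 w in
  l1 (blockf w s - decode R c) <= (arity r)%:R^-1 /\
  (P (s + arity w) <= sigma r (rcons Le.1 c))%N.
Proof. exact: code_approx. Qed.

Let cd Le := sval (cid (code_ex Le)).

Let cdP Le : let w := sigma r Le.1 in let s := maxn Le.2 w in
  l1 (blockf w s - decode R (cd Le)) <= (arity r)%:R^-1 /\
  (P (s + arity w) <= sigma r (rcons Le.1 (cd Le)))%N.
Proof. exact: svalP (cid (code_ex Le)). Qed.

(** The state holds the codes chosen so far and the first index not yet used. A block starts at the
    maximum of that index and its weight [w], which ensures [w <= P s] as the averages require; its
    code is chosen so that the next weight lies beyond the support of the block. *)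
Let next (Le : seq code * nat) := let w := sigma r Le.1 in
  (rcons Le.1 (cd Le), maxn Le.2 w + arity w)%N.
Let st k := iter k next ([::], 0%N).
Let cc k := cd (st k).
Let w k := sigma r (mkseq cc k).
Let s k := maxn (st k).2 (w k).

Let st1 k : (st k).1 = mkseq cc k.
Proof. by elim: k => // k IH; rewrite mkseqS -IH. Qed.

Let st2 k : (st k.+1).2 = (s k + arity (w k))%N.
Proof. by rewrite /s /w -st1. Qed.

Let ccP k : l1 (blockf (w k) (s k) - decode R (cc k)) <= (arity r)%:R^-1.
Proof. by have [+ _] := cdP (st k); rewrite st1. Qed.

Let wS k : (P (s k + arity (w k)) <= w k.+1)%N.
Proof. by have [_] := cdP (st k); rewrite st1 -/(s k) /w mkseqS. Qed.

Let wP k : (w k <= P (s k))%N.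
Proof. by rewrite (leq_trans _ (gtn_id Pm (s k)))// leq_maxr. Qed.

Let s_gt k : (s k < s k.+1)%N.
Proof.
rewrite {2}/s st2 (@leq_trans (s k + arity (w k)))// ?leq_maxl//.
by rewrite -[ltnLHS]addn0 ltn_add2l arity_gt0.
Qed.

Let w_gt k : (w k < w k.+1)%N.
Proof.
rewrite (leq_ltn_trans (wP k))// (leq_trans _ (wS k))//.
rewrite (leq_trans (Pm (s k)))// Pleq// -[ltnLHS]addn0 ltn_add2l arity_gt0//.
Qed.

Let z k := blockz (w k) (s k).
Let f k := blockf (w k) (s k).

Let c0 : 0 <= c. Proof. by have [_ _ xc _] := xP; exact: bnd_ge0 (xc 0). Qed.

Let wP' k : (w k <= P (s k + 0))%N. Proof. by rewrite addn0. Qed.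

Let zR : RIS (3 * c) z w.
Proof.
split => // k.
- apply: (supp_sub _ _ (@rescaled_avg_supp _ _ _ _ (w k) (RIS_shift (s k)))); first exact: wP'.
  exact: wS.
- exact: rescaled_avg_bnd (RIS_shift (s k)) (wP' k).
- move=> v vw; apply: (wbnd_le _ (@rescaled_avg_wbnd_lt _ _ _ _ _ (RIS_shift (s k)) (wP' k) _ vw)).
  by rewrite ler_wpM2r ?invr_ge0 ?weight_ge0//; have := c0; lra.
Qed.

Let z_gt k v : (w k < v)%N -> wbnd v (z k) (3 * c / weight R (w k)).
Proof.
move=> wv; apply: (wbnd_le _ (@rescaled_avg_wbnd_gt _ _ _ _ _ (RIS_shift (s k)) _ wv)).
by rewrite ler_wpM2r ?invr_ge0 ?weight_ge0//; have := c0; lra.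
Qed.

Let fz k : ev (f k) (z k) = 0.
Proof.
by rewrite evZl evZr ev_suml big1 ?mulr0// => i _; rewrite ev_sumr big1.
Qed.

Let Wf k : W (w k) (f k).
Proof.
apply: (@norming_even _ (w k) (arity (w k)) (fun i => P (s k + i)) (fun i => h (s k + i))) => //.
- by rewrite /w /sigma odd_double.
- by move=> l; rewrite addnS.
- by move=> l _; rewrite addnS.
Qed.

Let sf k : psupp (w k) (w k.+1) (f k).
Proof.
move=> i iw; rewrite coefZ coef_sum big1 ?mulr0// => j _; apply: sh.
apply: contra iw => /andP[h1 h2]; apply/andP; split.
  by rewrite (leq_trans (wP k))// (leq_trans _ h1)// Pleq// leq_addr.
by rewrite (leq_trans h2)// (leq_trans _ (wS k))// Pleq// -addnS leq_add2l.
Qed.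

Let F : {poly C} := (weight R r)^-1%:C *: \sum_(k < arity r) f k.

Let DF : D F.
Proof.
apply: (@norming_weight _ r).
(* The odd clause asks for a cut; this one contains all supports and changes nothing. *)
have -> : F = (weight R r)^-1%:C *: \sum_(k < arity r) cut 0 (w (arity r)) (f k).
  congr (_ *: _); apply: eq_bigr => k _; rewrite cut_id//.
  apply: psupp_sub (@sf k) => //.
  have w_le j : (w j <= w j.+1)%N by exact: ltnW (w_gt j).
  exact: (mono_leq w_le (ltn_ord k)).
apply: (@norming_odd _ r (arity r) w f cc) => // l; first exact: ltnW (w_gt l).
  by move=> _; exact: Wf.
by move=> _; exact: ccP.
Qed.

Let blk k i : (i < arity (w k))%N -> (s k <= s k + i < s k.+1)%N.
Proof. by move=> ik; rewrite leq_addr {2}/s st2 leq_max -addnS leq_add2l ik. Qed.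

(** On the part of [T (x n)] within the interval of [x n] only [h n] acts, reduced by the weights
    [w k] and [r]. The remainder is controlled by [err], with the exponent weakened from [n.+1] to
    [i.+1]. *)
Let Fx_ge k i : (i < arity (w k))%N -> (k < arity r)%N ->
  (weight R r)^-1 * (weight R (w k))^-1 * delta - 2^-1 ^+ i.+1 * delta <=
  complex.Re (ev F (T (x (s k + i)))).
Proof.
move=> ik kr; set n := (s k + i)%N.
have -> : ev F (T (x n)) = ev F (cutv (P n) (P n.+1) (T (x n))) +
    ev F (T (x n) - cutv (P n) (P n.+1) (T (x n))) by rewrite -evDr addrC subrK.
have -> : ev F (cutv (P n) (P n.+1) (T (x n))) = ((weight R r)^-1 * (weight R (w k))^-1 * t n)%:C.
  rewrite evZl ev_suml (bigD1 (Ordinal kr))//= big1 ?addr0; last first.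
    move=> l kl; rewrite evZl ev_suml big1 ?mulr0// => j _.
    rewrite hcut; case: eqP => // e; case/negP: kl; apply/eqP/val_inj => /=.
    have sl l' : (s l' <= s l'.+1)%N by exact: ltnW (s_gt l').
    apply: (mono_uniq sl (i := n)); last exact: blk.
    by rewrite -e; exact: blk.
  rewrite evZl ev_suml (bigD1 (Ordinal ik))//= big1 ?addr0; last first.
    move=> j ji; rewrite hcut; case: eqP => // /addnI e.
    by case/negP: ji; apply/eqP/val_inj.
  by rewrite hcut eqxx hT -!rmorphM mulrA.
rewrite raddfD/=; apply: lerD.
  by rewrite ler_wpM2l// mulr_ge0// invr_ge0 weight_ge0.
have : complex.Re (- ev F (T (x n) - cutv (P n) (P n.+1) (T (x n)))) <= 2^-1 ^+ i.+1 * delta.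
  rewrite (le_trans (Re_le_cabs _))// cabsN (le_trans (@err n _ DF))//.
  by rewrite ler_wpM2r ?(ltW delta0)// ler_wiXn2l ?invr_ge0 ?invf_le1 ?ler1n// ltnS leq_addl.
by rewrite raddfN/=; lra.
Qed.

(** The main terms average to [delta / weight R r]. The errors are summable and carry the factor
    [a], which is at most [(2 * weight R r)^-1], so they consume at most half of this. *)
Let Fz_ge k : (k < arity r)%N -> delta / (2 * weight R r) <= complex.Re (ev F (T (z k))).
Proof.
move=> kr; have Fxs i : fin S (x (s k + i)) by [].
rewrite (bopZ bT); last exact: (@fin_sum _ S _ (fun i => x (s k + i)) Fxs).
rewrite (bop_sum bT _ Fxs) evZr ev_sumr.
set a : R := weight R (w k) / (arity (w k))%:R.
have n0 : 0 < (arity (w k))%:R :> R by rewrite ltr0n arity_gt0.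
have wg := weight_gt0 R (w k); have rg := weight_gt0 R r.
have -> : forall u : C, complex.Re (a%:C * u) = a * complex.Re u.
  by move=> [u v]; rewrite /= mul0r subr0.
rewrite raddf_sum/=.
apply: (@le_trans _ _ (a * \sum_(i < arity (w k))
    ((weight R r)^-1 * (weight R (w k))^-1 * delta - 2^-1 ^+ i.+1 * delta))); last first.
  rewrite ler_wpM2l ?divr_ge0 ?weight_ge0//.
  by apply: ler_sum => i _; exact: Fx_ge.
rewrite big_split/= sumr_const card_ord -[X in _ * (X + _)]mulr_natl sumrN -mulr_suml mulrDr.
have -> : a * ((arity (w k))%:R * ((weight R r)^-1 * (weight R (w k))^-1 * delta)) = delta / weight R r.
  by rewrite /a; field; rewrite ?lt0r_neq0.
have a1 : a <= (weight R (w k))^-1.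
  by rewrite ler_pdivrMr// ler_pdivlMl// -expr2 weight_sq_arity.
have a2 : a <= (2 * weight R r)^-1.
  rewrite (le_trans a1)// lef_pV2 ?posrE ?mulr_gt0//.
  have rw : (r < w k)%N.
    by rewrite (leq_trans (arity_gtn r))// (leq_trans _ (sigma_ge _ _))// -addnn leq_addr.
  rewrite (le_trans _ (weight_sq R rw))// expr2 ler_wpM2r ?weight_ge0//.
  by rewrite /weight -[leLHS]expr1 ler_eXn2l ?ltr1n// expn_gt0.
have a0 : 0 <= a by rewrite divr_ge0 ?weight_ge0.
have : a * ((\sum_(i < arity (w k)) 2^-1 ^+ i.+1) * delta) <= (2 * weight R r)^-1 * (1 * delta).
  have s0 : 0 <= \sum_(i < arity (w k)) 2^-1 ^+ i.+1 :> R.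
    by apply: sumr_ge0 => i _; rewrite exprn_ge0// invr_ge0.
  apply: ler_pM => //; first by rewrite mulr_ge0// ltW.
  by rewrite ler_wpM2r ?(ltW delta0)// sum_halves.
rewrite mulrN mul1r.
have -> : delta / weight R r = (2 * weight R r)^-1 * delta + (2 * weight R r)^-1 * delta.
  by field; rewrite lt0r_neq0.
by rewrite [delta / _]mulrC; lra.
Qed.

(** [arity r] terms of size [delta / (2 * weight R r)] face [M] times the bound of [dependent_bound]
    for constant [3 * c], that is [9 * c * arity r / weight R r ^ 2]; hence the 18. *)
Lemma bad_sequence_bound : weight R r * delta <= M * (18 * c).
Proof.
have [M0 _ Tb] := bT.
have Fz k : fin S (z k) by apply/finZ/(@fin_sum _ S _ (fun i => x (s k + i))).
have n0 : 0 < (arity r)%:R :> R by rewrite ltr0n arity_gt0.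
have rg := weight_gt0 R r.
have zb : bnd (\sum_(k < arity r) z k) (3 * (3 * c) * (arity r)%:R / weight R r ^+ 2).
  by move=> g Dg; exact: dependent_bound r_odd zR z_gt fz ccP _ Dg.
have := le_trans (Re_le_cabs _) (Tb _ _ (fin_sum _ Fz) zb _ DF).
rewrite (bop_sum bT)// ev_sumr raddf_sum/= => H.
have {}H := le_trans (ler_sum _ (fun (k : 'I_(arity r)) _ => Fz_ge (ltn_ord k))) H.
move: H; rewrite sumr_const card_ord -[leLHS]mulr_natl.
have -> : M * (3 * (3 * c) * (arity r)%:R / weight R r ^+ 2) =
  (arity r)%:R / (2 * weight R r ^+ 2) * (M * (18 * c)) by field; rewrite lt0r_neq0.
have -> : (arity r)%:R * (delta / (2 * weight R r)) =
  (arity r)%:R / (2 * weight R r ^+ 2) * (weight R r * delta) by field; rewrite lt0r_neq0.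
by rewrite ler_pM2l// divr_gt0// mulr_gt0// exprn_gt0.
Qed.

End OddWeight.

Lemma no_bad_sequence : False.
Proof.
have [r0 rP] := weight_large (M * (18 * c)) delta0.
have := rP r0.*2.+1; rewrite -addnn -addnS leq_addr => /(_ isT).
apply/negP; rewrite -leNgt; apply: bad_sequence_bound.
by rewrite addnS addnn /= odd_double.
Qed.

End BadSequence.

(** Failure at every threshold yields, stage by stage, the data refuted by [no_bad_sequence]. The
    image [T x] is small to the left of [p] by [left_small] and to the right of [q] by [tail_small],
    so the functional of [kill_functional] may be cut to this interval: its value, above [eps / 3],
    drops by at most [eta <= eps / 6]. *)
Lemma dist_small S M (T : (nat -> C) -> nat -> C) (c eps : R) : bop_on S M T -> 0 < eps ->
  exists P, forall x, ris_vec S c P x -> exists lam : C, bnd (T x - lam *: x) eps.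
Proof.
move=> bT e0; apply: contrapT => H.
have e6 : 0 < eps / 6 by rewrite divr_gt0.
have step p : exists y : (nat -> C) * {poly C} * nat * R,
    let: (x, h, q, t) := y in
    [/\ ris_vec S c p x /\ (supp p q x /\ (p < q)%N), D h /\ psupp p q h,
        ev h x = 0, ev h (T x) = t%:C /\ eps / 6 <= t &
        bnd (T x - cutv p q (T x)) (2^-1 ^+ p.+1 * (eps / 6))].
  set eta := 2^-1 ^+ p.+1 * (eps / 6).
  have eta0 : 0 < eta by rewrite mulr_gt0// exprn_gt0// invr_gt0.
  have eta1 : eta <= eps / 6.
    by rewrite ler_piMl ?(ltW e6)// exprn_ile1// ?invr_ge0// invf_le1// ler1n.
  have eta2 : 0 < eta / 2 by rewrite divr_gt0.
  have [P1 HP1] := left_small bT c p eta2.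
  have [x Qx nb] : exists2 x, ris_vec S c (maxn p P1) x & forall lam, ~ bnd (T x - lam *: x) eps.
    apply: contrapT => h; apply: H; exists (maxn p P1) => x Qx.
    apply: contrapT => h'; apply: h; exists x => // lam lb; apply: h'.
    by exists lam.
  have [[q0 sx] Sx xc _] := Qx.
  have [_ _ Tb] := bT.
  have [q1 Hq1] := tail_small (Tb _ _ (ris_vec_fin Qx) xc) eta2.
  pose q := maxn p.+1 (maxn q0 q1).
  have [h0 Dh0 [h0x h0T]] := kill_functional (ris_vec_fin Qx) xc nb.
  have pq : (p < q)%N by rewrite leq_maxl.
  have sxq : supp p q x.
    by apply: supp_sub sx; rewrite ?leq_maxl// leq_max leq_max leqnn orbT.
  have Terr : bnd (T x - cutv p q (T x)) eta.
    have -> : T x - cutv p q (T x) = cutv 0 p (T x) + (T x - cutv 0 q (T x)).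
      apply/funext => i; rewrite /cutv !fctE /=.
      case: (ltnP i q) => iq; rewrite ?andbF ?andbT ?subr0.
        by case: ltnP; rewrite ?subrr ?subr0 ?addr0 ?add0r.
      by case: ltnP; rewrite ?add0r//; lia.
    rewrite [eta]splitr; apply: bndD.
      by apply/HP1/(ris_vec_le _ _ Qx) => //; exact: leq_maxr.
    by apply: Hq1; rewrite leq_max leq_max leqnn !orbT.
  have [u [u1 uh]] := phaseP (ev (cut p q h0) (T x)).
  exists (x, u *: cut p q h0, q, cabs (ev (cut p q h0) (T x))); split.
  - split; last by split.
    by apply: ris_vec_le Qx => //; exact: leq_maxl.
  - split; first by apply: D_scale => //; exact: norming_cut.
    by move=> i ii; rewrite coefZ psupp_cut// mulr0.
  - by rewrite evZl ev_cut cutv_id// h0x mulr0.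
  - split; first by rewrite evZl.
    rewrite ev_cut; have := Terr _ Dh0; rewrite evBr => e1.
    have := cabs_ler (ev h0 (T x)) (ev h0 (T x) - ev h0 (cutv p q (T x))).
    by rewrite subKr => e2; lra.
  - exact: Terr.
have [nx nxP] := choice step.
pose P k := iter k (fun p => (nx p).1.2) 0%N.
apply: (@no_bad_sequence S M T bT c (eps / 6) (fun k => (nx (P k)).1.1.1)
   (fun k => (nx (P k)).1.1.2) P (fun k => (nx (P k)).2)) => //.
- have XQ p : ris_vec S c p (nx p).1.1.1 /\ supp p (nx p).1.2 (nx p).1.1.1 /\ (p < (nx p).1.2)%N.
    by have := nxP p; case: (nx p) => [[[x h] q] t] [].
  have u1 (k : nat) : cabs ((fun=> 1 : C) k) <= 1 by rewrite cabs1.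
  have := RIS_of_ris_vec XQ 0 u1; rewrite -/P => HR.
  have -> : (fun k => (nx (P k)).1.1.1) = (fun k => 1 *: (nx (P k)).1.1.1).
    by apply/funext => k; rewrite scale1r.
  exact: HR.
- by move=> k; have := nxP (P k); case: (nx _) => [[[x h] q] t] [[/ris_vec_fin]].
- by move=> k; have := nxP (P k); case: (nx _) => [[[x h] q] t] [_ []].
- by move=> k; have := nxP (P k); rewrite /P iterS -/(P k); case: (nx _) => [[[x h] q] t] [_ []].
- by move=> k; have := nxP (P k); case: (nx _) => [[[x h] q] t] [].
- by move=> k; have := nxP (P k); case: (nx _) => [[[x h] q] t] [_ _ _ []].
- by move=> k; have := nxP (P k); case: (nx _) => [[[x h] q] t] [_ _ _ []].
- move=> k; have kP : (k <= P k)%N.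
    apply: gtn_id => j; rewrite /P iterS -/(P j); have := nxP (P j).
    by case: (nx _) => [[[x h] q] t] [[_ []]].
  have := nxP (P k); rewrite /P iterS -/(P k).
  case: (nx _) => [[[x h] q] t] [_ _ _ _]; apply: bnd_le.
  rewrite ler_wpM2r ?(ltW e6)// ler_wiXn2l ?invr_ge0 ?invf_le1 ?ler1n//.
Qed.

End Contradiction.

(** * Existence of the scalar part *)

Section ScalarPart.
Variable R : realType.
Local Notation C := R[i].
Implicit Types (f g : {poly C}) (S : pred nat).

Lemma cutvD p q (x y : nat -> C) : cutv p q (x + y) = cutv p q x + cutv p q y.
Proof.
by apply/funext => i; rewrite /cutv !fctE /cutv; case: ifP => _; rewrite ?addr0.
Qed.

Lemma cutvZ p q a (x : nat -> C) : cutv p q (a *: x) = a *: cutv p q x.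
Proof.
by apply/funext => i; rewrite /cutv !fctE /cutv; case: ifP => _; rewrite ?scaler0.
Qed.

Definition unbounded S := forall n, exists2 k, (n <= k)%N & S k.

(** A rescaled average of unit vectors at positions in [S], paired with the functional of the even
    weight [P.*2] on the same positions. Unit vectors form a RIS of constant 1, so
    [rescaled_avg_bnd] gives the 3. *)
Lemma reference_vector S P : unbounded S -> exists ug : (nat -> C) * {poly C},
  [/\ ris_vec S 3 P ug.1, D ug.2, ev ug.2 ug.1 = 1 & forall i, ~~ S i -> ug.2`_i = 0].
Proof.
move=> US; pose r := P.*2.
have US' n : exists k, (n <= k)%N /\ S k by have [k] := US n; exists k.
have [nx nxP] := choice US'.
pose t k := iter k (fun n => nx n.+1) (nx r).
have tm k : (t k < t k.+1)%N by rewrite /t iterS; have [] := nxP (t k).+1.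
have tm' k : (t k <= t k.+1)%N by exact: ltnW.
have St k : S (t k).
  by case: k => [|k]; rewrite /t ?iterS; [have [] := nxP r|have [] := nxP (t k).+1].
have rt : (r <= t 0)%N by have [] := nxP r.
have Pr : (P <= r)%N by rewrite /r -addnn leq_addr.
pose e k : nat -> C := fun i => (i == t k)%:R.
have eR : RIS 1 e t.
  split => // k.
  - move=> i; rewrite /e; case: eqP => // ->; rewrite leqnn tm//.
  - exact: bnd_basis.
  - by move=> v _; rewrite div1r; exact: wbnd_basis.
pose g : {poly C} := (weight R r)^-1%:C *: \sum_(l < arity r) 'X^(t l).
exists (rescaled_avg r e, g); split => /=.
- split.
  + exists (t (arity r)); apply: (supp_sub _ _ (@rescaled_avg_supp _ _ _ _ r eR)) => //.
    exact: leq_trans Pr rt.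
  + move=> i Si; rewrite /rescaled_avg fctE fct_sumE big1 ?scaler0// => k _.
    by rewrite /e; case: eqP => // ik; move: Si; rewrite ik St.
  + by rewrite -[3]mulr1; exact: rescaled_avg_bnd eR rt.
  + move=> v vP; apply: (wbnd_le _ (@rescaled_avg_wbnd_lt _ _ _ _ _ eR rt _ (leq_trans vP Pr))).
    by rewrite ler_wpM2r ?invr_ge0 ?weight_ge0//; lra.
- apply: (@norming_weight _ r); apply: (@norming_even _ r (arity r) t (fun l => 'X^(t l))) => //.
  + by rewrite /r odd_double.
  + by move=> l _; exact: norming_basis.
  + move=> l _ i; rewrite coefXn; case: eqP => // ->; rewrite leqnn tm//.
- rewrite evZl evZr ev_suml.
  have -> : \sum_(i < arity r) ev 'X^(t i) (\sum_(k < arity r) e k) = (arity r)%:R%:C.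
    rewrite rmorph_nat; transitivity (\sum_(i < arity r) (1 : C)).
      apply: eq_bigr => i _; rewrite evXn fct_sumE (bigD1 i)//= big1 ?addr0 ?/e ?eqxx//.
      move=> k ki; case: eqP => // /esym h; case/negP: ki; apply/eqP/val_inj.
      by apply: (mono_uniq tm' (i := t k)); rewrite ?leqnn ?tm//= -h leqnn tm.
    by rewrite sumr_const card_ord.
  have n0 : 0 < (arity r)%:R :> R by rewrite ltr0n arity_gt0.
  have wg := weight_gt0 R r; rewrite -!rmorphM.
  suff -> : (weight R r)^-1 * (weight R r / (arity r)%:R * (arity r)%:R) = 1 by [].
  by field; rewrite ?lt0r_neq0.
- move=> i Si; rewrite coefZ coef_sum big1 ?mulr0// => k _.
  by rewrite coefXn; case: eqP => // ik; move: Si; rewrite ik St.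
Qed.

Lemma cauchy_limR (a : nat -> R) :
  (forall e, 0 < e -> exists P, forall p q, (P <= p)%N -> (P <= q)%N -> `|a p - a q| <= e) ->
  exists l, forall e, 0 < e -> exists P, forall p, (P <= p)%N -> `|a p - l| <= e.
Proof.
move=> ca; pose E := [set y | exists P, forall n, (P <= n)%N -> y <= a n].
have bd e P : 0 < e -> (forall p q, (P <= p)%N -> (P <= q)%N -> `|a p - a q| <= e) ->
    E (a P - e) /\ ubound E (a P + e).
  move=> e0 aP; split.
    exists P => n Pn; have := aP P n (leqnn _) Pn; rewrite ler_norml => /andP[_]; lra.
  move=> y [P' yP']; have := yP' (maxn P P') (leq_maxr _ _).
  have := aP P (maxn P P') (leqnn _) (leq_maxl _ _); rewrite ler_norml => /andP[]; lra.
have [P1 aP1] := ca 1 ltr01; have [E1 U1] := bd 1 P1 ltr01 aP1.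
have hE : has_sup E by split; [exists (a P1 - 1)|exists (a P1 + 1)].
exists (sup E) => e e0; have e2 : 0 < e / 2 by rewrite divr_gt0.
have [P aP] := ca _ e2; have [EP UP] := bd _ P e2 aP.
exists P => p Pp; have h1 : a P - e / 2 <= sup E by apply: ub_le_sup => //; exact: hE.2.
have h2 : sup E <= a P + e / 2 by apply: ge_sup => //; exact: hE.1.
have := aP p P Pp (leqnn _); rewrite !ler_norml => /andP[h3 h4].
by apply/andP; split; lra.
Qed.

Lemma cauchy_limC (a : nat -> C) :
  (forall e, 0 < e -> exists P, forall p q, (P <= p)%N -> (P <= q)%N -> cabs (a p - a q) <= e) ->
  exists l, forall e, 0 < e -> exists P, forall p, (P <= p)%N -> cabs (a p - l) <= e.
Proof.
move=> ca.
have re_le (z : C) : `|complex.Re z| <= cabs z by rewrite -lecR -cabsE; exact: normc_ge_Re.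
have im_le (z : C) : `|complex.Im z| <= cabs z.
  by case: z => x y; rewrite /cabs /= -sqrtr_sqr ler_wsqrtr// lerDr sqr_ge0.
have [|u uP] := @cauchy_limR (fun n => complex.Re (a n)).
  move=> e /ca[P aP]; exists P => p q Pp Pq; apply: le_trans (aP p q Pp Pq).
  by rewrite -raddfB re_le.
have [|v vP] := @cauchy_limR (fun n => complex.Im (a n)).
  move=> e /ca[P aP]; exists P => p q Pp Pq; apply: le_trans (aP p q Pp Pq).
  by rewrite -raddfB im_le.
exists (u +i* v)%C => e e0; have e2 : 0 < e / 2 by rewrite divr_gt0.
have [P1 h1] := uP _ e2; have [P2 h2] := vP _ e2.
exists (maxn P1 P2) => p Pp; rewrite (le_trans (cabs_le_ReIm _))// [e]splitr lerD//.
  by rewrite raddfB/= h1// (leq_trans (leq_maxl _ _) Pp).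
by rewrite raddfB/= h2// (leq_trans (leq_maxr _ _) Pp).
Qed.

(* [T] is [lam] times the inclusion, up to an operator tending to 0 on RIS. *)
Definition scalar_part S (T : (nat -> C) -> nat -> C) (lam : C) :=
  forall c eps : R, 0 < eps -> exists P, forall x, ris_vec S c P x -> bnd (T x - lam *: x) eps.

(* The scalar [lam n] read off a reference vector far out also governs any earlier
   vector [x], as one sees by applying [T] to their sum. *)
Lemma scalar_part_ex S M T : unbounded S -> bop_on S M T -> exists lam, scalar_part S T lam.
Proof.
move=> US bT.
have [ug ugP] := choice (fun n => reference_vector n US).
pose u n := (ug n).1; pose g n := (ug n).2.
have Qu n : ris_vec S 3 n (u n) by have [] := ugP n.
have Dg n : D (g n) by have [] := ugP n.
have gu n : ev (g n) (u n) = 1 by have [] := ugP n.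
pose lam n := ev (g n) (T (u n)).
have lamP n mu (eps : R) : bnd (T (u n) - mu *: u n) eps -> cabs (lam n - mu) <= eps.
  by move=> /(_ _ (Dg n)); rewrite evBr evZr gu mulr1.
have key (c eps : R) : 0 < eps -> exists P, forall x, ris_vec S c P x -> exists n0,
    forall n, (n0 <= n)%N -> bnd (T x - lam n *: x) eps.
  move=> e0; wlog c0 : c / 0 <= c.
    move=> H; have [P HP] := H `|c| (normr_ge0 c); exists P => x Qx; apply: HP.
    by apply: ris_vec_le Qx; rewrite ?ler_norm.
  (* The final error is [d * (7 + 6 * c)]: [d] and [6 * d] for the first two summands, [6 * d * c]
     for the third. *)
  pose d := eps / (8 + 6 * c); have d0 : 0 < d by rewrite divr_gt0//; lra.
  have [P HP] := dist_small (c + 3) bT d0.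
  exists P => x Qx; have [[q sx] _ xc _] := Qx.
  exists (maxn P q) => n; rewrite geq_max => /andP[Pn qn].
  have c3 : c <= c + 3 by lra.
  have [mu xmu] := HP x (ris_vec_le c3 (leqnn _) Qx).
  have Qun : ris_vec S 3 P (u n) by exact: ris_vec_le (Qu n).
  have c3' : 3 <= c + 3 by lra.
  have [mu' umu] := HP _ (ris_vec_le c3' (leqnn _) Qun).
  have [nu xunu] := HP _ (ris_vecD Qx Qun).
  have mulam := lamP _ _ _ umu.
  have Fx := ris_vec_fin Qx; have Fu := ris_vec_fin Qun.
  (* [y] is small as a combination of approximation errors, and [x] and [u n] have disjoint
     supports, so that cutting bounds its two summands separately. *)
  pose y : nat -> C := (mu - nu) *: x + (lam n - nu) *: u n.
  have yb : bnd y (6 * d).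
    have -> : y = (T (x + u n) - nu *: (x + u n)) - (T x - mu *: x)
        - (T (u n) - mu' *: u n) + (lam n - mu') *: u n.
      rewrite (bopD bT)//; apply/funext => i; rewrite /y !fctE /GRing.scale/= ?fctE; ring.
    have ub : bnd ((lam n - mu') *: u n) (d * 3).
      have [_ _ u3 _] := Qun; apply: bnd_le (bndZ _ u3).
      by rewrite ler_wpM2r.
    by apply: bnd_le (bndD (bndB (bndB xunu xmu) umu) ub); lra.
  have [[N sun] _ _ _] := Qu n.
  have lamnu : cabs (lam n - nu) <= 6 * d.
    have := yb _ (norming_cut n N (Dg n)); rewrite ev_cut cutvD !cutvZ (cutv_id sun).
    suff -> : cutv n N x = 0 by rewrite scaler0 add0r evZr gu mulr1.
    by apply/funext => i; rewrite /cutv; case: ifP => // iN; apply: sx; lia.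
  have munu : bnd ((mu - nu) *: x) (6 * d).
    have := bnd_cut 0 n yb; rewrite cutvD !cutvZ.
    have -> : cutv 0 n (u n) = 0.
      by apply/funext => i; rewrite /cutv; case: ifP => // iN; apply: sun; lia.
    rewrite scaler0 addr0 cutv_id//; apply: supp_sub sx => //.
  have -> : T x - lam n *: x = (T x - mu *: x) + (mu - nu) *: x + (nu - lam n) *: x.
    by apply/funext => i; rewrite !fctE /GRing.scale/=; ring.
  apply: bnd_le (bndD (bndD xmu munu) (bndZ _ xc)); rewrite cabsBC.
  apply: (@le_trans _ _ (d * (7 + 6 * c))).
    have := ler_wpM2r c0 lamnu; lra.
  rewrite /d mulrAC ler_pdivrMr; last by lra.
  by rewrite ler_wpM2l ?(ltW e0)//; lra.
have [|l lP] := @cauchy_limC lam.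
  move=> e e0; have e2 : 0 < e / 2 by rewrite divr_gt0.
  have [P HP] := key 3 _ e2; exists P => p p' Pp Pp'.
  have [n1 h1] := HP _ (ris_vec_le (lexx _) Pp (Qu p)).
  have [n2 h2] := HP _ (ris_vec_le (lexx _) Pp' (Qu p')).
  have := lamP _ _ _ (h1 _ (leq_maxl n1 n2)).
  have := lamP _ _ _ (h2 _ (leq_maxr n1 n2)).
  set v := lam (maxn n1 n2); rewrite [cabs (lam p' - v)]cabsBC => k2 k1.
  have -> : lam p - lam p' = (lam p - v) + (v - lam p') by ring.
  by rewrite (le_trans (cabsD _ _))//; lra.
exists l => c eps e0; have e2 : 0 < eps / 2 by rewrite divr_gt0.
have [P HP] := key c _ e2; exists P => x Qx.
have [_ _ xc _] := Qx; have c0 := bnd_ge0 xc.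
have e3 : 0 < eps / 2 / (c + 1) by rewrite divr_gt0//; lra.
have [P' lP'] := lP _ e3; have [n0 h0] := HP x Qx.
pose n := maxn n0 P'.
have -> : T x - l *: x = (T x - lam n *: x) + (lam n - l) *: x.
  by apply/funext => i; rewrite !fctE /GRing.scale/=; ring.
apply: bnd_le (bndD (h0 n (leq_maxl _ _)) (bndZ _ xc)).
have := ler_wpM2r c0 (lP' n (leq_maxr _ _)).
suff : eps / 2 / (c + 1) * c <= eps / 2 by lra.
rewrite mulrAC ler_pdivrMr; last by lra.
by rewrite ler_wpM2l ?(ltW e2)//; lra.
Qed.

(* The reference functional vanishes on the range of [T]. *)
Lemma scalar_part_eq0 S S' T lam : scalar_part S T lam -> subpred S' S -> unbounded S' ->
  (forall x i, fin S x -> S' i -> T x i = 0) -> lam = 0.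
Proof.
move=> Tl SS US T0; apply: cabs_eq0; apply/eqP; rewrite eq_le cabs_ge0 andbT.
apply/ler_addgt0Pl => e e0; rewrite addr0.
have [P HP] := Tl 3 _ e0; have [[u g] /= [Qu Dg gu g0]] := reference_vector P US.
have QSu := ris_vec_sub SS Qu; have := HP _ QSu _ Dg.
rewrite evBr evZr gu mulr1 (_ : ev g (T u) = 0) ?sub0r ?cabsN//.
rewrite -(ev0r g); apply: eq_ev => i gi; apply: T0; first exact: ris_vec_fin QSu.
by apply: contraNT gi => /g0 ->.
Qed.

End ScalarPart.

(** * The space and the triangular representation *)

Section Norm.
Variable R : realType.
Local Notation C := R[i].
Implicit Types (x y : nat -> C).

Definition nrm x : R := sup [set cabs (ev f x) | f in D].

Lemma nrm_has_sup x c : bnd x c -> has_sup [set cabs (ev f x) | f in D].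
Proof.
move=> xc; split; first by exists (cabs (ev 0 x)), 0 => //; exact: D0.
by exists c => _ [f Df <-]; exact: xc.
Qed.

Lemma nrm_le x c : bnd x c -> nrm x <= c.
Proof.
move=> xc; apply: ge_sup; first by have [] := nrm_has_sup xc.
by move=> _ [f Df <-]; exact: xc.
Qed.

Lemma bnd_nrm x c : bnd x c -> bnd x (nrm x).
Proof.
move=> xc f Df; apply: ub_le_sup; first by have [] := nrm_has_sup xc.
by exists f.
Qed.

Lemma fin_bnd S x : fin S x -> exists c, bnd x c.
Proof.
move=> [[q sx] _]; exists (\sum_(i < q) cabs (x i)) => f Df.
have -> : ev f x = ev (cut 0 q f) x by rewrite ev_cut cutv_id.
rewrite (@ev_wide _ q); last first.
  by apply/leq_sizeP => j qj; rewrite coef_cut; case: ltnP => //; lia.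
rewrite (le_trans (cabs_sum _ _ _))//; apply: ler_sum => i _.
rewrite cabsM ler_piMl ?cabs_ge0//; apply: D_coef; exact: norming_cut.
Qed.

End Norm.

Section Space.
Variables (R : realType) (m : nat).
Local Notation C := R[i].

(** The decreasing sets of the overview, as unions of residue classes modulo [m]; passing from [j]
    to [j.+1] removes the class of [j]. *)
Definition coord_set (j : nat) : pred nat := fun k => (j <= k %% m)%N.

Local Notation yfun := ('I_m -> nat -> C).

Definition yvec_pred : {pred yfun} := mem [set y : yfun |
  (forall (j : 'I_m) i, ~~ coord_set j i -> y j i = 0) /\ exists c, forall j, bnd (y j) c].

Record yvec := YVec { yval :> 'I_m -> nat -> C ; yvec_mem : yval \in yvec_pred }.

HB.instance Definition _ := [isSub for yval].
HB.instance Definition _ := [Choice of yvec by <:].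

Lemma yvec_submod_closed : submod_closed yvec_pred.
Proof.
split=> [|a x y]; rewrite !inE.
  by split => //; exists 0 => j; exact: bnd0.
move=> [Sx [c xc]] [Sy [d yd]]; split => [j i ji|].
  by rewrite !fctE Sx// Sy// scaler0 addr0.
by exists (cabs a * c + d) => j; apply: bndD => //; exact: bndZ.
Qed.

HB.instance Definition _ := GRing.isSubmodClosed.Build C yfun yvec_pred yvec_submod_closed.
HB.instance Definition _ := [SubChoice_isSubLmodule of yvec by <:].

Lemma yvec_supp (y : yvec) (j : 'I_m) i : ~~ coord_set j i -> y j i = 0.
Proof. by have := yvec_mem y; rewrite inE => -[+ _]; exact. Qed.

Lemma yvec_bnd (y : yvec) j : bnd (y j) (nrm (y j)).
Proof. by have := yvec_mem y; rewrite inE => -[_ [c /(_ j)/bnd_nrm]]. Qed.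

Lemma yvecD (x y : yvec) j : (x + y) j = x j + y j. Proof. by []. Qed.
Lemma yvecZ a (x : yvec) j : (a *: x) j = a *: x j. Proof. by []. Qed.

Definition yn (y : yvec) : R := \sum_(j < m) nrm (y j).
Definition ynorm (y : yvec) : C := (yn y)%:C.

Lemma nrm_ge0 (y : yvec) j : 0 <= nrm (y j).
Proof. exact: bnd_ge0 (@yvec_bnd y j). Qed.

Lemma nrm_le_yn (y : yvec) j : nrm (y j) <= yn y.
Proof. by rewrite /yn (bigD1 j)//= lerDl sumr_ge0// => k _; exact: nrm_ge0. Qed.

Lemma ynD x y : yn (x + y) <= yn x + yn y.
Proof.
rewrite /yn -big_split/=; apply: ler_sum => j _; apply: nrm_le.
by apply: bndD; exact: yvec_bnd.
Qed.

Lemma ynZ_le a x : yn (a *: x) <= cabs a * yn x.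
Proof.
rewrite /yn mulr_sumr; apply: ler_sum => j _; apply: nrm_le.
by apply: bndZ; exact: yvec_bnd.
Qed.

Lemma ynormD x y : ynorm (x + y) <= ynorm x + ynorm y.
Proof. by rewrite /ynorm -rmorphD lecR ynD. Qed.

Lemma ynormZ a x : ynorm (a *: x) = `|a| * ynorm x.
Proof.
rewrite /ynorm cabsE -rmorphM; congr (_%:C); apply/eqP; rewrite eq_le ynZ_le/=.
have [->|a0] := eqVneq a 0; first by rewrite cabs0 mul0r sumr_ge0// => j _; exact: nrm_ge0.
rewrite -ler_pdivlMl ?cabs_gt0// -cabsV.
by rewrite -{1}[x]scale1r -(mulVf a0) -scalerA ynZ_le.
Qed.

Lemma yn_eq0 x : yn x = 0 -> x = 0.
Proof.
move=> x0; apply/val_inj/funext => j; apply/funext => i; apply: cabs_eq0.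
apply/eqP; rewrite eq_le cabs_ge0 andbT -x0 (le_trans _ (nrm_le_yn x j))//.
exact: bnd_coord (@yvec_bnd x j).
Qed.

Lemma ynorm_eq0 x : ynorm x = 0 -> x = 0.
Proof. by move=> [] /yn_eq0. Qed.

HB.instance Definition _ := Lmodule_isNormed.Build C yvec ynormD ynormZ ynorm_eq0.

Lemma yvec_normE (x : yvec) : `|x| = (yn x)%:C.
Proof. by []. Qed.

Lemma ball_yvec (x y : yvec) (e : R) : ball x e%:C y = (yn (x - y) < e).
Proof. by rewrite -ball_normE /ball_/= yvec_normE ltcR. Qed.

Lemma ev_limit (f : {poly C}) (x : nat -> nat -> C) (L : nat -> C) (e : R) :
  (forall i, forall d, 0 < d -> exists P, forall p, (P <= p)%N -> cabs (x p i - L i) <= d) ->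
  0 < e -> exists P, forall p, (P <= p)%N -> cabs (ev f (x p - L)) <= e.
Proof.
move=> xL e0; pose B := \sum_(i < size f) cabs f`_i.
have B0 : 0 <= B by apply: sumr_ge0 => i _; exact: cabs_ge0.
pose d := e / (B + 1); have d0 : 0 < d by rewrite divr_gt0//; lra.
have [P HP] := choice (fun i => xL i d d0).
exists (\sum_(i < size f) P i)%N => p Pp.
rewrite (le_trans (cabs_sum _ _ _))//; apply: (@le_trans _ _ (B * d)); last first.
  by rewrite /d mulrCA ler_piMr ?(ltW e0)// ler_pdivrMr; lra.
rewrite mulr_suml; apply: ler_sum => i _; rewrite cabsM ler_wpM2l ?cabs_ge0//.
by apply: HP; rewrite (leq_trans _ Pp)// (bigD1 i)//= leq_addr.
Qed.

(** The coordinatewise limit [L] of fast approximants [a n] works: each norming functional is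
    finitely supported, so bounds on [a n - a k] pass to [a n - L] functional by functional. *)
Lemma yvec_complete (F : set_system yvec) : ProperFilter F -> cauchy F -> cvg F.
Proof.
move=> FF /cauchyP Fc.
have an n : exists y : yvec, F (ball y ((2^-1 ^+ n : R)%:C)).
  by apply: Fc; rewrite ltcR exprn_gt0// invr_gt0.
have [a aF] := choice an.
have adist n k : yn (a n - a k) <= 2^-1 ^+ n + 2^-1 ^+ k.
  have [z [zn zk]] := filter_ex (filterI (aF n) (aF k)).
  move: zn zk; rewrite !ball_yvec => zn zk.
  have -> : a n - a k = (a n - z) + (z - a k) by rewrite addrA subrK.
  rewrite (le_trans (ynD _ _))// lerD ?(ltW zn)//.
  apply: le_trans (ltW zk); rewrite -opprB -scaleN1r (le_trans (ynZ_le _ _))//.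
  by rewrite cabsN cabs1 mul1r.
have pw (e : R) : 0 < e -> exists P, forall n, (P <= n)%N -> 2^-1 ^+ n <= e.
  move=> e0; exists (Num.bound e^-1) => n Pn; rewrite exprVn -[e]invrK.
  rewrite lef_pV2 ?posrE ?exprn_gt0 ?invr_gt0//.
  have ie : 0 <= e^-1 by rewrite invr_ge0 ltW.
  rewrite (le_trans (ltW (archi_boundP ie)))// (le_trans _ (natr_ltX2 R n))//.
  by rewrite ler_nat.
have adist_e (e : R) : 0 < e -> exists P, forall p q, (P <= p)%N -> (P <= q)%N -> yn (a p - a q) <= e.
  move=> e0; have [|P HP] := pw (e / 2); first by rewrite divr_gt0.
  exists P => p q Pp Pq; rewrite (le_trans (adist p q))// [e]splitr lerD// HP//.
have lim1 j i : exists l, forall d, 0 < d -> exists P, forall p, (P <= p)%N -> cabs (a p j i - l) <= d.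
  apply: cauchy_limC => e /adist_e[P HP]; exists P => p q Pp Pq.
  rewrite (le_trans _ (HP _ _ Pp Pq))// (le_trans _ (nrm_le_yn _ j))//.
  exact: bnd_coord (@yvec_bnd (a p - a q) j).
have [L HL] : exists L : yfun, forall j i, forall d, 0 < d -> exists P, forall p, (P <= p)%N -> cabs (a p j i - L j i) <= d.
  have [L HL] := choice (fun ji : 'I_m * nat => lim1 ji.1 ji.2).
  by exists (fun j i => L (j, i)) => j i; exact: (HL (j, i)).
have Lb n j : bnd (a n j - L j) (2^-1 ^+ n).
  move=> f Df; apply/ler_addgt0Pr => e e0.
  have [|P1 HP1] := pw (e / 2); first by rewrite divr_gt0.
  have [|P2 HP2] := @ev_limit f (fun p => a p j) (L j) (e / 2) (HL j); first by rewrite divr_gt0.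
  pose k := maxn P1 P2.
  have -> : ev f (a n j - L j) = ev f ((a n - a k) j) + ev f (a k j - L j).
    by rewrite -evDr; congr (ev f _); rewrite yvecD addrA subrK.
  rewrite (le_trans (cabsD _ _))//.
  have h1 : cabs (ev f ((a n - a k) j)) <= 2^-1 ^+ n + 2^-1 ^+ k.
    by rewrite (le_trans (@yvec_bnd _ j _ Df))// (le_trans (nrm_le_yn _ _)).
  have h2 := HP1 k (leq_maxl _ _); have h3 := HP2 k (leq_maxr _ _).
  by lra.
have LY : L \in yvec_pred.
  rewrite inE; split.
    move=> j i ji; apply: cabs_eq0; apply/eqP; rewrite eq_le cabs_ge0 andbT.
    apply/ler_addgt0Pl => e e0; rewrite addr0; have [P HP] := HL j i e e0.
    by have := HP P (leqnn _); rewrite yvec_supp// sub0r cabsN.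
  exists (1 + yn (a 0)) => j.
  have -> : L j = - (a 0 j - L j) + a 0 j by rewrite opprB subrK.
  apply: bndD; first by apply/bndN; have := Lb 0 j; rewrite expr0.
  exact: bnd_le (nrm_le_yn _ _) (@yvec_bnd _ j).
apply/cvg_ex; exists (YVec LY); apply/cvg_ballP => eC eC0.
have -> : eC = (complex.Re eC)%:C by rewrite RRe_real// gtr0_real.
set e := complex.Re eC.
have e0 : 0 < e by rewrite -ltcR RRe_real// gtr0_real.
(* One share for each of the [m] components, one for [a P - y], and one left over for strictness. *)
have e3 : 0 < e / (m%:R + 2) by rewrite divr_gt0// addr_gt0// ltr0n.
have [P HP] := pw _ e3.
apply: filterS (aF P) => y; rewrite !ball_yvec => aPy.
have -> : YVec LY - y = (YVec LY - a P) + (a P - y) by rewrite addrA subrK.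
rewrite (le_lt_trans (ynD _ _))//.
have : yn (YVec LY - a P) <= m%:R * (e / (m%:R + 2)).
  rewrite -[m in m%:R * _]card_ord -sum1_card natr_sum mulr_suml.
  apply: ler_sum => j _; rewrite mul1r; apply: le_trans (HP P (leqnn _)).
  apply: nrm_le; have -> : (YVec LY - a P) j = - (a P j - L j) by rewrite opprB.
  exact/bndN/Lb.
have := HP P (leqnn _).
set d := e / _ in e3 *; have -> : e = (m%:R + 2) * d.
  by rewrite /d mulrC divfK// gt_eqF// addr_gt0// ltr0n.
by lra.
Qed.

HB.instance Definition _ := Uniform_isComplete.Build yvec yvec_complete.

End Space.

(** * Uniqueness and linearity of scalar parts *)

Section ScalarPartTheory.
Variable R : realType.
Local Notation C := R[i].
Implicit Types (S : pred nat) (T U : (nat -> C) -> nat -> C).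

Lemma scalar_part_ext S T U (lam : C) : (forall x, fin S x -> T x = U x) ->
  scalar_part S T lam -> scalar_part S U lam.
Proof.
move=> TU Tl c e e0; have [P HP] := Tl c e e0; exists P => x Qx.
by rewrite -TU; [exact: HP|exact: ris_vec_fin Qx].
Qed.

(** The 3 is the norm bound of the reference vectors. With [mu = 0] this is the source of the
    continuity of [psi]. *)
Lemma scalar_part_dist S T (lam mu : C) (e : R) : unbounded S -> scalar_part S T lam ->
  (forall x c, fin S x -> bnd x c -> bnd (T x - mu *: x) (e * c)) ->
  cabs (lam - mu) <= e * 3.
Proof.
move=> US Tl Tm; apply/ler_addgt0Pr => d d0.
have [P HP] := Tl 3 _ d0; have [[u g] /= [Qu Dg gu _]] := reference_vector R P US.
have [_ _ u3 _] := Qu; have h1 := HP _ Qu _ Dg; have h2 := Tm u 3 (ris_vec_fin Qu) u3 _ Dg.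
rewrite -[_ - _]mulr1 -gu -evZr.
have -> : (lam - mu) *: u = (T u - mu *: u) - (T u - lam *: u).
  by apply/funext => i; rewrite !fctE /GRing.scale/=; ring.
by rewrite evBr (le_trans (cabsB _ _))// lerD.
Qed.

Lemma scalar_part_uniq S T (lam mu : C) : unbounded S ->
  scalar_part S T lam -> scalar_part S T mu -> lam = mu.
Proof.
move=> US Tl Tm; apply/eqP; rewrite -subr_eq0; apply/eqP/cabs_eq0/eqP.
rewrite eq_le cabs_ge0 andbT; apply/ler_addgt0Pl => e e0; rewrite addr0.
have e2 : 0 < e / 2 by rewrite divr_gt0.
have [P1 H1] := Tl 3 _ e2; have [P2 H2] := Tm 3 _ e2.
have [[u g] /= [Qu Dg gu _]] := reference_vector R (maxn P1 P2) US.
have h1 := H1 _ (ris_vec_le (lexx _) (leq_maxl _ _) Qu) _ Dg.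
have h2 := H2 _ (ris_vec_le (lexx _) (leq_maxr _ _) Qu) _ Dg.
rewrite -[_ - _]mulr1 -gu -evZr.
have -> : (lam - mu) *: u = (T u - mu *: u) - (T u - lam *: u).
  by apply/funext => i; rewrite !fctE /GRing.scale/=; ring.
by rewrite evBr (le_trans (cabsB _ _))// [e]splitr lerD.
Qed.

Lemma scalar_part_lin S T U (lam mu a : C) : scalar_part S T lam -> scalar_part S U mu ->
  scalar_part S (fun x => a *: T x + U x) (a * lam + mu).
Proof.
move=> Tl Um c e e0.
have a0 := cabs_ge0 a.
have e1 : 0 < e / 2 / (cabs a + 1) by rewrite divr_gt0 ?divr_gt0//; lra.
have e2 : 0 < e / 2 by rewrite divr_gt0.
have [P1 H1] := Tl c _ e1; have [P2 H2] := Um c _ e2.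
exists (maxn P1 P2) => x Qx.
have h1 := H1 _ (ris_vec_le (lexx _) (leq_maxl _ _) Qx).
have h2 := H2 _ (ris_vec_le (lexx _) (leq_maxr _ _) Qx).
have -> : a *: T x + U x - (a * lam + mu) *: x = a *: (T x - lam *: x) + (U x - mu *: x).
  by apply/funext => i; rewrite !fctE /GRing.scale/=; ring.
apply: bnd_le (bndD (bndZ a h1) h2).
suff : cabs a * (e / 2 / (cabs a + 1)) <= e / 2 by lra.
rewrite mulrCA ler_piMr ?(ltW e2)// ler_pdivrMr; lra.
Qed.

Lemma scalar_part_scale S (a : C) : scalar_part S (fun x => a *: x) a.
Proof.
move=> c e e0; exists 0%N => x _; rewrite subrr; apply: bnd_le (@bnd0 R).
exact: ltW.
Qed.

Lemma fin_ex S (c : R) (I : finType) (A : I -> (nat -> C) -> Prop) :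
  (forall k, exists P, forall x, ris_vec S c P x -> A k x) ->
  exists P, forall x, ris_vec S c P x -> forall k, A k x.
Proof.
move=> H; have [P HP] := choice H.
exists (\sum_k P k)%N => x Qx k; apply: HP; apply: ris_vec_le Qx => //.
by rewrite (bigD1 k)//= leq_addr.
Qed.

End ScalarPartTheory.

(** * The homomorphisms [psi] and [theta] *)

Section Representation.
Variables (R : realType) (m : nat).
Local Notation C := R[i].
Local Notation Y := (yvec R m).
Hypothesis m_gt0 : (0 < m)%N.
Implicit Types (i j : 'I_m) (x : nat -> C) (T U : bop Y).

Lemma coord_set_unbounded (j : 'I_m) : unbounded (coord_set m j).
Proof.
move=> n; exists (n * m + j)%N; first by rewrite (leq_trans (leq_pmulr n m_gt0))// leq_addr.
by rewrite /coord_set modnMDl modn_small.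
Qed.

Lemma coord_setD_unbounded (i j : 'I_m) : (j < i)%N ->
  unbounded (fun k => coord_set m j k && ~~ coord_set m i k).
Proof.
move=> ji n; exists (n * m + j)%N; first by rewrite (leq_trans (leq_pmulr n m_gt0))// leq_addr.
by rewrite /coord_set modnMDl modn_small// leqnn -ltnNge.
Qed.

Lemma coord_set_sub (i j : nat) : (i <= j)%N -> subpred (coord_set m j) (coord_set m i).
Proof. by move=> ij k; exact: leq_trans. Qed.

(** Embedding of the [j]-th summand, made total: [insubd] returns 0 when [x] does not belong to that
    summand. *)
Definition inY (j : 'I_m) (x : nat -> C) : Y :=
  insubd (0 : Y) (fun j' => if j' == j then x else 0).

Lemma inYE j x : fin (coord_set m j) x -> forall i, inY j x i = if i == j then x else 0.
Proof.
move=> Fx i; rewrite -[LHS]/(val (inY j x) i) val_insubd ifT// inE; split.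
  by move=> k l; case: eqP => // -> Skl; have [_ ->] := Fx.
have [c xc] := fin_bnd Fx; exists c => k; case: eqP => // _.
exact: bnd_le (bnd_ge0 xc) (@bnd0 R).
Qed.

Lemma eq_yvec (x y : Y) : (forall j, x j = y j) -> x = y.
Proof. by move=> xy; apply/val_inj/funext. Qed.

Lemma inYD j a (x y : nat -> C) : fin (coord_set m j) x -> fin (coord_set m j) y ->
  inY j (a *: x + y) = a *: inY j x + inY j y.
Proof.
move=> Fx Fy; apply: eq_yvec => i; rewrite yvecD yvecZ !inYE//.
  by case: eqP => // _; rewrite scaler0 addr0.
by apply: finD => //; exact: finZ.
Qed.

Lemma nrm0 : nrm (0 : nat -> C) = 0.
Proof.
apply/eqP; rewrite eq_le (nrm_le (@bnd0 R))/=.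
exact: bnd_ge0 (bnd_nrm (@bnd0 R)).
Qed.

Lemma yn_inY j x : fin (coord_set m j) x -> yn (inY j x) = nrm x.
Proof.
move=> Fx; rewrite /yn (bigD1 j)//= inYE// eqxx big1 ?addr0// => i ij.
by rewrite inYE// (negbTE ij) nrm0.
Qed.

Definition real_opnorm (T : bop Y) : R := complex.Re (opnorm T).

Lemma real_opnorm_ge0 T : 0 <= real_opnorm T.
Proof. by rewrite -lecR /real_opnorm RRe_real ?ger0_real ?opnorm_ge0. Qed.

Lemma real_opnormE T : opnorm T = (real_opnorm T)%:C.
Proof. by rewrite /real_opnorm RRe_real// ger0_real// opnorm_ge0. Qed.

Lemma le_real_opnorm T y : yn (T y) <= real_opnorm T * yn y.
Proof. by have := le_opnorm T y; rewrite real_opnormE !yvec_normE -rmorphM lecR. Qed.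

Definition entry (T : bop Y) i j (x : nat -> C) : nat -> C := T (inY j x) i.

Lemma entry_bop T i j : bop_on (coord_set m j) (real_opnorm T) (entry T i j).
Proof.
split; first exact: real_opnorm_ge0.
  by move=> a x y Fx Fy; rewrite /entry inYD// linearP.
move=> x c Fx xc; apply: bnd_le (@yvec_bnd _ _ _ i).
rewrite (le_trans (nrm_le_yn _ _))// (le_trans (le_real_opnorm _ _))//.
by rewrite ler_wpM2l ?real_opnorm_ge0// yn_inY// nrm_le.
Qed.

Definition entry_scalar T i j : C := sval (cid (scalar_part_ex (@coord_set_unbounded j) (entry_bop T i j))).

Lemma entry_scalarP T i j : scalar_part (coord_set m j) (entry T i j) (entry_scalar T i j).
Proof. exact: (svalP (cid _)). Qed.

Lemma entry_scalar_eq T i j lam : scalar_part (coord_set m j) (entry T i j) lam -> entry_scalar T i j = lam.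
Proof. by apply: scalar_part_uniq (entry_scalarP T i j); exact: coord_set_unbounded. Qed.

Lemma entry_scalar_tri T (i j : 'I_m) : (j < i)%N -> entry_scalar T i j = 0.
Proof.
move=> ji; apply: (scalar_part_eq0 (entry_scalarP T i j) (S' := fun k => coord_set m j k && ~~ coord_set m i k)).
- by move=> k /andP[].
- exact: coord_setD_unbounded.
- by move=> x k _ /andP[_]; exact: yvec_supp.
Qed.

Lemma entry_scalar_lin a T U i j : entry_scalar (a *: T + U) i j = a * entry_scalar T i j + entry_scalar U i j.
Proof.
apply: entry_scalar_eq; apply: scalar_part_ext (scalar_part_lin a (entry_scalarP T i j) (entry_scalarP U i j)).
move=> x _; rewrite /entry -yvecZ -yvecD; congr (yval _ i).
Qed.

Lemma yn_sum (I : Type) (r : seq I) (P : pred I) (F : I -> Y) :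
  yn (\sum_(i <- r | P i) F i) <= \sum_(i <- r | P i) yn (F i).
Proof.
elim/big_rec2: _ => [|i a b _ ab]; last by rewrite (le_trans (ynD _ _))// lerD2l.
by rewrite /yn big1// => j _; exact: nrm0.
Qed.

Lemma yvec_sum (I : Type) (r : seq I) (P : pred I) (F : I -> Y) j :
  (\sum_(i <- r | P i) F i) j = \sum_(i <- r | P i) F i j.
Proof. by elim/big_rec2: _ => // i a b _ <-. Qed.

Lemma ler_sum_const (F : 'I_m -> R) (e : R) : (forall k, F k <= e) -> \sum_k F k <= m%:R * e.
Proof.
move=> Fe; apply: (@le_trans _ _ (\sum_(k < m) e)); first exact: ler_sum.
by rewrite sumr_const card_ord mulr_natl.
Qed.

(** For [k > j] the vector [x] need not live on [coord_set m k] and [inY k x] may be the default 0;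
    such terms carry the scalar 0 by [entry_scalar_tri]. For [k <= j] the nesting of the sets makes
    [inY k x] a genuine copy of [x]. *)
Lemma entry_scalar_column T (j : 'I_m) (c e : R) : 0 < e -> exists P, forall x, ris_vec (coord_set m j) c P x ->
  yn (T (inY j x) - \sum_k entry_scalar T k j *: inY k x) <= e.
Proof.
move=> e0; have em : 0 < e / m%:R by rewrite divr_gt0 // ltr0n.
have [P HP] := fin_ex (fun k => entry_scalarP T k j c em).
exists P => x Qx; have Fx := ris_vec_fin Qx.
have -> : e = m%:R * (e / m%:R) by rewrite mulrCA divff ?mulr1// pnatr_eq0 -lt0n.
apply: ler_sum_const => k; apply: nrm_le.
suff -> : (T (inY j x) - \sum_l entry_scalar T l j *: inY l x) k = entry T k j x - entry_scalar T k j *: x.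
  exact: HP.
rewrite -scaleN1r addrC yvecD yvecZ scaleN1r addrC; congr (_ - _).
rewrite yvec_sum (bigD1 k)// big1 ?Monoid.mulm1 => [|l /andP[_ lk]].
  have [kj|jk] := leqP k j.
    by rewrite yvecZ inYE ?eqxx//; have [sx Sx] := Fx; split => // n Sn; apply: Sx;
       apply: contra Sn; exact: coord_set_sub.
  by rewrite entry_scalar_tri// !scale0r.
have [lj|jl] := leqP l j; last by rewrite entry_scalar_tri// scale0r.
rewrite yvecZ inYE; first by rewrite eq_sym (negbTE lk) scaler0.
have [sx Sx] := Fx; split => // n Sn; apply: Sx.
by apply: contra Sn; exact: coord_set_sub.
Qed.

(** [U] need not map RIS to RIS, but by [entry_scalar_column] it sends [x], up to a small error [y],
    to a combination of copies of [x]. Each copy is a RIS vector of its summand, so the scalar parts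
    of [T] apply to it. *)
Lemma entry_scalar_mul T U i j : entry_scalar (T * U) i j = \sum_k entry_scalar T i k * entry_scalar U k j.
Proof.
apply: entry_scalar_eq => c e e0.
pose B := \sum_k cabs (entry_scalar U k j).
have B0 : 0 <= B by apply: sumr_ge0 => k _; exact: cabs_ge0.
have M0 := real_opnorm_ge0 T.
pose e1 := e / 2 / (B + 1); have e10 : 0 < e1 by rewrite divr_gt0 ?divr_gt0//; lra.
pose e2 := e / 2 / (real_opnorm T + 1); have e20 : 0 < e2 by rewrite divr_gt0 ?divr_gt0//; lra.
have [P1 H1] := entry_scalar_column U j c e20.
have Hk k : exists P, forall x, ris_vec (coord_set m j) c P x ->
    bnd (entry_scalar U k j *: (entry T i k x - entry_scalar T i k *: x)) (cabs (entry_scalar U k j) * e1).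
  have [kj|jk] := leqP k j; last first.
    by exists 0%N => x _; rewrite entry_scalar_tri// scale0r cabs0 mul0r; exact: bnd0.
  have [P HP] := entry_scalarP T i k c e10; exists P => x Qx; apply/bndZ/HP.
  exact: ris_vec_sub (coord_set_sub kj) Qx.
have [P2 H2] := fin_ex Hk; exists (maxn P1 P2) => x Qx.
have {}H1 := H1 _ (ris_vec_le (lexx _) (leq_maxl _ _) Qx).
have {}H2 := H2 _ (ris_vec_le (lexx _) (leq_maxr _ _) Qx).
set y := U (inY j x) - _ in H1.
have -> : entry (T * U) i j x - (\sum_k entry_scalar T i k * entry_scalar U k j) *: x =
  (T y) i + \sum_k entry_scalar U k j *: (entry T i k x - entry_scalar T i k *: x).
  have -> : entry (T * U) i j x = (T (y + \sum_k entry_scalar U k j *: inY k x)) i.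
    by rewrite /y subrK.
  rewrite linearD yvecD linear_sum yvec_sum -addrA; congr (_ + _).
  rewrite scaler_suml -sumrB; apply: eq_bigr => k _.
  by rewrite linearZ yvecZ scalerBr scalerA [_ * entry_scalar T i k]mulrC.
apply: (bnd_le _ (bndD (@yvec_bnd _ _ (T y) i) (bnd_sum (fun k _ => H2 k)))).
have h1 : nrm (T y i) <= e / 2.
  rewrite (le_trans (nrm_le_yn _ _))// (le_trans (le_real_opnorm _ _))//.
  rewrite (le_trans (ler_wpM2l M0 H1))// /e2 mulrCA ler_piMr ?divr_ge0 ?(ltW e0)//.
  by rewrite ler_pdivrMr; lra.
have h2 : \sum_k cabs (entry_scalar U k j) * e1 <= e / 2.
  rewrite -mulr_suml -/B /e1 mulrCA ler_piMr ?divr_ge0 ?(ltW e0)//.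
  by rewrite ler_pdivrMr; lra.
by rewrite [leRHS]splitr lerD.
Qed.

Definition psi_mx (T : bop Y) : 'M[C]_m := \matrix_(i, j) entry_scalar T i j.

Lemma psi_mem T : psi_mx T \in @utmx_pred C m.
Proof. by apply/utmxP => i j ji; rewrite mxE entry_scalar_tri. Qed.

Definition psi (T : bop Y) : utmx C m := UTMx (psi_mem T).

Lemma psi_linear : linear psi.
Proof.
by move=> a T U; apply/val_inj/matrixP => i j; rewrite !mxE entry_scalar_lin.
Qed.

HB.instance Definition _ := GRing.isLinear.Build C (bop Y) (utmx C m) *:%R psi psi_linear.

Lemma psiM T U : psi (T * U) = psi T * psi U.
Proof.
apply/val_inj/matrixP => i j; rewrite !mxE entry_scalar_mul.
by apply: eq_bigr => k _; rewrite !mxE.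
Qed.

Lemma bounded_continuous (V W : normedModType C) (f : {linear V -> W}) (M : R) :
  (forall v, `|f v| <= M%:C * `|v|) -> continuous f.
Proof.
move=> fM; apply/linear_bounded_continuous/linear_boundedP.
exists M%:C; split; first by rewrite complex_real.
by move=> r Mr x; rewrite (le_trans (fM x))// ler_wpM2r// ltW.
Qed.

Lemma psi_continuous : continuous psi.
Proof.
apply: (@bounded_continuous _ _ psi 3) => T.
have -> : `|T| = (real_opnorm T)%:C by exact: real_opnormE.
rewrite -rmorphM -[`|_|]/(mx_norm (psi_mx T)).
have [->|/mx_norm_neq0[[i j] ->]/=] := eqVneq (mx_norm (psi_mx T)) 0.
  by rewrite lecR mulr_ge0// real_opnorm_ge0.
rewrite mxE cabsE lecR mulrC -[entry_scalar T i j]subr0.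
apply: scalar_part_dist (@coord_set_unbounded j) (entry_scalarP T i j) _ => x c Fx xc.
by rewrite scale0r subr0; have [_ _ +] := entry_bop T i j; exact.
Qed.

Definition theta_fun (A : utmx C m) (y : Y) : 'I_m -> nat -> C :=
  fun i => \sum_j A i j *: y j.

(** Triangularity is what makes the matrix formula land in the right summands: [y j] enters
    component [i] only if [i <= j], and then [coord_set m j] lies in [coord_set m i]. *)
Lemma theta_mem A y : theta_fun A y \in @yvec_pred R m.
Proof.
rewrite inE; split.
  move=> i k Sk; rewrite /theta_fun fct_sumE big1// => j _.
  have [ij|ji] := leqP i j; last by have /utmxP -> := utmx_mem A; rewrite ?scale0r.
  by rewrite fctE yvec_supp ?scaler0//; apply: contra Sk; exact: coord_set_sub.
exists (\sum_i \sum_j cabs (A i j) * nrm (y j)) => i.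
apply: (@bnd_le _ _ (\sum_j cabs (A i j) * nrm (y j))).
  rewrite [leRHS](bigD1 i)//= lerDl sumr_ge0// => k _; rewrite sumr_ge0// => l _.
  by rewrite mulr_ge0 ?cabs_ge0// nrm_ge0.
by apply: bnd_sum => j _; apply: bndZ; exact: yvec_bnd.
Qed.

Definition theta_op A y : Y := YVec (theta_mem A y).

Lemma theta_opE A y i : theta_op A y i = \sum_j A i j *: y j.
Proof. by []. Qed.

Lemma theta_op_linear A : linear (theta_op A).
Proof.
move=> a y z; apply: eq_yvec => i; rewrite yvecD yvecZ !theta_opE.
rewrite scaler_sumr -big_split; apply: eq_bigr => j _.
by rewrite yvecD yvecZ scalerDr !scalerA [a * _]mulrC.
Qed.

HB.instance Definition _ A := GRing.isLinear.Build C Y Y *:%R (theta_op A) (theta_op_linear A).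

Lemma mx_entry_le (A : 'M[C]_m) i j : `|A i j| <= mx_norm A.
Proof.
rewrite mx_normE -[A i j]/(A (i, j).1 (i, j).2) -[leLHS]nngE num_le.
exact: le_bigmax.
Qed.

Lemma theta_op_bound A y : yn (theta_op A y) <= (m%:R * complex.Re `|A|) * yn y.
Proof.
set a := complex.Re `|A|; have aE : `|A| = a%:C by rewrite RRe_real// normr_real.
rewrite -mulrA; apply: ler_sum_const => i.
apply: nrm_le; apply: (@bnd_le _ _ (\sum_j a * nrm (y j))); first by rewrite -mulr_sumr.
apply: bnd_sum => j _; apply: bnd_le (bndZ _ (@yvec_bnd _ _ y j)).
by rewrite ler_wpM2r ?nrm_ge0// -lecR -cabsE -aE; exact: mx_entry_le.
Qed.

Lemma theta_bop A : theta_op A \in @bop_pred C Y.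
Proof.
rewrite inE; split; first exact: theta_op_linear.
apply: (@bounded_continuous _ _ (theta_op A) (m%:R * complex.Re `|A|)) => y.
by rewrite !yvec_normE -rmorphM lecR theta_op_bound.
Qed.

Definition theta A : bop Y := BOp (theta_bop A).

Lemma theta_linear : linear theta.
Proof.
move=> a A B; apply/val_inj/funext => y.
suff : theta_op (a *: A + B) y = a *: theta_op A y + theta_op B y by [].
apply: eq_yvec => i; rewrite yvecD yvecZ !theta_opE scaler_sumr -big_split.
by apply: eq_bigr => j _; rewrite !mxE scalerDl scalerA.
Qed.

HB.instance Definition _ := GRing.isLinear.Build C (utmx C m) (bop Y) *:%R theta theta_linear.

Lemma thetaM A B : theta (A * B) = theta A * theta B.
Proof.
apply/val_inj/funext => y.
suff : theta_op (A * B) y = theta_op A (theta_op B y) by [].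
apply: eq_yvec => i; rewrite !theta_opE.
under [RHS]eq_bigr do rewrite theta_opE scaler_sumr.
rewrite exchange_big; apply: eq_bigr => j _.
by rewrite mxE scaler_suml; apply: eq_bigr => k _; rewrite scalerA.
Qed.

Lemma theta_continuous : continuous theta.
Proof.
apply: (@bounded_continuous _ _ theta m%:R) => A.
apply: ge_opnorm => y y1.
set a := complex.Re `|A|; have aE : `|A| = a%:C by rewrite RRe_real// normr_real.
have a0 : 0 <= a by rewrite -lecR -aE normr_ge0.
rewrite aE -rmorphM yvec_normE lecR (le_trans (theta_op_bound A y))//.
by rewrite ler_piMr ?mulr_ge0//; move: y1; rewrite yvec_normE lecR.
Qed.

Lemma thetaK : psi \o theta = idfun.
Proof.
apply/funext => A; apply/val_inj/matrixP => i j; rewrite !mxE; apply: entry_scalar_eq.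
apply: scalar_part_ext (@scalar_part_scale _ (coord_set m j) (A i j)) => x Fx.
transitivity (theta_op A (inY j x) i); last by [].
rewrite theta_opE (bigD1 j)// inYE// eqxx big1 ?Monoid.mulm1// => k /andP[_ kj].
by rewrite inYE// (negbTE kj) scaler0.
Qed.

End Representation.

(** * Strictly singular operators *)

Section LinearAlgebra.
Variables (K : numFieldType) (Y : normedModType K).
Implicit Types W : set Y.

Lemma independent_not_fd W (e : nat -> Y) : (forall k, W (e k)) ->
  (forall n (c : nat -> K), \sum_(k < n) c k *: e k = 0 -> forall k, (k < n)%N -> c k = 0) ->
  ~ finite_dimensional W.
Proof.
move=> We ind [n [b Wb]].
have ex k : exists c : 'I_n -> K, e k = \sum_(i < n) c i *: b i.
  by have := We k; rewrite Wb => -[c _ <-]; exists c.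
have [M MP] := choice ex.
pose A : 'M[K]_(n.+1, n) := \matrix_(k, i) M k i.
have /rowV0Pn[v vA v0] : kermx A != 0.
  rewrite kermx_eq0 /row_free; apply/negP => /eqP rA.
  by have := rank_leq_col A; rewrite rA ltnn.
move/sub_kermxP: vA => vA; case/negP: v0; apply/eqP/rowP => k; rewrite mxE.
pose c l := if insub l is Some o then v 0 o else 0.
have ck (o : 'I_n.+1) : c o = v 0 o by rewrite /c valK.
rewrite -ck; apply: (ind n.+1 c) (ltn_ord k).
under eq_bigr do rewrite ck MP scaler_sumr.
rewrite exchange_big big1// => i _.
under eq_bigr do rewrite scalerA.
rewrite -scaler_suml; have := congr1 (fun B : 'rV_n => B 0 i) vA.
by rewrite !mxE; under eq_bigr do rewrite mxE; move=> ->; rewrite scale0r.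
Qed.

Lemma fd_ker W (lam : Y -> K) : (forall a x y, lam (a *: x + y) = a * lam x + lam y) ->
  linear_subspace W -> finite_dimensional (W `&` [set y | lam y = 0]) ->
  finite_dimensional W.
Proof.
move=> llin [W0 Wlin] [n [b Wb]].
have [[w Ww lw]|nw] := pselect (exists2 w, W w & lam w != 0); last first.
  exists n, b; rewrite -Wb; apply/seteqP; split=> [y Wy|y []//]; split => //=.
  by apply/eqP; apply: contrapT => /negP ly; apply: nw; exists y.
have bW c : W (\sum_(i < n) c i *: b i).
  suff : (W `&` [set y | lam y = 0]) (\sum_(i < n) c i *: b i) by case.
  by rewrite Wb; exists c.
exists n.+1, (fun i => if unlift ord0 i is Some k then b k else w).
apply/seteqP; split => [y Wy|_ [c _ <-]].
  pose a := lam y / lam w.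
  have : (W `&` [set y | lam y = 0]) (- a *: w + y).
    by split; [exact: Wlin|rewrite /= llin mulNr /a divfK// addNr].
  rewrite Wb => -[c _ cy].
  exists (fun i => if unlift ord0 i is Some k then c k else a) => //.
  rewrite big_ord_recl unlift_none; under eq_bigr do rewrite liftK.
  by rewrite cy addrA scaleNr subrr add0r.
rewrite big_ord_recl unlift_none; apply: Wlin => //.
by under eq_bigr do rewrite liftK; exact: bW.
Qed.

End LinearAlgebra.

(** * RIS vectors in subspaces and the kernel of [psi] *)

Section StrictlySingularPart.
Variables (R : realType) (m : nat).
Local Notation C := R[i].
Local Notation Y := (yvec R m).
Hypothesis m_gt0 : (0 < m)%N.
Implicit Types (j : 'I_m) (x : nat -> C) (T U : bop Y) (W : set Y).

(** Each coordinate condition preserves infinite dimension, by [fd_ker]. *)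
Lemma vanishing_vector (s : seq ('I_m * nat)) W : linear_subspace W ->
  ~ finite_dimensional W ->
  exists w, [/\ W w, w != 0 & forall ji, ji \in s -> w ji.1 ji.2 = 0].
Proof.
elim: s W => [|[j i] s IH] W Ws nW.
  apply: contrapT => h; apply: nW; exists 0%N, (fun=> 0).
  apply/seteqP; split => [y Wy|_ [c _ <-]]; last by rewrite big_ord0; case: Ws.
  exists (fun=> 0) => //; rewrite big_ord0; apply/esym/eqP; apply: contrapT => /negP y0.
  by apply: h; exists y.
have llin a (x y : Y) : (a *: x + y) j i = a * x j i + y j i by [].
have [W0 Wlin] := Ws.
have [|fd|w [[Ww w0] wn ws]] := IH (W `&` [set y : Y | y j i = 0]).
- split => [|a x y [Wx x0] [Wy y0]]; first by split.
  split; first exact: Wlin.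
  suff : (a *: x + y) j i = 0 by [].
  by rewrite llin (x0 : x j i = 0) (y0 : y j i = 0) mulr0 addr0.
- by apply: nW; apply: (fd_ker (lam := fun y : Y => y j i)).
- by exists w; split => // ji; rewrite inE => /orP[/eqP->|/ws].
Qed.

Lemma cutY_mem p q (y : Y) : (fun j => cutv p q (y j)) \in @yvec_pred R m.
Proof.
rewrite inE; split.
  by move=> j i ji; rewrite /cutv; case: ifP => // _; exact: yvec_supp.
exists (yn y) => j; apply: bnd_cut; exact: bnd_le (nrm_le_yn _ _) (@yvec_bnd _ _ y j).
Qed.

Definition cutY p q (y : Y) : Y := YVec (cutY_mem p q y).

Lemma yn_cutY p q y : yn (cutY p q y) <= yn y.
Proof. by apply: ler_sum => j _; apply/nrm_le/bnd_cut/yvec_bnd. Qed.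

Lemma yn_ge0 (y : Y) : 0 <= yn y.
Proof. by apply: sumr_ge0 => j _; exact: nrm_ge0. Qed.

Lemma ynZ (a : C) (y : Y) : yn (a *: y) = cabs a * yn y.
Proof.
have := @normrZ _ Y a y; rewrite !yvec_normE cabsE -rmorphM => /(congr1 (@complex.Re R)).
by [].
Qed.

Lemma ynB_ge (y z : Y) : yn y - yn (y - z) <= yn z.
Proof.
by have := ynD z (y - z); rewrite [z + _]addrC subrK; lra.
Qed.

(** Vanishing on the first [p] coordinates takes care of the left end; [tail_small], applied to the
    [m] components with [eps / m], provides the right end. *)
Lemma normalized_block (W : set Y) p (eps : R) : linear_subspace W ->
  ~ finite_dimensional W -> 0 < eps ->
  exists vq : Y * nat, [/\ W vq.1, yn vq.1 = 1, (p < vq.2)%N &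
    yn (vq.1 - cutY p vq.2 vq.1) <= eps].
Proof.
move=> Ws nW e0.
pose s := [seq (j, i) | j <- enum 'I_m, i <- iota 0 p].
have [w [Ww w0 ws]] := vanishing_vector s Ws nW.
have nw : 0 < yn w.
  rewrite lt_neqAle yn_ge0 andbT eq_sym; apply: contra w0 => /eqP h.
  by rewrite (yn_eq0 h).
pose v : Y := (yn w)^-1%:C *: w.
have Wv : W v by have [W0 Wl] := Ws; rewrite /v -[_ *: _]addr0; exact: Wl.
have v1 : yn v = 1.
  by rewrite /v ynZ cabsR ger0_norm ?invr_ge0 ?ltW// mulVf// gt_eqF.
have em : 0 < eps / m%:R by rewrite divr_gt0// ltr0n.
have [q qP] := choice (fun j => tail_small (@yvec_bnd _ _ v j) em).
exists (v, (p.+1 + \sum_j q j)%N); split => //=; first exact: leq_addr.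
have -> : eps = m%:R * (eps / m%:R) by rewrite mulrCA divff ?mulr1// pnatr_eq0 -lt0n.
apply: ler_sum_const => j; apply: nrm_le.
have vp i : (i < p)%N -> v j i = 0.
  move=> ip; rewrite /v yvecZ fctE (ws (j, i)) ?scaler0//.
  by apply/allpairsP; exists (j, i); rewrite /= mem_enum mem_iota.
set N := (p.+1 + _)%N.
suff H : bnd (v j - cutv p N (v j)) (eps / m%:R) by exact: H.
have -> : cutv p N (v j) = cutv 0 N (v j).
  apply/funext => i; rewrite /cutv leq0n; case: (leqP p i) => // ip.
  by rewrite vp// !if_same.
by apply: qP; rewrite /N (bigD1 j)//= addnCA leq_addr.
Qed.

Section Averages.
Variables (n : nat) (p : nat -> nat) (B : nat -> Y).
Hypotheses (n0 : (3 < n)%N) (pm : forall k, (p k < p k.+1)%N).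

(** The factor is [2 / n] where an average would have [1 / n]: positive lower bounds double at each
    step. At the first level where some norm exceeds 1, half of that vector is a plain average of
    vectors of norm at most 1, yet has norm above [2^-1]. *)
Fixpoint level (t : nat) : nat -> Y :=
  if t is t'.+1 then fun i => (2 / n%:R : R)%:C *: \sum_(k < n) level t' (i * n + k) else B.

Lemma levelS t i :
  level t.+1 i = (2 / n%:R : R)%:C *: \sum_(k < n) level t (i * n + k).
Proof. by []. Qed.

Lemma level_closed (W : set Y) t i : linear_subspace W -> (forall k, W (B k)) -> W (level t i).
Proof.
move=> [W0 Wl] WB; elim: t i => [|t IH] i //=.
have WS (F : nat -> Y) N : (forall k, W (F k)) -> W (\sum_(k < N) F k).
  move=> WF; elim/big_ind: _ => // x y Wx Wy.
  by rewrite -[x]scale1r; exact: Wl.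
by rewrite -[_ *: _]addr0; apply: Wl => //; exact: (WS (fun k => level t (i * n + k))).
Qed.

Lemma p_leq k l : (k <= l)%N -> (p k <= p l)%N.
Proof. by apply: mono_leq => h; exact: ltnW. Qed.

Hypothesis sB : forall k j, supp (p k) (p k.+1) (B k j).

Lemma level_supp t i j : supp (p (i * n ^ t)) (p (i.+1 * n ^ t)) (level t i j).
Proof.
elim: t i => [|t IH] i; first by rewrite !muln1; exact: sB.
rewrite levelS yvecZ yvec_sum; apply/suppZ/supp_sum => k _ _.
apply: supp_sub (IH _); apply: p_leq.
  by rewrite expnS mulnA leq_mul2r leq_addr orbT.
rewrite expnS mulnA leq_mul2r; apply/orP; right.
by rewrite mulSn; have := ltn_ord k; lia.
Qed.

Lemma two_div_n : 0 <= (2 / n%:R : R) <= 2^-1.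
Proof.
have n4 : (4 : R) <= n%:R by rewrite ler_nat.
by rewrite divr_ge0//= ler_pdivrMr; lra.
Qed.

Lemma level_functional (Phi : Y -> R) (al : R) N :
  (forall (a : R) y z, Phi (a%:C *: y) = a * Phi y /\ Phi (y + z) = Phi y + Phi z) ->
  (forall k, (k < N)%N -> al <= Phi (B k)) ->
  forall t i, (i.+1 * n ^ t <= N)%N -> 2 ^+ t * al <= Phi (level t i).
Proof.
move=> Plin PB; elim=> [|t IH] i iN.
  by rewrite expr0 mul1r; apply: PB; rewrite -[ltnLHS](muln1) -(expn0 n) in iN *.
have PS (F : nat -> Y) M : Phi (\sum_(k < M) F k) = \sum_(k < M) Phi (F k).
  elim: M => [|M IHM]; first by rewrite !big_ord0 -(scale0r 0); have [-> _] := Plin 0 0 0; rewrite mul0r.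
  by rewrite !big_ord_recr/=; have [_ ->] := Plin 0 (\sum_(k < M) F k) (F M); rewrite IHM.
rewrite levelS; have [-> _] := Plin (2 / n%:R) (\sum_(k < n) level t (i * n + k)) 0.
rewrite (PS (fun k => level t (i * n + k))).
have np : 0 < n%:R :> R by rewrite ltr0n (ltn_trans _ n0).
have -> : 2 ^+ t.+1 * al = 2 / n%:R * (\sum_(k < n) 2 ^+ t * al).
  by rewrite sumr_const card_ord -mulr_natl exprS; field; rewrite lt0r_neq0.
rewrite ler_wpM2l ?divr_ge0//; apply: ler_sum => k _; apply: IH.
apply: leq_trans iN; rewrite expnS mulnA leq_mul2r; apply/orP; right.
by rewrite mulSn; have := ltn_ord k; lia.
Qed.

(* Here the even weights provide lower estimates for successive blocks: after
   sufficiently many averaging steps the norm must exceed 1. *)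
Lemma level_large : (forall k, 2^-1 <= yn (B k)) -> exists t i, 1 < yn (level t i).
Proof.
(* [q] is even and so large that [n ^ s] blocks fit into one functional of weight [q]. The [s] steps
   multiply lower bounds by [2 ^+ s], which is [8 * weight R q]. *)
move=> B2; pose q := (n.+1).*2; pose s := (2 ^ q + 3)%N.
have ns : (n ^ s <= arity q)%N.
  rewrite arityE (@leq_trans ((16 * prev_arity q) ^ s))//.
    rewrite leq_exp2r; last by rewrite /s addn_gt0 orbT.
    have nq : (n <= prev_arity q)%N.
      by rewrite /q doubleS /prev_arity (leq_trans _ (ltnW (arity_gtn _)))// -addnn ltnW// ltnS leq_addr.
    by rewrite (leq_trans nq)// leq_pmull.
  rewrite leq_pexp2l ?muln_gt0 ?prev_arity_gt0// /s expnS mul2n -addnn leq_add2l.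
  by rewrite (leq_trans _ (ltn_expl q (isT : 1 < 2)%N))// /q doubleS.
have ex l j : exists gt : {poly C} * R, [/\ D gt.1, psupp (p l) (p l.+1) gt.1,
    ev gt.1 (B l j) = gt.2%:C & nrm (B l j) / 2 <= gt.2].
  have [g Dg gB] := near_norming (@yvec_bnd _ _ (B l) j).
  have [u [u1 ug]] := phaseP (ev g (B l j)).
  exists (u *: cut (p l) (p l.+1) g, cabs (ev g (B l j))); split => /=.
  - by apply: D_scale => //; exact: norming_cut.
  - by move=> i ii; rewrite coefZ psupp_cut// mulr0.
  - by rewrite evZl ev_cut cutv_id.
  - by rewrite ler_pdivrMr// mulrC; apply: nrm_le.
have [gt gtP] : exists gt : nat -> 'I_m -> {poly C} * R, forall l j,
    [/\ D (gt l j).1, psupp (p l) (p l.+1) (gt l j).1,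
    ev (gt l j).1 (B l j) = (gt l j).2%:C & nrm (B l j) / 2 <= (gt l j).2].
  have [gt gtP] := choice (fun lj : nat * 'I_m => ex lj.1 lj.2).
  by exists (fun l j => gt (l, j)) => l j; exact: (gtP (l, j)).
pose N := (n ^ s)%N.
pose F j : {poly C} := (weight R q)^-1%:C *: \sum_(l < N) (gt l j).1.
have DF j : D (F j).
  apply: (@norming_weight _ q); apply: (@norming_even _ q N p (fun l => (gt l j).1)) => //.
  - by rewrite /q odd_double.
  - by move=> l; exact: ltnW.
  - by move=> l _; have [] := gtP l j.
  - by move=> l _; have [] := gtP l j.
pose Phi (y : Y) : R := \sum_j complex.Re (ev (F j) (y j)).
have Phi_le y : Phi y <= yn y.
  apply: ler_sum => j _; rewrite (le_trans (Re_le_cabs _))//.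
  exact: (@yvec_bnd _ _ y j).
have Phi_lin (a : R) y z : Phi (a%:C *: y) = a * Phi y /\ Phi (y + z) = Phi y + Phi z.
  split; last by rewrite /Phi -big_split; apply: eq_bigr => j _; rewrite yvecD evDr raddfD.
  rewrite /Phi mulr_sumr; apply: eq_bigr => j _; rewrite yvecZ evZr.
  by case: (ev _ _) => u v; rewrite /= mul0r subr0.
(* The [4^-1] is one half from the size of the blocks times one half from [near_norming]; after [s]
   steps the bound becomes 2. *)
have Phi_B l : (l < N)%N -> (weight R q)^-1 * 4^-1 <= Phi (B l).
  move=> lN.
  have -> : Phi (B l) = (weight R q)^-1 * \sum_j (gt l j).2.
    rewrite /Phi mulr_sumr; apply: eq_bigr => j _.
    rewrite evZl ev_suml (bigD1 (Ordinal lN))//= big1 ?addr0; last first.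
      move=> k kl; have [_ sg _ _] := gtP k j; apply: (ev_disjoint sg (@sB l j)).
      have : (k : nat) != l by apply: contra kl => /eqP e; apply/eqP/val_inj.
      by rewrite neq_ltn => /orP[] h; apply/orP; [right|left]; exact: p_leq.
    by have [_ _ -> _] := gtP l j; rewrite -rmorphM.
  rewrite ler_wpM2l ?invr_ge0 ?weight_ge0//.
  apply: (@le_trans _ _ (yn (B l) / 2)); first by have := B2 l; lra.
  by rewrite /yn mulr_suml; apply: ler_sum => j _; have [] := gtP l j.
exists s, 0%N; apply: lt_le_trans (Phi_le _).
apply: lt_le_trans (level_functional Phi_lin Phi_B (t := s) (i := 0%N) _); last by rewrite mul1n.
have -> : 2 ^+ s * ((weight R q)^-1 * 4^-1) = 2 :> R.
  by rewrite /s exprD -/(weight R q) (_ : 2 ^+ 3 = 8) ?expr2; [|rewrite !exprS expr0; lra]; field; rewrite lt0r_neq0// weight_gt0.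
by rewrite ltr1n.
Qed.

(** A functional of weight [v < P] has at most [arity P] pieces. By [split_le] the blocks meeting a
    breakpoint contribute at most [(arity P).+1 / n] to the average, and the others at most
    [1 / weight R v]; the size of [n] makes the first contribution at most [1 / weight R v] too. *)
Lemma average_ris_vec t i P : (P <= p 0)%N -> ((arity P).+1 * 2 ^ (2 ^ P) <= n)%N ->
  (forall k, yn (level t k) <= 1) -> forall j,
  ris_vec (coord_set m j) 2 P (((2^-1 : R)%:C *: level t.+1 i) j).
Proof.
move=> Pp nP lev1 j.
pose x k := level t (i * n + k) j; pose a k := p ((i * n + k) * n ^ t).
have np : 0 < n%:R :> R by rewrite ltr0n (ltn_trans _ n0).
have xE : ((2^-1 : R)%:C *: level t.+1 i) j = (n%:R^-1 : R)%:C *: \sum_(k < n) x k.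
  rewrite levelS yvecZ yvecZ yvec_sum scalerA -rmorphM; congr ((_%:C) *: _).
  by field; rewrite lt0r_neq0.
have am k : (a k < a k.+1)%N.
  rewrite (leq_trans (pm _))// p_leq// ltn_mul2r expn_gt0 (ltn_trans _ n0)//=.
  by rewrite addnS.
have sx k : supp (a k) (a k.+1) (x k) by rewrite /a addnS; exact: level_supp.
have x1 k : bnd (x k) 1.
  by apply: bnd_le (@yvec_bnd _ _ (level t (i * n + k)) j); rewrite (le_trans (nrm_le_yn _ _)).
rewrite xE; split.
- exists (a n); apply/suppZ/supp_sum => k _ _; apply: supp_sub (sx k).
    by rewrite (leq_trans Pp)// p_leq.
  have am' l : (a l <= a l.+1)%N by exact: ltnW.
  exact: (mono_leq am' (ltn_ord k)).
- move=> l Sl; rewrite fctE fct_sumE big1 ?scaler0// => k _; exact: yvec_supp.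
- move=> f Df; rewrite evZr cabsM cabsR ger0_norm ?invr_ge0// mulrC ler_pdivrMr//.
  have := bnd_sum_cnt n xpredT Df x1; rewrite cnt_predT; lra.
- move=> v vP f Wf; rewrite evZr cabsM cabsR ger0_norm ?invr_ge0// mulrC ler_pdivrMr//.
  have [d [b [h wf]]] := W_weighted Wf; have [dv bm Dh sh _] := wf.
  have wg := weight_gt0 R v.
  have := @split_le _ d b a h x n xpredT (weight R v) 0 1 bm am sh sx (weight_ge0 R v) ler01 _ _.
  rewrite (cabs_weighted _ wf) cnt_predT mul1r mulr0 addr0 => H.
  rewrite -(ler_pM2l wg) (le_trans (H _ _))//.
  + by move=> k; rewrite (cabs_weighted _ wf) ler_piMr ?weight_ge0//; exact/x1/norming_weight/Wf.
  + by move=> l A' ld; rewrite add0r; exact: bnd_sum_cnt (Dh l ld) x1.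
  + have -> : weight R v * (2 / weight R v * n%:R) = n%:R + n%:R by field; rewrite lt0r_neq0.
    rewrite lerD2r (le_trans _ (_ : ((arity P).+1 * 2 ^ (2 ^ P))%:R <= n%:R))//; last by rewrite ler_nat.
    rewrite natrM natrX mulrC ler_pM ?weight_ge0//; last by apply: weight_le; exact: ltnW.
    by rewrite ler_nat ltnS (leq_trans dv)// arity_mono// ltnW.
Qed.

End Averages.

(** Errors do not grow with [t]: [2 / n] is at most one half, and the vectors entering
    [level t.+1 i] have indices from [i * n] on, where the errors are geometrically small. *)
Lemma level_err n (V B : nat -> Y) (eta : R) : (3 < n)%N -> 0 <= eta ->
  (forall k, yn (V k - B k) <= 2^-1 ^+ k.+1 * eta) ->
  forall t i, yn (level n V t i - level n B t i) <= 2^-1 ^+ i.+1 * eta.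
Proof.
move=> n0 e0 VB; elim=> [|t IH] i; first exact: VB.
rewrite !levelS; have /andP[h0 h1] := two_div_n n0.
rewrite -scalerBr -sumrB ynZ cabsR ger0_norm//.
apply: (@le_trans _ _ (2^-1 * (2^-1 ^+ i * eta))); last by rewrite exprS mulrA.
rewrite ler_pM ?yn_ge0// (le_trans (yn_sum _ _ _))//.
apply: (@le_trans _ _ (\sum_(k < n) 2^-1 ^+ i * (2^-1 ^+ k.+1 * eta))).
  apply: ler_sum => k _; rewrite (le_trans (IH _))// mulrA -exprD ler_wpM2r//.
  rewrite ler_wiXn2l ?invr_ge0 ?invf_le1 ?ler1n// addnS ltnS leq_add2r.
  by rewrite leq_pmulr// (ltn_trans _ n0).
rewrite -mulr_sumr -mulr_suml ler_wpM2l ?exprn_ge0 ?invr_ge0//.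
by rewrite ler_piMl// sum_halves.
Qed.

(** The same averaging is applied to normalized vectors [V k] of [W] and to their truncations [B k],
    which are successive; [w] and [w'] are halves of the resulting vectors. *)
Lemma RIS_in_subspace (W : set Y) P (eta : R) : linear_subspace W ->
  ~ finite_dimensional W -> 0 < eta -> eta <= 2^-1 ->
  exists w w' : Y, [/\ W w, forall j, ris_vec (coord_set m j) 2 P (w' j), yn (w - w') <= eta &
    2^-1 <= yn w'].
Proof.
move=> Ws nW e0 e1.
have h k : 0 < 2^-1 ^+ k.+1 * eta by rewrite mulr_gt0// exprn_gt0// invr_gt0.
have [nx nxP] := choice (fun p => normalized_block p Ws nW (h p)).
pose p k := iter k (fun p => (nx p).2) P.
pose V k := (nx (p k)).1; pose B k := cutY (p k) (p k.+1) (V k).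
have pm k : (p k < p k.+1)%N by have [] := nxP (p k).
have WV k : W (V k) by have [] := nxP (p k).
have V1 k : yn (V k) = 1 by have [] := nxP (p k).
have VB k : yn (V k - B k) <= 2^-1 ^+ k.+1 * eta.
  have [_ _ _] := nxP (p k); move/le_trans; apply.
  by rewrite ler_wpM2r ?(ltW e0)// ler_wiXn2l ?invr_ge0 ?invf_le1 ?ler1n// ltnS gtn_id.
have B1 k : yn (B k) <= 1 by rewrite -(V1 k) yn_cutY.
have half1 k : 2^-1 ^+ k <= 1 :> R by rewrite exprn_ile1 ?invr_ge0// invf_le1// ler1n.
have B2 k : 2^-1 <= yn (B k).
  apply: le_trans (ynB_ge (V k) (B k)); rewrite V1.
  have := VB k; have := ler_wpM2r (ltW e0) (half1 k.+1); lra.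
have sB k j : supp (p k) (p k.+1) (B k j) by exact: supp_cutv.
pose n := maxn 4 ((arity P).+1 * 2 ^ (2 ^ P)).
have n0 : (3 < n)%N by exact: leq_maxl.
have [t0 [i0 ti0]] := level_large n0 pm sB B2.
have ext : exists t, `[< exists i, 1 < yn (level n B t i) >].
  by exists t0; apply/asboolP; exists i0.
(* Minimality bounds all vectors of level [t] by 1, as [average_ris_vec] requires; level 0 is
   excluded because the blocks have norm at most 1. *)
case: (ex_minnP ext) => -[|t] /asboolP[i ti] tmin.
  by move: ti; rewrite ltNge B1.
have lev1 k : yn (level n B t k) <= 1.
  rewrite leNgt; apply/negP => tk; have := tmin t; rewrite ltnn => H; apply/notF/H.
  by apply/asboolP; exists k.
exists ((2^-1 : R)%:C *: level n V t.+1 i), ((2^-1 : R)%:C *: level n B t.+1 i).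
have i2 : 0 <= 2^-1 :> R by rewrite invr_ge0.
split.
- have [W0 Wl] := Ws; rewrite -[_ *: _]addr0; apply: Wl => //.
  exact: level_closed.
- by apply: average_ris_vec => //; exact: leq_maxr.
- rewrite -scalerBr ynZ cabsR ger0_norm//.
  apply: (@le_trans _ _ (1 * (1 * eta))); last by rewrite !mul1r.
  rewrite ler_pM ?yn_ge0//; first by rewrite invf_le1// ler1n.
  rewrite (le_trans (level_err n0 (ltW e0) VB _ _))//.
  by rewrite ler_wpM2r ?(ltW e0).
- by rewrite ynZ cabsR ger0_norm// ler_peMr// ltW.
Qed.

Lemma sum_inY (y : Y) : (forall j, fin (coord_set m j) (y j)) -> y = \sum_j inY j (y j).
Proof.
move=> Fy; apply: eq_yvec => k; rewrite yvec_sum (bigD1 k)//.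
rewrite big1 ?Monoid.mulm1 => [|l /andP[_ lk]]; first by rewrite inYE// eqxx.
by rewrite inYE// eq_sym (negbTE lk).
Qed.

Lemma bounded_below_yn T W : bounded_below_on T W ->
  exists2 c : R, 0 < c & forall w, W w -> c * yn w <= yn (T w).
Proof.
move=> [c c0 cW]; have cE : c = (complex.Re c)%:C by rewrite RRe_real// gtr0_real.
exists (complex.Re c); first by rewrite -ltcR -cE.
by move=> w /cW; rewrite cE !yvec_normE -rmorphM lecR.
Qed.

Lemma psi_eq0_ss T : psi m_gt0 T = 0 -> strictly_singular Y T.
Proof.
move=> T0 W Ws /bounded_below_yn[c c0 cW]; apply: contrapT => nW.
have s0 k j : entry_scalar m_gt0 T k j = 0.
  have := congr1 (fun A : utmx C m => utmx_mx A k j) T0.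
  by rewrite /= mxE => ->; rewrite mxE.
have M0 := real_opnorm_ge0 T; set M := real_opnorm T in M0.
(* Chosen to have both [M * eta <= c / 16] and [eta <= 4^-1]. Then
   [c / 4 <= c * yn w <= yn (T w) <= c / 8], a contradiction. *)
pose eta := c / (16 * (M + 1) + 4 * c).
have den : 0 < 16 * (M + 1) + 4 * c by lra.
have eta0 : 0 < eta by rewrite divr_gt0.
have eta4 : eta <= 4^-1 by rewrite ler_pdivrMr//; lra.
have Meta : M * eta <= c / 16.
  rewrite /eta mulrA ler_pdivrMr// -mulrA (mulrC M) ler_wpM2l ?(ltW c0)//; lra.
have m0 : 0 < m%:R :> R by rewrite ltr0n.
have e0 : 0 < c / 16 / m%:R by rewrite divr_gt0// divr_gt0.
have [P HP] := choice (fun j => entry_scalar_column m_gt0 T j 2 e0).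
have eta2 : eta <= 2^-1 by lra.
have [w [w' [Ww Qw' ww' w'2]]] := RIS_in_subspace (\sum_j P j) Ws nW eta0 eta2.
have Tw' : yn (T w') <= c / 16.
  rewrite (@sum_inY w'); last by move=> j; exact: ris_vec_fin (Qw' j).
  rewrite linear_sum (le_trans (yn_sum _ _ _))//.
  have -> : c / 16 = m%:R * (c / 16 / m%:R) by field; rewrite lt0r_neq0.
  apply: ler_sum_const => j.
  have Qj : ris_vec (coord_set m j) 2 (P j) (w' j).
    by apply: ris_vec_le (Qw' j) => //; rewrite (bigD1 j)//= leq_addr.
  have := HP j _ Qj; rewrite big1 ?subr0// => k _; by rewrite s0 scale0r.
have Tw : yn (T w) <= c / 16 + c / 16.
  have -> : T w = T w' + T (w - w') by rewrite -linearD addrC subrK.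
  rewrite (le_trans (ynD _ _))// lerD// (le_trans (le_real_opnorm _ _))//.
  by rewrite (le_trans _ Meta)// ler_wpM2l.
have yw : 4^-1 <= yn w.
  have := ynB_ge w' w; have -> : w' - w = (-1) *: (w - w') by rewrite scaleN1r opprB.
  by rewrite ynZ cabsN cabs1 mul1r; lra.
have := cW w Ww; have := ler_wpM2l (ltW c0) yw; lra.
Qed.

Lemma ss_psi_eq0 T : strictly_singular Y T -> psi m_gt0 T = 0.
Proof.
move=> Tss; apply/val_inj/matrixP => i j; rewrite [LHS]mxE [RHS]mxE.
apply: contrapT => /eqP L0; set L := entry_scalar m_gt0 T i j in L0.
have l0 : 0 < cabs L by exact: cabs_gt0.
have l2 : 0 < cabs L / 2 by rewrite divr_gt0.
have step p : exists ugq : (nat -> C) * {poly C} * nat, let: (u, g, q) := ugq in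
    [/\ fin (coord_set m j) u /\ supp p q u, (p < q)%N, D g /\ ev g u = 1 &
        bnd (entry T i j u - L *: u) (2^-1 ^+ p.+1 * (cabs L / 2))].
  have e0 : 0 < 2^-1 ^+ p.+1 * (cabs L / 2) by rewrite mulr_gt0// exprn_gt0// invr_gt0.
  have [P HP] := entry_scalarP m_gt0 T i j 3 e0.
  have [[u g] /= [Qu Dg gu _]] := reference_vector R (maxn p P) (@coord_set_unbounded m m_gt0 j).
  have [[q su] _ _ _] := Qu.
  exists (u, g, maxn q p.+1); split.
  - by split; [exact: ris_vec_fin Qu|apply: supp_sub su; rewrite leq_maxl].
  - exact: leq_maxr.
  - by [].
  - by apply/HP/(ris_vec_le _ _ Qu) => //; exact: leq_maxr.
have [nx nxP] := choice step.
pose p k := iter k (fun q => (nx q).2) 0%N.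
pose u k := (nx (p k)).1.1; pose g k := (nx (p k)).1.2.
have pS k : p k.+1 = (nx (p k)).2 by [].
have Fu k : fin (coord_set m j) (u k).
  by have := nxP (p k); rewrite /u; case: (nx _) => [[? ?] ?] [[]].
have su k : supp (p k) (p k.+1) (u k).
  by have := nxP (p k); rewrite /u pS; case: (nx _) => [[? ?] ?] [[]].
have pm k : (p k < p k.+1)%N.
  by have := nxP (p k); rewrite pS; case: (nx _) => [[? ?] ?] [].
have Dg k : D (g k) /\ ev (g k) (u k) = 1.
  by have := nxP (p k); rewrite /u /g; case: (nx _) => [[? ?] ?] [].
have Tu k : bnd (entry T i j (u k) - L *: u k) (2^-1 ^+ k.+1 * (cabs L / 2)).
  have kp : (k <= p k)%N by exact: gtn_id.
  have := nxP (p k); rewrite /u; case: (nx _) => [[? ?] ?] [_ _ _]; apply: bnd_le.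
  by rewrite ler_wpM2r ?(ltW l2)// ler_wiXn2l ?invr_ge0 ?invf_le1 ?ler1n.
pose S N (a : nat -> C) : nat -> C := \sum_(k < N) a k *: u k.
have FS N a : fin (coord_set m j) (S N a).
  by apply: (@fin_sum _ _ N (fun k => a k *: u k)) => k; exact: finZ.
have pm' k : (p k <= p k.+1)%N by exact: ltnW.
(* The cut of [g k] to the interval of [u k] reads off the coefficient [a k]. This gives the
   independence of the [u k] and lets the errors be measured by [nrm x]. *)
have aS N a k : (k < N)%N -> cabs (a k) <= nrm (S N a).
  move=> kN; have [c /bnd_nrm Sb] := fin_bnd (FS N a); have [Dgk gu] := Dg k.
  have := Sb _ (norming_cut (p k) (p k.+1) Dgk).
  rewrite ev_cut; suff -> : cutv (p k) (p k.+1) (S N a) = a k *: u k by rewrite evZr gu mulr1.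
  rewrite /S (bigD1 (Ordinal kN))//= cutvD cutvZ (cutv_id (su k)).
  suff -> : cutv (p k) (p k.+1) (\sum_(l < N | l != Ordinal kN) a l *: u l) = 0 by rewrite addr0.
  apply/funext => n; rewrite /cutv; case: ifP => // pn.
  rewrite fct_sumE big1// => l lk; rewrite fctE (su l) ?scaler0//.
  apply: contra lk => pl; apply/eqP/val_inj => /=; exact: mono_uniq pm' _ _ _ pl pn.
pose W := [set y : Y | exists N a, y = inY j (S N a)].
have pad N a N' : (N <= N')%N -> S N a = S N' (fun k => if (k < N)%N then a k else 0).
  move=> NN; rewrite /S (big_ord_widen N' (fun k => a k *: u k) NN) big_mkcond.
  by apply: eq_bigr => k _; case: ifP; rewrite ?scale0r.
have Ws : linear_subspace W.
  split; first by exists 0%N, (fun=> 0); apply: eq_yvec => k; rewrite inYE// /S big_ord0 if_same.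
  move=> b x y [N [a ->]] [N' [a' ->]].
  rewrite (pad N a (maxn N N')) ?leq_maxl// (pad N' a' (maxn N N')) ?leq_maxr//.
  set a1 := fun k => _; set a2 := fun k => _.
  exists (maxn N N'), (fun k => b * a1 k + a2 k); rewrite -inYD//; congr inY.
  rewrite /S scaler_sumr -big_split; apply: eq_bigr => k _.
  by rewrite scalerDl scalerA.
have Wu k : W (inY j (u k)).
  exists k.+1, (fun l => (l == k)%:R); congr inY; rewrite /S (bigD1 ord_max)//= eqxx scale1r.
  rewrite big1 ?addr0// => l lk; case: eqP => [e|]; last by rewrite scale0r.
  by case/negP: lk; apply/eqP/val_inj.
suff /(Tss W Ws) : bounded_below_on T W.
  apply: (@independent_not_fd _ Y W (fun k => inY j (u k))) => // N c Sc k kN.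
  apply: cabs_eq0; apply/eqP; rewrite eq_le cabs_ge0 andbT (le_trans (aS N c k kN))//.
  have -> : S N c = 0; last by rewrite nrm0.
  transitivity ((0 : Y) j); last by [].
  rewrite -Sc yvec_sum; apply: eq_bigr => l _.
  by rewrite yvecZ inYE// eqxx.
exists (cabs L / 2)%:C; first by rewrite ltcR.
move=> _ [N [a ->]]; rewrite !yvec_normE -rmorphM lecR yn_inY//.
apply: le_trans (nrm_le_yn (T (inY j (S N a))) i).
set x := S N a; have [c /bnd_nrm xb] := fin_bnd (FS N a).
have x0 : 0 <= nrm x by exact: bnd_ge0 xb.
(* Summing the errors costs at most half of [cabs L * nrm x], which leaves [cabs L / 2] as lower
   bound. *)
have Eb : bnd (\sum_(k < N) a k *: (entry T i j (u k) - L *: u k)) (nrm x * (cabs L / 2)).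
  apply: (@bnd_le _ _ (\sum_(k < N) nrm x * (2^-1 ^+ k.+1 * (cabs L / 2)))).
    by rewrite -mulr_sumr -mulr_suml ler_wpM2l// ler_piMl ?(ltW l2)// sum_halves.
  apply: bnd_sum => k _; apply: bnd_le (bndZ _ (Tu k)).
  rewrite ler_wpM2r ?aS// mulr_ge0 ?(ltW l2)// exprn_ge0// invr_ge0//.
have TxE : entry T i j x = L *: x + \sum_(k < N) a k *: (entry T i j (u k) - L *: u k).
  rewrite /x {1}/S (bop_sum (entry_bop T i j) _ (fun k => finZ (a k) (Fu k))).
  rewrite scaler_sumr -big_split; apply: eq_bigr => k _.
  rewrite (bopZ (entry_bop T i j))// scalerBr !scalerA [L * _]mulrC.
  by rewrite [RHS]addrC subrK.
have Lx : bnd (L *: x) (nrm (entry T i j x) + nrm x * (cabs L / 2)).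
  have -> : L *: x = entry T i j x - \sum_(k < N) a k *: (entry T i j (u k) - L *: u k).
    by rewrite TxE addrK.
  by apply: bndB => //; exact: (@yvec_bnd _ _ (T (inY j x)) i).
have : nrm x <= (cabs L)^-1 * (nrm (entry T i j x) + nrm x * (cabs L / 2)).
  have := bndZ L^-1 Lx; rewrite scalerA mulVf; last exact: L0.
  by rewrite scale1r cabsV; exact: nrm_le.
rewrite ler_pdivlMl// -[entry T i j x]/(T (inY j x) i); lra.
Qed.

Lemma yvec_not_fd : ~ finite_dimensional [set: Y].
Proof.
pose j := Ordinal m_gt0; pose e k : nat -> C := fun i => (i == k)%:R.
have Fe k : fin (coord_set m j) (e k).
  split; last by move=> i; rewrite /coord_set.
  by exists k.+1 => i; rewrite /e; case: eqP => // ->; rewrite leq0n ltnSn.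
apply: (@independent_not_fd _ Y _ (fun k => inY j (e k))) => // n c Sc k kn.
have := congr1 (fun y : Y => y j k) Sc; rewrite yvec_sum fct_sumE (bigD1 (Ordinal kn))//.
rewrite big1 ?Monoid.mulm1 => [|l /andP[_ lk]].
  by rewrite yvecZ inYE// eqxx fctE /e eqxx /GRing.scale/= mulr1.
rewrite yvecZ inYE// eqxx fctE /e; case: eqP => [h|_]; last exact: scaler0.
by case/negP: lk; apply/eqP/val_inj.
Qed.

End StrictlySingularPart.

Unset Implicit Arguments.

Theorem proposition4p5 (R : realType) (m : nat) (m_ge1 : (1 <= m)%N) :
  exists Y : completeNormedModType R[i],
    ~ finite_dimensional [set: Y] /\
    exists (psi : {linear bop Y -> utmx R[i] m})
           (theta : {linear utmx R[i] m -> bop Y}),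
      [/\ continuous psi /\ (forall S T : bop Y, psi (S * T) = psi S * psi T),
          continuous theta /\
            (forall A B : utmx R[i] m, theta (A * B) = theta A * theta B),
          short_exact (@set_val (bop Y) (strictly_singular Y)) psi
        & psi \o theta = idfun].
Proof.
exists (yvec R m); split; first exact: yvec_not_fd m_ge1.
exists (psi m_ge1), (@theta R m); split.
- by split; [exact: psi_continuous|exact: psiM].
- by split; [exact: theta_continuous|exact: thetaM].
- split.
  + by move=> S T; rewrite set_valE => /val_inj.
  + apply/seteqP; split=> [_ [S _ <-]|S S0].
      by apply: ss_psi_eq0; rewrite set_valE; exact: set_valP.
    by exists (SigSub (mem_set (psi_eq0_ss S0))); rewrite // set_valE.
  + apply/seteqP; split=> // A _; exists (theta A) => //.
    by rewrite -[LHS]/((psi m_ge1 \o @theta R m) A) thetaK.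
- exact: thetaK.
Qed.
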